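(* Suppose there are positive finite constants $c_\Psi,C_\Psi,c_h,C_h$ and exponents $0<\alpha\le2$, $0<\beta<d$ such that $c_\Psi|\xi|^\alpha\le\Psi(\xi)\le C_\Psi|\xi|^\alpha$ and $c_h|\xi|^{-\beta}\le h(\xi)\le C_h|\xi|^{-\beta}$ for all $\xi\in\mathbb R^d\setminus\{0\}$. Let $\theta_1=H-\frac{d-\beta}{2\alpha}$ and $\theta_2=\alpha\theta_1$, and suppose $\theta_1>0$ and $\theta_2<1$. Let $T$ be a compact rectangle in $(0,\infty)\times\mathbb R^d$. Then there exists a constant $c_2>0$ such that for any $n\ge1$ and any $(t,x),(t^1,x^1),\dots,(t^n,x^n)\in T$, $$\mathrm{Var}\big(u(t,x)\mid u(t^1,x^1),\dots,u(t^n,x^n)\big)\ge c_2\min_{1\le j\le n}\Delta^2\big((t,x),(t^j,x^j)\big),$$ where $\Delta((t,x),(s,y))=|t-s|^{\theta_1}+\sum_{j=1}^d|x_j-y_j|^{\theta_2}$. In particular, $\|u(t,x)-u(s,y)\|_{L^2}\ge\sqrt{c_2}\,\Delta((t,x),(s,y))$ for all $(t,x),(s,y)\in T$.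
   Context: Setting. $d\ge1$, $1/2\le H<1$. $X=\{X(t),t\ge0\}$ is a symmetric Lévy process in $\mathbb R^d$ with generator $\mathscr L$ and characteristic exponent $\Psi$, $\mathbb E[e^{i\xi\cdot X(t)}]=e^{-t\Psi(\xi)}$ (so $\Psi(\xi)=\Psi(-\xi)\ge0$), and $X(t)$ has density $p_t(x)=(2\pi)^{-d}\int_{\mathbb R^d}e^{-i\xi\cdot x}e^{-t\Psi(\xi)}d\xi$ for $t>0$. $u$ is the solution of $\partial_tu=\mathscr Lu+\dot W$ on $[0,\infty)\times\mathbb R^d$, $u(0,\cdot)=0$, where $\dot W$ is a centered Gaussian noise, fractional in time with Hurst index $H$ (white if $H=1/2$) and with spatial covariance $f$ having spectral measure $\mu(d\xi)=h(\xi)d\xi$, $h\ge0$ even. Precisely, for test functions $\varphi,\psi$ on $(0,\infty)\times\mathbb R^d$, $$\mathbb E[W(\varphi)W(\psi)]=c_{H,d}\int_{\mathbb R}d\tau\,|\tau|^{1-2H}\int_{\mathbb R^d}d\xi\,h(\xi)\,\mathcal F\varphi(\tau,\xi)\overline{\mathcal F\psi(\tau,\xi)},$$ with $\mathcal F\varphi(\tau,\xi)=\int_{\mathbb R^{1+d}}e^{-i\tau s-i\xi\cdot y}\varphi(s,y)\,ds\,dy$ and $c_{H,d}=b_H(2\pi)^{-d}$, where $b_H=H(2H-1)(2^{2(1-H)}\sqrt\pi)^{-1}\Gamma(H-1/2)/\Gamma(1-H)$ for $1/2<H<1$ and $b_{1/2}=(2\pi)^{-1}$. The isometry extends $W$ to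 the Hilbert space completion, and $$u(t,x)=\int_0^t\int_{\mathbb R^d}p_{t-s}(x-y)\,W(ds,dy)=W(G_{t,x}),\qquad G_{t,x}(s,y)=p_{t-s}(x-y)\mathbf 1_{[0,t]}(s),$$ which is well defined when $\int_{\mathbb R^d}\mu(d\xi)/(1+\Psi(\xi)^{2H})<\infty$. One has $\mathcal FG_{t,x}(\tau,\xi)=e^{-i\xi\cdot x}(e^{-i\tau t}-e^{-t\Psi(\xi)})/(\Psi(\xi)-i\tau)$. Thus $u$ is a centered Gaussian field with $\mathbb E[u(t,x)u(s,y)]=c_{H,d}\iint\mathcal FG_{t,x}\overline{\mathcal FG_{s,y}}\,|\tau|^{1-2H}h(\xi)\,d\tau\,d\xi$. Write $\|Y\|_{L^2}=(\mathbb E[Y^2])^{1/2}$. *)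

(* Defs.v *)
From HB Require Import structures.
From mathcomp Require Import all_boot all_order all_algebra.
From mathcomp Require Import all_classical all_reals all_analysis.
From mathcomp Require Import complex.

Set Implicit Arguments.
Unset Strict Implicit.
Unset Printing Implicit Defensive.

Import Order.TTheory GRing.Theory Num.Theory numFieldNormedType.Exports.

Local Open Scope classical_set_scope.
Local Open Scope ring_scope.
Local Open Scope complex_scope.

(* Borel sigma-algebra of R^d = 'rV[R]_d, generated by the coordinates (the same
   construction as the library's instance on n.-tuple T); the library has no
   measurable structure on matrices. *)
Section measurable_rowvector.
Variables (R : realType) (d : nat).
Let coord (i : 'I_d) (x : 'rV[R]_d) : R := x ord0 i.
Let rV_set0 : g_sigma_preimage coord set0.
Proof. exact: sigma_algebra0. Qed.
Let rV_setC A : g_sigma_preimage coord A -> g_sigma_preimage coord (~` A).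
Proof. exact: sigma_algebraC. Qed.
Let rV_bigcup (F : _^nat) : (forall i, g_sigma_preimage coord (F i)) ->
  g_sigma_preimage coord (\bigcup_i (F i)).
Proof. exact: sigma_algebra_bigcup. Qed.
HB.instance Definition _ := @isMeasurable.Build default_measure_display
  'rV[R]_d (g_sigma_preimage coord) rV_set0 rV_setC rV_bigcup.
End measurable_rowvector.

Section measurable_coordinates.
Variable R : realType.

Lemma measurable_coord d (i : 'I_d) :
  measurable_fun [set: 'rV[R]_d] (fun x : 'rV[R]_d => x ord0 i).
Proof.
move=> _ Y mY; rewrite setTI; apply: sub_sigma_algebra => /=.
rewrite -bigcup_seq/=; exists i => /=; first by rewrite mem_index_enum.
by exists Y => //; rewrite setTI.
Qed.

Lemma measurable_fun_rV d dT (T : measurableType dT) (f : T -> 'rV[R]_d) :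
  (forall i, measurable_fun setT (fun x => f x ord0 i)) -> measurable_fun setT f.
Proof.
move=> mf _ A mA; rewrite setTI.
suff: [set B | measurable (f @^-1` B)] A by [].
move: A mA; apply: smallest_sub.
  split => /=.
  - by rewrite preimage_set0; exact: measurable0.
  - by move=> B mB /=; rewrite setTD preimage_setC; exact: measurableC.
  - by move=> F mF /=; rewrite preimage_bigcup; exact: bigcup_measurable.
move=> B; rewrite -bigcup_seq => -[i _ [C mC <-]] /=.
rewrite setTI; have := mf i measurableT C mC.
by rewrite setTI.
Qed.

Definition rV_cons d (p : R * 'rV[R]_d) : 'rV[R]_d.+1 :=
  \row_j (if unlift ord0 j is Some k then p.2 ord0 k else p.1).
Definition rV_uncons d (x : 'rV[R]_d.+1) : R * 'rV[R]_d :=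
  (x ord0 ord0, \row_j x ord0 (lift ord0 j)).

Lemma rV_cons0 d (p : R * 'rV[R]_d) : rV_cons p ord0 ord0 = p.1.
Proof.
by rewrite mxE unlift_none.
Qed.

Lemma rV_consS d (p : R * 'rV[R]_d) (j : 'I_d) :
  rV_cons p ord0 (lift ord0 j) = p.2 ord0 j.
Proof.
by rewrite mxE liftK.
Qed.

Lemma rV_consK d : cancel (@rV_cons d) (@rV_uncons d).
Proof.
move=> [x y]; rewrite /rV_uncons rV_cons0; congr pair.
by apply/rowP => j; rewrite mxE rV_consS.
Qed.

Lemma rV_unconsK d : cancel (@rV_uncons d) (@rV_cons d).
Proof.
move=> x; apply/rowP => j; case: (unliftP ord0 j) => [k ->|->].
- by rewrite rV_consS mxE.
- by rewrite rV_cons0.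
Qed.

Lemma measurable_rV_cons d : measurable_fun [set: R * 'rV[R]_d] (@rV_cons d).
Proof.
apply: measurable_fun_rV => i; case: (unliftP ord0 i) => [j ->|->].
- rewrite (_ : (fun _ => _) = (fun x : 'rV[R]_d => x ord0 j) \o snd).
    exact: measurableT_comp (measurable_coord j) measurable_snd.
  by apply/funext => p; exact: rV_consS.
- rewrite (_ : (fun _ => _) = fst); first exact: measurable_fst.
  by apply/funext => p; exact: rV_cons0.
Qed.

Lemma measurable_rV_uncons d :
  measurable_fun [set: 'rV[R]_d.+1] (@rV_uncons d).
Proof.
apply/measurable_fun_pair; first exact: measurable_coord.
apply: measurable_fun_rV => i.
rewrite (_ : (fun _ => _) = (fun x : 'rV[R]_d.+1 => x ord0 (lift ord0 i))).
  exact: measurable_coord.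
by apply/funext => x; rewrite mxE.
Qed.

End measurable_coordinates.

(* If m is Lebesgue measure on R^d then lebesgue_rV_succ m is Lebesgue measure
   on R^(d+1), transported from R * R^d along rV_cons. *)
Section lebesgue_rV_succ.
Local Open Scope ereal_scope.
Variables (R : realType) (d : nat).
Variable m : {sigma_finite_measure set 'rV[R]_d -> \bar R}.

Let prod : {measure set (measurableTypeR R * 'rV[R]_d) -> \bar R} :=
  @lebesgue_measure R \x m.

Definition lebesgue_rV_succ : set 'rV[R]_d.+1 -> \bar R :=
  pushforward prod (@rV_cons R d).

Let succ0 : lebesgue_rV_succ set0 = 0.
Proof. by rewrite /lebesgue_rV_succ /pushforward preimage_set0 measure0. Qed.

Let succ_ge0 A : 0 <= lebesgue_rV_succ A.
Proof. exact: (@measure_ge0 _ _ _ prod). Qed.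

Let succ_sigma_additive : semi_sigma_additive lebesgue_rV_succ.
Proof.
move=> F mF tF mUF; rewrite /lebesgue_rV_succ /pushforward preimage_bigcup.
have mc (A : set 'rV[R]_d.+1) : measurable A -> measurable (@rV_cons R d @^-1` A).
  by move=> mA; rewrite -[X in measurable X]setTI; exact: measurable_rV_cons.
apply: (@measure_semi_sigma_additive _ _ _ prod).
- by move=> n; exact: mc.
- apply/trivIsetP => /= i j _ _ ij; rewrite -preimage_setI.
  by move/trivIsetP : tF => /(_ _ _ _ _ ij) ->//; rewrite preimage_set0.
- by rewrite -preimage_bigcup; exact: mc.
Qed.

HB.instance Definition _ := isMeasure.Build _ _ _ lebesgue_rV_succ
  succ0 succ_ge0 succ_sigma_additive.

Let succ_sigma_finite : sigma_finite setT lebesgue_rV_succ.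
Proof.
have /sigma_finiteP[F [FT ndF mF]] := sigma_finiteT (@lebesgue_measure R).
have /sigma_finiteP[G [GT ndG mG]] := sigma_finiteT m.
exists (fun n => @rV_uncons R d @^-1` (F n `*` G n)).
  apply/seteqP; split => // x _.
  have : (setT : set (measurableTypeR R)) (rV_uncons x).1 by [].
  rewrite FT => -[i _ Fi].
  have : setT (rV_uncons x).2 by [].
  rewrite GT => -[j _ Gj].
  exists (maxn i j) => //; split => /=.
  - by have /subsetPset := ndF _ _ (leq_maxl i j); exact.
  - by have /subsetPset := ndG _ _ (leq_maxr i j); exact.
move=> n; have mFG : measurable (F n `*` G n).
  by apply: measurableX; [exact: (mF n).1|exact: (mG n).1].
split.
  by rewrite -[X in measurable X]setTI; exact: measurable_rV_uncons.
rewrite /lebesgue_rV_succ /pushforward -comp_preimage.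
rewrite (_ : _ \o _ = id); last by apply/funext => p; exact: rV_consK.
rewrite preimage_id [ltLHS]product_measure1E; [|exact: (mF n).1|exact: (mG n).1].
apply: lte_mul_pinfty; first exact: measure_ge0.
- by rewrite ge0_fin_numE ?measure_ge0//; exact: (mF n).2.
- exact: (mG n).2.
Qed.

HB.instance Definition _ := @Measure_isSigmaFinite.Build _ _ _ lebesgue_rV_succ
  succ_sigma_finite.

End lebesgue_rV_succ.

Fixpoint lebesgue_rV (R : realType) (d : nat) :
    {sigma_finite_measure set 'rV[R]_d -> \bar R} :=
  match d return {sigma_finite_measure set 'rV[R]_d -> \bar R} with
  | 0 => [the {sigma_finite_measure set 'rV[R]_0 -> \bar R} of \d_(0 : 'rV[R]_0)]
  | d'.+1 => [the {sigma_finite_measure set 'rV[R]_d'.+1 -> \bar R}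
                of lebesgue_rV_succ (lebesgue_rV R d')]
  end.

Lemma measurable_box (R : realType) (d : nat) (lo hi : 'rV[R]_d) :
  measurable [set x : 'rV[R]_d | forall j, lo ord0 j <= x ord0 j <= hi ord0 j].
Proof.
rewrite (_ : [set _ | _] = \bigcap_(j in [set: 'I_d])
    ((fun x : 'rV[R]_d => x ord0 j) @^-1` `[lo ord0 j, hi ord0 j])).
  apply: fin_bigcap_measurable; first exact: finite_finset.
  move=> j _; rewrite -[X in measurable X]setTI.
  by apply: measurable_coord => //; exact: measurable_itv.
apply/seteqP; split => x /=.
  by move=> H j _ /=; rewrite in_itv /=; exact: H.
by move=> H j; have := H j I; rewrite /= in_itv.
Qed.

Lemma lebesgue_rV_box (R : realType) (d : nat) (lo hi : 'rV[R]_d) :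
  (forall j, lo ord0 j <= hi ord0 j) ->
  lebesgue_rV R d [set x : 'rV[R]_d | forall j, lo ord0 j <= x ord0 j <= hi ord0 j] =
  (\prod_(j < d) (hi ord0 j - lo ord0 j))%:E.
Proof.
elim: d lo hi => [|d IH] lo hi lohi.
  by rewrite big_ord0 /= diracE mem_set// => -[].
pose lo' := (rV_uncons lo).2; pose hi' := (rV_uncons hi).2.
have E : @rV_cons R d @^-1`
    [set x : 'rV[R]_d.+1 | forall j, lo ord0 j <= x ord0 j <= hi ord0 j] =
  `[lo ord0 ord0, hi ord0 ord0] `*`
  [set y : 'rV[R]_d | forall j, lo' ord0 j <= y ord0 j <= hi' ord0 j].
  apply/seteqP; split => [[x y] /= H|[x y] /= [Hx Hy] j].
    split => [|j]; first by have := H ord0; rewrite rV_cons0 in_itv.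
    by have := H (lift ord0 j); rewrite rV_consS !mxE.
  case: (unliftP ord0 j) => [k ->|->].
    by rewrite rV_consS; have := Hy k; rewrite !mxE.
  by rewrite rV_cons0; rewrite in_itv /= in Hx.
have -> : lebesgue_rV R d.+1 [set x : 'rV[R]_d.+1 | forall j, lo ord0 j <= x ord0 j <= hi ord0 j] =
  (@lebesgue_measure R \x lebesgue_rV R d)%E (@rV_cons R d @^-1`
    [set x : 'rV[R]_d.+1 | forall j, lo ord0 j <= x ord0 j <= hi ord0 j]) by [].
rewrite E product_measure1E; [|exact: measurable_itv|exact: measurable_box].
rewrite IH; last by move=> j; rewrite !mxE.
rewrite big_ord_recl EFinM; congr (_ * _)%E.
  rewrite [LHS]lebesgue_measure_itv /= lte_fin.
  have := lohi ord0; rewrite le_eqVlt => /predU1P[->|->]; last by rewrite EFinB.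
  by rewrite ltxx subrr.
by congr EFin; apply: eq_bigr => j _; rewrite !mxE.
Qed.

Section vectors.
Variables (R : realType) (d : nat).

Definition dotp (x y : 'rV[R]_d) : R := \sum_(j < d) x ord0 j * y ord0 j.

(* Euclidean norm; the library's `|x| on 'rV[R]_d is the sup norm. *)
Definition enorm (x : 'rV[R]_d) : R := Num.sqrt (dotp x x).

(* Lebesgue measure ds dy on R x R^d. *)
Definition lebesgue_tx :
    {measure set (measurableTypeR R * 'rV[R]_d) -> \bar R} :=
  (@lebesgue_measure R \x lebesgue_rV R d)%E.

End vectors.

Section complex_integral.
Variable R : realType.

Definition expi (theta : R) : R[i] := cos theta +i* sin theta.

Definition normsq (z : R[i]) : R := complex.Re z ^+ 2 + complex.Im z ^+ 2.

Definition cintegral dT (T : measurableType dT)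
    (mu : {measure set T -> \bar R}) (f : T -> R[i]) : R[i] :=
  Rintegral mu setT (fun x => complex.Re (f x)) +i*
  Rintegral mu setT (fun x => complex.Im (f x)).

Definition Gamma (x : R) : R :=
  Rintegral (@lebesgue_measure R) `]0, +oo[
    (fun t => t `^ (x - 1) * expR (- t)).

End complex_integral.

Section levy.
Variables (R : realType) (d : nat) (dO : measure_display).
Variables (Omega : measurableType dO) (P : probability Omega R).

Record symmetric_levy (X : R -> Omega -> 'rV[R]_d) : Prop := SymmetricLevy {
  levy_measurable : forall t, 0 <= t -> measurable_fun setT (X t);
  levy_start : {ae P, forall w, X 0 w = 0};
  levy_stationary : forall (s t : R) (A : set 'rV[R]_d), 0 <= s -> s <= t ->
    measurable A ->
    P [set w | A (X t w - X s w)] = P [set w | A (X (t - s) w)];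
  levy_independent : forall (n : nat) (t : nat -> R) (A : nat -> set 'rV[R]_d),
    0 <= t 0%N -> (forall i, (i < n)%N -> t i <= t i.+1) ->
    (forall i, measurable (A i)) ->
    P (\bigcap_(i < n) [set w | A i (X (t i.+1) w - X (t i) w)]) =
    (\prod_(i < n) P [set w | A i (X (t i.+1) w - X (t i) w)%R])%E;
  levy_continuous : forall t eps : R, 0 <= t -> 0 < eps ->
    P [set w | eps <= enorm (X s w - X t w)]
      @[s --> within [set s | 0 <= s] (nbhs t)] --> 0%E;
  levy_symmetric : forall (t : R) (A : set 'rV[R]_d), 0 <= t -> measurable A ->
    P [set w | A (X t w)] = P [set w | A (- X t w)]
}.

Definition char_exponent (X : R -> Omega -> 'rV[R]_d) (Psi : 'rV[R]_d -> R) :=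
  forall (t : R) (xi : 'rV[R]_d), 0 <= t ->
    cintegral P (fun w => expi (dotp xi (X t w))) = (expR (- t * Psi xi))%:C.

(* p_t(x); the integral is real because Psi is even. *)
Definition levy_density (Psi : 'rV[R]_d -> R) (t : R) (x : 'rV[R]_d) : R :=
  (2 * pi) ^- d *
  complex.Re (cintegral (lebesgue_rV R d)
    (fun xi => expi (- dotp xi x) * (expR (- t * Psi xi))%:C)).

Definition has_levy_density (X : R -> Omega -> 'rV[R]_d)
    (Psi : 'rV[R]_d -> R) :=
  forall (t : R) (A : set 'rV[R]_d), 0 < t -> measurable A ->
    P [set w | A (X t w)] =
    (\int[lebesgue_rV R d]_(x in A) (levy_density Psi t x)%:E)%E.

End levy.

Section test_functions.
Variables (R : realType) (d : nat).
Implicit Types phi : R * 'rV[R]_d -> R.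

Fixpoint Ck (k : nat) phi : Prop :=
  match k with
  | 0 => continuous phi
  | k'.+1 => forall v : R * 'rV[R]_d,
      (forall p, derivable phi p v) /\ Ck k' (fun p => 'D_v phi p)
  end.

(* C^infinity functions (all iterated directional derivatives exist and are
   continuous) with compact support in (0, +oo) x R^d. *)
Definition test_function phi : Prop :=
  (forall k, Ck k phi) /\
  exists K : set (R * 'rV[R]_d),
    [/\ compact K, K `<=` [set p | 0 < p.1] & forall p, ~ K p -> phi p = 0].

Definition fourier phi (tau : R) (xi : 'rV[R]_d) : R[i] :=
  cintegral (@lebesgue_tx R d)
    (fun p => expi (- (tau * p.1) - dotp xi p.2) * (phi p)%:C).

End test_functions.

Section noise.
Variables (R : realType) (d : nat) (H : R) (h : 'rV[R]_d -> R).

Definition bH : R :=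
  if H == 2^-1 then (2 * pi)^-1
  else H * (2 * H - 1) * (2 `^ (2 * (1 - H)) * Num.sqrt pi)^-1 *
       (Gamma (H - 2^-1) / Gamma (1 - H)).

Definition cHd : R := bH * (2 * pi) ^- d.

Definition noise_cov (phi psi : R * 'rV[R]_d -> R) : R[i] :=
  cHd%:C * cintegral (@lebesgue_tx R d)
    (fun p => (`|p.1| `^ (1 - 2 * H) * h p.2)%:C *
       (fourier phi p.1 p.2 * conjc (fourier psi p.1 p.2))).

(* Squared distance in the completion of the test functions, identified through
   the Fourier transform with a subspace of L^2(|tau|^(1-2H) h(xi) dtau dxi);
   extended-real so that an infinite distance is not confused with 0. *)
Definition noise_dist2 (phi psi : R * 'rV[R]_d -> R) : \bar R :=
  (cHd%:E * \int[@lebesgue_tx R d]_p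
     (`|p.1| `^ (1 - 2 * H) * h p.2 *
      normsq (fourier phi p.1 p.2 - fourier psi p.1 p.2))%:E)%E.

Variables (dO : measure_display) (Omega : measurableType dO).
Variable P : probability Omega R.

(* normal_prob 0 0 is not the Dirac mass at 0 in the library. *)
Definition centered_gaussian (Y : Omega -> R) : Prop :=
  exists s : R, forall A : set R, measurable A ->
    P [set w | A (Y w)] = if s == 0 then \d_(0 : R) A else normal_prob 0 s A.

(* W is only meaningful on test functions; jointly Gaussian means that every
   finite linear combination is centered Gaussian (possibly degenerate). *)
Record gaussian_noise (W : (R * 'rV[R]_d -> R) -> {RV P >-> R}) : Prop :=
  GaussianNoise {
  noise_gaussian : forall (n : nat) (phi : 'I_n -> R * 'rV[R]_d -> R)
    (a : 'I_n -> R), (forall i, test_function (phi i)) ->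
    centered_gaussian (fun w => \sum_(i < n) a i * W (phi i) w);
  noise_covE : forall phi psi, test_function phi -> test_function psi ->
    (Rintegral P setT (fun w => W phi w * W psi w))%:C = noise_cov phi psi
}.

(* Y = W(g) for the isometric extension of W to the completion: W(g) is the
   L^2(P)-limit of W(phi_n) for test functions phi_n converging to g. *)
Definition wiener_integral (W : (R * 'rV[R]_d -> R) -> {RV P >-> R})
    (g : R * 'rV[R]_d -> R) (Y : {RV P >-> R}) : Prop :=
  exists phi : nat -> R * 'rV[R]_d -> R,
    [/\ forall n, test_function (phi n),
        noise_dist2 (phi n) g @[n --> \oo] --> 0%E &
        (\int[P]_w ((W (phi n) w - Y w) ^+ 2)%:E)%E @[n --> \oo] --> 0%E].

(* G_{t,x}(s,y) = p_{t-s}(x-y) 1_[0,t](s); its value at the single time s = t,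
   where no density exists, is irrelevant. *)
Definition green (Psi : 'rV[R]_d -> R) (t : R) (x : 'rV[R]_d) :
    R * 'rV[R]_d -> R :=
  fun p => levy_density Psi (t - p.1) (x - p.2) * \1_`[0, t] p.1.

Definition mild_solution (Psi : 'rV[R]_d -> R)
    (W : (R * 'rV[R]_d -> R) -> {RV P >-> R})
    (u : R -> 'rV[R]_d -> {RV P >-> R}) : Prop :=
  forall t x, 0 <= t -> wiener_integral W (green Psi t x) (u t x).

End noise.

Section conditioning.
Variables (R : realType) (dO : measure_display) (Omega : measurableType dO).
Variable P : probability Omega R.

Definition is_cond_exp (S : set (set Omega)) (Y Z : Omega -> R) : Prop :=
  [/\ forall B : set R, measurable B -> S (Z @^-1` B),
      P.-integrable setT (EFin \o Z) &
      forall A, S A -> (\int[P]_(w in A) (Z w)%:E = \int[P]_(w in A) (Y w)%:E)%E].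

(* A version of E[Y | S], with junk value 0 when none exists. *)
Definition cond_exp (S : set (set Omega)) (Y : Omega -> R) : Omega -> R :=
  xget (fun=> 0) [set Z | is_cond_exp S Y Z].

(* Var(Y | Y_0, ..., Y_(n-1)), a random variable defined up to P-null sets. *)
Definition cond_var (Y : Omega -> R) (n : nat) (Ys : 'I_n -> Omega -> R) :
    Omega -> R :=
  let S := g_sigma_preimage Ys in
  cond_exp S (fun w => (Y w - cond_exp S Y w) ^+ 2).

Definition L2norm (Y : Omega -> R) : R :=
  Num.sqrt (Rintegral P setT (fun w => Y w ^+ 2)).

End conditioning.

Section metric.
Variables (R : realType) (d : nat).

Definition Delta (theta1 theta2 : R) (p q : R * 'rV[R]_d) : R :=
  `|p.1 - q.1| `^ theta1 + \sum_(j < d) `|p.2 ord0 j - q.2 ord0 j| `^ theta2.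

Definition rectangle (a b : R) (lo hi : 'rV[R]_d) : set (R * 'rV[R]_d) :=
  [set p : R * 'rV[R]_d | a <= p.1 <= b /\
     forall j, lo ord0 j <= p.2 ord0 j <= hi ord0 j].

End metric.

(* Main.v *)
Require Import Defs.
From mathcomp Require Import all_boot all_order all_algebra.
From mathcomp Require Import all_classical all_reals all_analysis.
From mathcomp Require Import measurable_realfun complex ring lra.

Import Order.TTheory GRing.Theory Num.Theory numFieldNormedType.Exports.

Local Open Scope classical_set_scope.
Local Open Scope ring_scope.

(** The Fourier transform of [G_(t,x)] satisfies
    [(Psi - i tau) F G_(t,x) = e^(-i xi.x) (e^(-i tau t) - e^(-t Psi))], so pairing
    a combination [F = sum_i b_i F G_(t_i,x_i)] (with [b_0 = 1], [b_j = - a_j]) with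
    [e^(i xi.x + i tau t) (Psi - i tau) K(delta tau) prod_j K(eps xi_j)] produces the
    transform of the kernel at the points [(t - t_i, x - x_i)], minus terms that
    contain the transform of [K(delta tau)] at [t].  The kernel [K] is chosen with
    compactly supported transform, hence if [delta <= t] and every other point is at
    distance at least [delta] in time or [eps] in space, only the term of index 0
    survives.  By Cauchy-Schwarz in [L^2(|tau|^(1-2H) h)] and scaling, with
    [eps^alpha = delta], the variance of [u(t,x) - sum_j a_j u(t^j,x^j)] is at least a
    constant times [delta^(2 theta1)].  For the coefficients [a_j] of the orthogonal
    projection, the residual of a Gaussian family is independent of the conditioning
    variables, and the conditional variance is almost surely constant, equal to the
    variance of the residual. *)

Set Implicit Arguments.
Unset Strict Implicit.
Unset Printing Implicit Defensive.

(** * Real-valued integrals *)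

(** Multiplication by [Psi - i tau] removes the denominator of the transform, and the [tau]-integral
    is computed before the [xi]-integral. The unwanted term is a bounded function of [xi] times an
    exponential of frequency [t] in [tau], so it vanishes whatever that function is. The price is
    paid in Cauchy-Schwarz: the squared kernel is integrated against [Psi^2 + tau^2] divided by the
    weight, that is, against powers of [|tau|] up to [2 H + 1] and of [|xi|] up to [2 alpha + beta].
    Hence [K] must also have finite moments of these orders, which a truncated power of [1 - r^2] on
    the transform side provides. The relation between [eps] and [delta] gives [Psi^2] and [tau^2]
    the same scaling. Only the coefficient of index 0 enters the bound, so the constant depends
    neither on [n] nor on the other coefficients. In the conditioning, independence of the residual
    is used only through its first two moments against cosines of linear combinations of the
    conditioning variables; these are read off the characteristic function and carried to events by
    Fourier uniqueness. *)

Section real_integration.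
Context d (T : measurableType d) (R : realType) (mu : {measure set T -> \bar R}).
Implicit Types f g : T -> R.

Definition rintegrable f := mu.-integrable setT (EFin \o f).

Lemma rintegrable_measurable f : rintegrable f -> measurable_fun setT f.
Proof. by move=> /measurable_int /measurable_EFinP. Qed.

Lemma eq_rintegrable f g : f =1 g -> rintegrable f -> rintegrable g.
Proof. by move=> /funext ->. Qed.

Lemma ge0_rintegrable f : measurable_fun setT f -> (forall x, 0 <= f x) ->
  (\int[mu]_x (f x)%:E < +oo)%E -> rintegrable f.
Proof.
move=> mf f0 foo; apply/integrableP; split; first exact/measurable_EFinP.
by under eq_integral do rewrite /= ger0_norm//.
Qed.

Lemma le_rintegrable f g : measurable_fun setT f -> (forall x, `|f x| <= g x) ->
  rintegrable g -> rintegrable f.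
Proof.
move=> mf fg; apply: le_integrable => //; first exact/measurable_EFinP.
by move=> x _; rewrite /= lee_fin (le_trans (fg x))// ler_norm.
Qed.

Lemma rintegrable_norm f : rintegrable f -> rintegrable (fun x => `|f x|).
Proof. by move=> /integrable_abse. Qed.

Lemma rintegrableD f g : rintegrable f -> rintegrable g ->
  rintegrable (fun x => f x + g x).
Proof. by move=> fi gi; have := integrableD measurableT fi gi. Qed.

Lemma rintegrableB f g : rintegrable f -> rintegrable g ->
  rintegrable (fun x => f x - g x).
Proof. by move=> fi gi; have := integrableB measurableT fi gi. Qed.

Lemma rintegrableZl k f : rintegrable f -> rintegrable (fun x => k * f x).
Proof. by move=> fi; have := integrableZl measurableT k fi. Qed.

Lemma rintegrable0 : rintegrable (fun=> 0).
Proof. exact: integrable0. Qed.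

Lemma rintegrable_sum (I : Type) (s : seq I) (F : I -> T -> R) :
  (forall i, rintegrable (F i)) -> rintegrable (fun x => \sum_(i <- s) F i x).
Proof.
move=> Fi; elim: s => [|i s IH].
  by under eq_fun do rewrite big_nil; exact: rintegrable0.
by under eq_fun do rewrite big_cons; exact: rintegrableD.
Qed.

Lemma EFin_Rintegral f : rintegrable f ->
  ((\int[mu]_x f x)%:E = \int[mu]_x (f x)%:E)%E.
Proof. by move=> fi; rewrite /Rintegral fineK//; exact: integrable_fin_num. Qed.

Lemma rintegralD f g : rintegrable f -> rintegrable g ->
  \int[mu]_x (f x + g x) = \int[mu]_x f x + \int[mu]_x g x.
Proof. exact: RintegralD. Qed.

Lemma rintegralB f g : rintegrable f -> rintegrable g ->
  \int[mu]_x (f x - g x) = \int[mu]_x f x - \int[mu]_x g x.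
Proof. exact: RintegralB. Qed.

Lemma rintegralZl k f : rintegrable f ->
  \int[mu]_x (k * f x) = k * \int[mu]_x f x.
Proof. by move=> fi; rewrite RintegralZl. Qed.

Lemma rintegral0 : \int[mu]_x (0 : R) = 0.
Proof. by rewrite /Rintegral integral0. Qed.

Lemma rintegral_sum (I : Type) (s : seq I) (F : I -> T -> R) :
  (forall i, rintegrable (F i)) ->
  \int[mu]_x (\sum_(i <- s) F i x) = \sum_(i <- s) \int[mu]_x F i x.
Proof.
move=> Fi; elim: s => [|i s IH].
  by under eq_Rintegral do rewrite big_nil; rewrite big_nil rintegral0.
under eq_Rintegral do rewrite big_cons.
by rewrite rintegralD ?IH ?big_cons//; exact: rintegrable_sum.
Qed.

Lemma le_rintegral f g : rintegrable f -> rintegrable g ->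
  (forall x, f x <= g x) -> \int[mu]_x f x <= \int[mu]_x g x.
Proof. by move=> fi gi fg; exact: le_Rintegral. Qed.

Lemma rintegral_ge0 f : (forall x, 0 <= f x) -> 0 <= \int[mu]_x f x.
Proof. by move=> f0; exact: Rintegral_ge0. Qed.

Lemma ae_eq_rintegral f g : measurable_fun setT f -> measurable_fun setT g ->
  {ae mu, forall x, f x = g x} -> \int[mu]_x f x = \int[mu]_x g x.
Proof.
move=> mf mg fg; congr fine; apply: ae_eq_integral => //;
  try exact/measurable_EFinP.
by apply: filterS fg => x /= -> _.
Qed.

Lemma ae_le_rintegral f g : rintegrable f -> rintegrable g ->
  {ae mu, forall x, f x <= g x} -> \int[mu]_x f x <= \int[mu]_x g x.
Proof.
move=> fi gi fg; rewrite -subr_ge0 -rintegralB//.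
have mgf := rintegrable_measurable (rintegrableB gi fi).
(* The positive part agrees almost everywhere with [g - f] and is nonnegative everywhere, as
   [rintegral_ge0] requires. *)
rewrite (@ae_eq_rintegral _ (fun x => Num.max (g x - f x) 0))//.
- by apply: rintegral_ge0 => x; rewrite le_max lexx orbT.
- exact: measurable_maxr.
- by apply: filterS fg => x /=; rewrite -subr_ge0 => /max_idPl ->.
Qed.

Lemma rintegral_cvg (f_ : nat -> T -> R) f g :
  (forall n, measurable_fun setT (f_ n)) ->
  (forall x, f_ n x @[n --> \oo] --> f x) ->
  rintegrable g -> (forall n x, `|f_ n x| <= g x) ->
  rintegrable f /\ \int[mu]_x f_ n x @[n --> \oo] --> \int[mu]_x f x.
Proof.
move=> mf_ f_f gi fg.
have mf : measurable_fun setT f.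
  by apply: (measurable_fun_cvg mf_) => x _; exact: f_f.
have [] := @dominated_convergence _ _ _ mu _ measurableT
  (fun n => EFin \o f_ n) (EFin \o f) (EFin \o g).
- by move=> n; exact/measurable_EFinP.
- exact/measurable_EFinP.
- by apply: nearW => x _; apply: cvg_EFin; [exact: nearW|exact: f_f].
- by [].
- by apply: nearW => x n _; rewrite /= lee_fin.
- move=> fi _ H; split => //.
  apply: fine_cvg; rewrite -/(Rintegral _ _ _) EFin_Rintegral//.
Qed.

Lemma ge0_rintegral_eq0 f : rintegrable f -> (forall x, 0 <= f x) ->
  \int[mu]_x f x = 0 -> {ae mu, forall x, f x = 0}.
Proof.
move=> fi f0 If0.
have : (\int[mu]_x `|(EFin \o f) x| = 0)%E.
  under eq_integral do rewrite /= ger0_norm//.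
  by rewrite -EFin_Rintegral// If0.
move/(ae_eq_integral_abs _ measurableT) => /(_ (measurable_int _ fi)).
by apply: filterS => x /= /(_ I) [].
Qed.

End real_integration.

Section real_fubini.
Context d1 d2 (T1 : measurableType d1) (T2 : measurableType d2) (R : realType).
Variables (m1 : {sigma_finite_measure set T1 -> \bar R})
  (m2 : {sigma_finite_measure set T2 -> \bar R}).
Implicit Types f : T1 * T2 -> R.
Local Notation m12 := (m1 \x m2)%E.

Lemma rintegrable_product f : measurable_fun setT f ->
  (\int[m1]_x \int[m2]_y `|f (x, y)|%:E < +oo)%E -> rintegrable m12 f.
Proof.
by move=> mf H; apply/integrable12ltyP => //; exact/measurable_EFinP.
Qed.

(** The inner bound is asked only almost everywhere because the Green function of time [t] has no
    density on the slice [s = t]. *)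
Lemma rintegrable_product_le f (g : T1 -> R) : measurable_fun setT f ->
  rintegrable m1 g ->
  {ae m1, forall x, (\int[m2]_y `|f (x, y)|%:E <= (g x)%:E)%E} ->
  rintegrable m12 f.
Proof.
move=> mf gi fg; apply: rintegrable_product => //.
have mg := rintegrable_measurable gi.
have mnf : measurable_fun setT (fun x => \int[m2]_y `|f (x, y)|%:E)%E.
  apply: (measurable_fun_fubini_tonelli_F (fun p => `|f p|%:E)) => //.
  by apply/measurable_EFinP; exact: measurableT_comp.
apply: (@le_lt_trans _ _ (\int[m1]_x `|(EFin \o g) x|)%E); last first.
  by have /integrableP[] := gi.
apply: ae_ge0_le_integral => //.
- by move=> x _; exact: integral_ge0.
- by apply: measurableT_comp => //; exact/measurable_EFinP.
- apply: filterS fg => x /= H _; apply: (le_trans H).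
  by rewrite lee_fin ler_norm.
Qed.

Lemma rintegral_fubini f : rintegrable m12 f ->
  \int[m12]_p f p = \int[m1]_x \int[m2]_y f (x, y).
Proof.
move=> fi; have := @integral12_prod_meas1 _ _ _ _ _ m1 m2 _ fi.
rewrite /Rintegral => <-; congr fine.
apply: ae_eq_integral => //.
- by have /measurable_int := integrable_fubini_F fi.
- apply/measurable_EFinP; apply: (measurableT_comp (@fine_measurable _ _ measurableT)).
  by have /measurable_int := integrable_fubini_F fi.
- apply: filterS (ae_integrable1 fi) => x /= H _.
  by rewrite fineK//; exact: integrable_fin_num.
Qed.

Lemma rintegral_fubini_swap f : rintegrable m12 f ->
  \int[m12]_p f p = \int[m2]_y \int[m1]_x f (x, y).
Proof.
move=> fi; have := @integral21_prod_meas1 _ _ _ _ _ m1 m2 _ fi.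
rewrite /Rintegral => <-; congr fine.
apply: ae_eq_integral => //.
- exact: (measurable_fubini_G fi).
- apply/measurable_EFinP; apply: (measurableT_comp (@fine_measurable _ _ measurableT)).
  exact: (measurable_fubini_G fi).
- apply: filterS (ae_integrable2 fi) => x /= H _.
  by rewrite fineK//; exact: integrable_fin_num.
Qed.

Lemma rintegral_fubini_eq f : rintegrable m12 f ->
  \int[m1]_x \int[m2]_y f (x, y) = \int[m2]_y \int[m1]_x f (x, y).
Proof. by move=> fi; rewrite -rintegral_fubini// rintegral_fubini_swap. Qed.

Lemma rintegrableX (f : T1 -> R) (g : T2 -> R) :
  rintegrable m1 f -> rintegrable m2 g ->
  rintegrable m12 (fun p => f p.1 * g p.2).
Proof.
move=> fi gi.
have mf := rintegrable_measurable fi; have mg := rintegrable_measurable gi.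
apply: (@rintegrable_product_le _ (fun x => `|f x| * \int[m2]_y `|g y|)).
- by apply: measurable_funM; exact: measurableT_comp.
- apply: (@eq_rintegrable _ _ _ _ (fun x => (\int[m2]_y `|g y|) * `|f x|)).
    by move=> x; rewrite mulrC.
  by apply: rintegrableZl; exact: rintegrable_norm.
- apply: nearW => x; rewrite EFinM EFin_Rintegral; last exact: rintegrable_norm.
  rewrite [leLHS](_ : _ = \int[m2]_y (`|f x|%:E * `|g y|%:E))%E.
    2: by apply: eq_integral => y _; rewrite normrM EFinM.
  rewrite ge0_integralZl//; apply/measurable_EFinP; exact: measurableT_comp.
Qed.

Lemma rintegralX (f : T1 -> R) (g : T2 -> R) :
  rintegrable m1 f -> rintegrable m2 g ->
  \int[m12]_p (f p.1 * g p.2) = (\int[m1]_x f x) * \int[m2]_y g y.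
Proof.
move=> fi gi; rewrite rintegral_fubini; last exact: rintegrableX.
under eq_Rintegral do rewrite /= rintegralZl//.
by under eq_Rintegral do rewrite mulrC; rewrite rintegralZl// mulrC.
Qed.

(** Tonelli is applied to the positive and negative parts separately, so parameters at which the
    inner integral diverges are allowed; [levy_density] at nonpositive times is such a case. *)
Lemma measurable_rintegral2 f : measurable_fun setT f ->
  measurable_fun setT (fun x => \int[m2]_y f (x, y)).
Proof.
move=> mf; apply: (measurableT_comp (@fine_measurable _ _ measurableT)).
under eq_fun do rewrite integralE.
have mef : measurable_fun setT (EFin \o f) by exact/measurable_EFinP.
apply: emeasurable_funB.
- have := @measurable_fun_fubini_tonelli_F _ _ _ _ _ m2 (EFin \o f)^\+%E
    (measurable_funepos mef) (fun p => funepos_ge0 _ p).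
  by apply: eq_measurable_fun => x _; apply: eq_integral => y _; rewrite !funeposE.
- have := @measurable_fun_fubini_tonelli_F _ _ _ _ _ m2 (EFin \o f)^\-%E
    (measurable_funeneg mef) (fun p => funeneg_ge0 _ p).
  by apply: eq_measurable_fun => x _; apply: eq_integral => y _; rewrite !funenegE.
Qed.

End real_fubini.

(** * Lebesgue measure on row vectors *)

Section lebesgue_affine.
Variable R : realType.
Local Notation lam := (@lebesgue_measure R).

(** The scaled image measure gives every []a, b]] its length, and this characterises Lebesgue
    measure. *)
Lemma lebesgue_measure_affine (c e : R) (A : set R) : 0 < c -> measurable A ->
  (lam A = c%:E * lam [set x | A (c * x + e)%R])%E.
Proof.
move=> c0 mA.
pose k : {nonneg R} := NngNum (ltW c0).
pose phi : measurableTypeR R -> measurableTypeR R := fun x => c * x + e.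
have mphi : measurable_fun setT phi.
  by apply: measurable_funD => //; apply: measurable_funM.
apply: (@lebesgue_measure_unique R (mscale k (pushforward lam phi))) => //.
move=> _ [[a b]] _ <- /=.
have E : phi @^-1` `]a, b]%classic = `](a - e) / c, (b - e) / c]%classic.
  apply/seteqP; split => x /=; rewrite !in_itv /= /phi.
    by rewrite ltr_pdivrMr// ler_pdivlMr// ltrBlDr lerBrDr mulrC.
  by rewrite ltr_pdivrMr// ler_pdivlMr// ltrBlDr lerBrDr mulrC.
transitivity (c%:E * lam (phi @^-1` `]a, b]%classic))%E => //.
rewrite E !lebesgue_measure_itv /= !lte_fin.
rewrite ltr_pM2r ?invr_gt0// ltrD2r; case: ifPn => ab; last by rewrite mule0.
by rewrite -!EFinB -EFinM; congr EFin; field; rewrite gt_eqF.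
Qed.

Lemma ge0_integral_affine (c e : R) (f : R -> \bar R) : 0 < c ->
  measurable_fun setT f -> (forall x, 0 <= f x)%E ->
  (\int[lam]_x f (c * x + e)%R = (c^-1)%:E * \int[lam]_x f x)%E.
Proof.
move=> c0 mf f0.
pose k : {nonneg R} := NngNum (ltW c0).
pose phi : measurableTypeR R -> measurableTypeR R := fun x => c * x + e.
have mphi : measurable_fun setT phi.
  by apply: measurable_funD => //; apply: measurable_funM.
have -> : (\int[lam]_x f x = c%:E * \int[lam]_x f (c * x + e)%R)%E.
  pose m : {measure set (measurableTypeR R) -> \bar R} :=
    measure_function_pushforward__canonical__measure_function_Measure lam mphi.
  transitivity (\int[mscale k m]_x f x)%E.
    apply: eq_measure_integral => A mA _.
    by rewrite [LHS](lebesgue_measure_affine e c0).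
  rewrite (@ge0_integral_mscale _ _ _ m _ measurableT)//.
  by rewrite ge0_integral_pushforward// preimage_setT.
by rewrite muleA -EFinM mulVf ?gt_eqF// mul1e.
Qed.

Lemma rintegrable_affine (c e : R) (f : R -> R) : 0 < c ->
  rintegrable lam f -> rintegrable lam (fun x => f (c * x + e)).
Proof.
move=> c0 fi; have mf := rintegrable_measurable fi.
apply/integrableP; split.
  apply/measurable_EFinP; apply: (measurableT_comp mf).
  by apply: measurable_funD => //; apply: measurable_funM.
rewrite (@ge0_integral_affine c e (fun x => `|f x|%:E))//.
  have /integrableP[_ H] := fi.
  by apply: lte_mul_pinfty => //; rewrite lee_fin invr_ge0 ltW.
by apply/measurable_EFinP; exact: measurableT_comp.
Qed.

Lemma rintegral_affine (c e : R) (f : R -> R) : 0 < c ->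
  rintegrable lam f ->
  \int[lam]_x f (c * x + e) = c^-1 * \int[lam]_x f x.
Proof.
move=> c0 fi; apply: EFin_inj; rewrite EFin_Rintegral; last exact: rintegrable_affine.
rewrite EFinM EFin_Rintegral// integralE [in RHS]integralE.
have mfi := measurable_int _ fi.
rewrite muleBr//; last first.
  rewrite fin_num_adde_defl//.
  by rewrite fin_numN ge0_fin_numE ?integral_ge0//; exact: integral_funeneg_lt_pinfty.
rewrite -(ge0_integral_affine e c0 (measurable_funepos mfi))//.
rewrite -[in RHS](ge0_integral_affine e c0 (measurable_funeneg mfi))//.
congr (_ - _)%E; apply: eq_integral => x _.
+ by rewrite !funeposE.
+ by rewrite !funenegE.
Qed.

Lemma rintegrable_opp (f : R -> R) :
  rintegrable lam f -> rintegrable lam (fun x => f (- x)).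
Proof.
move=> fi; have mf := rintegrable_measurable fi.
apply/integrableP; split.
  by apply/measurable_EFinP; apply: (measurableT_comp mf).
have /integrableP[_ H] := fi.
apply: le_lt_trans H.
rewrite [leRHS](eq_measure_integral (pushforward lam (-%R : _ -> measurableTypeR R))); last first.
  by move=> A mA _; rewrite [RHS]lebesgue_measureN.
rewrite ge0_integral_pushforward// ?preimage_setT//.
by apply: measurableT_comp => //; exact/measurable_EFinP.
Qed.

Lemma rintegral_opp (f : R -> R) :
  rintegrable lam f -> \int[lam]_x f (- x) = \int[lam]_x f x.
Proof.
move=> fi; have mf := rintegrable_measurable fi.
congr fine; rewrite [RHS](eq_measure_integral (pushforward lam (-%R : _ -> measurableTypeR R))); last first.
  by move=> A mA _; rewrite [RHS]lebesgue_measureN.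
rewrite integral_pushforward//; first exact/measurable_EFinP.
by rewrite preimage_setT; exact: rintegrable_opp.
Qed.

Lemma rintegral_sub (e : R) (f : R -> R) : rintegrable lam f ->
  \int[lam]_x f (x - e) = \int[lam]_x f x.
Proof.
move=> fi; have := rintegral_affine (- e) ltr01 fi.
by rewrite invr1 mul1r => <-; apply: eq_Rintegral => x _; rewrite mul1r.
Qed.

Lemma rintegrable_sub (e : R) (f : R -> R) : rintegrable lam f ->
  rintegrable lam (fun x => f (x - e)).
Proof.
move=> fi; have := rintegrable_affine (- e) ltr01 fi.
by apply: eq_rintegrable => x; rewrite mul1r.
Qed.

End lebesgue_affine.

Section lebesgue_rV_integral.
Variable R : realType.
Local Notation lam := (@lebesgue_measure R).
Local Notation leb := (@lebesgue_rV R).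

Lemma ge0_integral_rV_succ d (f : 'rV[R]_d.+1 -> \bar R) :
  measurable_fun setT f -> (forall x, 0 <= f x)%E ->
  (\int[leb d.+1]_x f x = \int[lam \x leb d]_p f (rV_cons p))%E.
Proof.
move=> mf f0.
have := @ge0_integral_pushforward _ _ (measurableTypeR R * 'rV[R]_d)%type _ R (@rV_cons R d) (@measurable_rV_cons R d)
  (lam \x leb d)%E setT f.
by rewrite preimage_setT; apply.
Qed.

Lemma rintegrable_rV_succ d (f : 'rV[R]_d.+1 -> R) : measurable_fun setT f ->
  rintegrable (leb d.+1) f <-> rintegrable (lam \x leb d)%E (f \o @rV_cons R d).
Proof.
move=> mf.
have mfc : measurable_fun setT (f \o @rV_cons R d).
  by apply: measurableT_comp => //; exact: measurable_rV_cons.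
have E : (\int[leb d.+1]_x `|f x|%:E = \int[lam \x leb d]_p `|f (rV_cons p)|%:E)%E.
  rewrite (@ge0_integral_rV_succ _ (fun x => `|f x|%:E))//.
  by apply/measurable_EFinP; exact: measurableT_comp.
split=> /integrableP[_ H]; apply/integrableP; split; try exact/measurable_EFinP.
- by move: H; rewrite [X in (X < _)%E]E.
- by rewrite [X in (X < _)%E]E.
Qed.

Lemma rintegral_rV_succ d (f : 'rV[R]_d.+1 -> R) : rintegrable (leb d.+1) f ->
  \int[leb d.+1]_x f x = \int[(lam \x leb d)%E]_p f (rV_cons p).
Proof.
move=> fi; congr fine; have mf := rintegrable_measurable fi.
have := @integral_pushforward _ _ (measurableTypeR R * 'rV[R]_d)%type _ R (@rV_cons R d) (@measurable_rV_cons R d)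
  (lam \x leb d)%E setT (EFin \o f).
rewrite preimage_setT; apply => //; first exact/measurable_EFinP.
exact/rintegrable_rV_succ.
Qed.

Lemma rV_cons_sub d (p : R * 'rV[R]_d) (a : 'rV[R]_d.+1) :
  rV_cons p - a = rV_cons (p.1 - (rV_uncons a).1, p.2 - (rV_uncons a).2).
Proof.
apply/rowP => j; rewrite mxE; case: (unliftP ord0 j) => [k ->|->].
  by rewrite !rV_consS !mxE.
by rewrite !rV_cons0 mxE.
Qed.

Lemma measurable_rV_sub d (a : 'rV[R]_d) :
  measurable_fun setT (fun x : 'rV[R]_d => x - a).
Proof.
apply: measurable_fun_rV => i; under eq_fun do rewrite mxE.
by apply: measurable_funD => //; exact: measurable_coord.
Qed.

Lemma tonelli_rV d (f : R * 'rV[R]_d -> \bar R) :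
  measurable_fun setT f -> (forall p, 0 <= f p)%E ->
  (\int[lam \x leb d]_p f p = \int[lam]_x \int[leb d]_y f (x, y))%E.
Proof.
by move=> mf f0; have := @fubini_tonelli1 _ _ (measurableTypeR R) _ R lam (leb d) f mf f0.
Qed.

Lemma ge0_integral_rV_sub d (f : 'rV[R]_d -> \bar R) (a : 'rV[R]_d) :
  measurable_fun setT f -> (forall x, 0 <= f x)%E ->
  (\int[leb d]_x f (x - a)%R = \int[leb d]_x f x)%E.
Proof.
elim: d f a => [|d IH] f a mf f0.
  by apply: eq_integral => x _; congr f; apply/rowP => -[].
rewrite !ge0_integral_rV_succ//; last exact: measurableT_comp mf (measurable_rV_sub a).
have mfc : measurable_fun setT (f \o @rV_cons R d).
  by apply: measurableT_comp => //; exact: measurable_rV_cons.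
rewrite (tonelli_rV mfc (fun p => f0 _)); under eq_integral do rewrite rV_cons_sub.
pose g : R -> \bar R := fun x => (\int[leb d]_y f (rV_cons (x, y)))%E.
transitivity (\int[lam]_x g (1 * x + - (rV_uncons a).1)%R)%E; last first.
  rewrite ge0_integral_affine ?invr1 ?mul1e//.
  - have := @measurable_fun_fubini_tonelli_F _ _ (measurableTypeR R) _ _ (leb d)
      (f \o @rV_cons R d) mfc (fun p => f0 _).
    by [].
  - by move=> x; exact: integral_ge0.
rewrite (@tonelli_rV _ (fun p => f (rV_cons (p.1 - (rV_uncons a).1, p.2 - (rV_uncons a).2))))//; last first.
  apply: (measurableT_comp mfc); apply/measurable_fun_pair => /=.
    by apply: measurable_funD => //; exact: measurable_fst.
  exact: measurableT_comp (measurable_rV_sub _) measurable_snd.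
apply: eq_integral => x _ /=; rewrite /g mul1r.
apply: (IH (fun y => f (rV_cons (x - (rV_uncons a).1, y)))) => //.
exact: (measurableT_comp mfc).
Qed.

Lemma rintegral_rV_sub d (f : 'rV[R]_d -> R) (a : 'rV[R]_d) :
  rintegrable (leb d) f -> \int[leb d]_x f (x - a) = \int[leb d]_x f x.
Proof.
move=> fi; have mfi := measurable_int _ fi.
congr fine; rewrite integralE [in RHS]integralE.
rewrite -[in RHS](ge0_integral_rV_sub a (measurable_funepos mfi))//.
rewrite -[in RHS](ge0_integral_rV_sub a (measurable_funeneg mfi))//.
congr (_ - _)%E; apply: eq_integral => x _.
+ by rewrite !funeposE.
+ by rewrite !funenegE.
Qed.

(** The spectral estimates reach integrability in [xi] through this factorisation: kernels, their
    weighted squares and dominating functions are products over the coordinates, or sums of such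
    products. *)
Lemma rintegrable_rV_prod d (f : 'I_d -> R -> R) :
  (forall j, rintegrable lam (f j)) ->
  rintegrable (leb d) (fun x => \prod_(j < d) f j (x ord0 j)) /\
  \int[leb d]_x \prod_(j < d) f j (x ord0 j) = \prod_(j < d) \int[lam]_x f j x.
Proof.
elim: d f => [|d IH] f fi.
  (* The measure on the one-point space of empty rows is a Dirac mass, so the empty product has
     integral 1. *)
  have d1 : leb 0 setT = 1%E by exact: diracT.
  split.
    apply: (@eq_rintegrable _ _ _ _ (fun=> 1)); first by move=> x; rewrite big_ord0.
    apply: ge0_rintegrable => //; rewrite integral_cst//.
    by rewrite mul1e [X in (X < _)%E]d1 ltry.
  under eq_Rintegral do rewrite big_ord0.
  by rewrite big_ord0 Rintegral_cst// mul1r [X in fine X]d1.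
have [Ii IE] := IH (fun j => f (lift ord0 j)) (fun j => fi _).
have m : measurable_fun setT (fun x : 'rV[R]_d.+1 => \prod_(j < d.+1) f j (x ord0 j)).
  apply: measurable_prod => j _.
  apply: measurableT_comp; last exact: measurable_coord.
  exact: rintegrable_measurable (fi j).
have E : (fun x : 'rV[R]_d.+1 => \prod_(j < d.+1) f j (x ord0 j)) \o @rV_cons R d =
   fun p => f ord0 p.1 * \prod_(j < d) f (lift ord0 j) (p.2 ord0 j).
  apply/funext => p /=; rewrite big_ord_recl rV_cons0; congr (_ * _).
  by apply: eq_bigr => j _; rewrite rV_consS.
have Ii' : rintegrable (leb d.+1) (fun x => \prod_(j < d.+1) f j (x ord0 j)).
  by apply/rintegrable_rV_succ => //; rewrite E;
      exact: (@rintegrableX _ _ (measurableTypeR R) _ R lam (leb d) _ _ (fi ord0) Ii).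
split => //; rewrite rintegral_rV_succ// big_ord_recl -IE.
rewrite -(@rintegralX _ _ (measurableTypeR R) _ R lam (leb d) _ _ (fi ord0) Ii).
by apply: eq_Rintegral => p _; have := congr1 (fun g => g p) E.
Qed.

End lebesgue_rV_integral.

(** * Elementary integrals and the Poisson kernel *)

Section calculus.
Variable R : realType.
Implicit Types (f g : R -> R) (x a b : R).
Local Notation lam := (@lebesgue_measure R).

Lemma is_derive_add f g x a b : is_derive x 1 f a -> is_derive x 1 g b ->
  is_derive x 1 (fun y => f y + g y) (a + b).
Proof. exact: is_deriveD. Qed.

Lemma is_derive_mul f g x a b : is_derive x 1 f a -> is_derive x 1 g b ->
  is_derive x 1 (fun y => f y * g y) (f x * b + g x * a).
Proof. exact: is_deriveM. Qed.

Lemma is_derive_scale f x k a : is_derive x 1 f a ->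
  is_derive x 1 (fun y => k * f y) (k * a).
Proof. exact: (is_deriveZ k). Qed.

Lemma is_derive_comp f g x a b : is_derive x 1 f a -> is_derive (f x) 1 g b ->
  is_derive x 1 (fun y => g (f y)) (b * a).
Proof. by move=> fa gb; exact: is_derive1_comp. Qed.

(** Affine arguments keep the literal form [k * y + c], even for [c = 0], so that derivatives
    compose by matching; hence the [+ 0] in many formulas. *)
Lemma is_derive_lin k c x : is_derive x 1 (fun y => k * y + c) k.
Proof.
apply: (@is_derive_eq _ _ _ _ _ _ _ (k * 1 + 0)).
by rewrite mulr1 addr0.
Qed.

Lemma is_derive_continuous f x a : is_derive x 1 f a -> {for x, continuous f}.
Proof.
by move=> [fx _]; apply: differentiable_continuous; exact/derivable1_diffP.
Qed.

Lemma ftc_itvcc (F f : R -> R) a b : a <= b ->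
  (forall x, is_derive x 1 F (f x)) -> continuous f ->
  \int[lam]_(x in `[a, b]) f x = F b - F a.
Proof.
rewrite le_eqVlt => /predU1P[->|ab] dF cf.
  by rewrite set_itv1 Rintegral_set1 subrr.
have FE : F^`()%classic = f by apply/funext => x; rewrite derive1E; have [_ ->] := dF x.
rewrite /Rintegral (@continuous_FTC2 _ f F)// ?FE//.
- exact: continuous_subspaceT.
- have cF : continuous F by move=> x; exact: is_derive_continuous (dF x).
  split.
  + by move=> x _; have [] := dF x.
  + exact/cvg_at_right_filter/cF.
  + exact/cvg_at_left_filter/cF.
Qed.

Lemma ge0_ftc_itvcy (F f : R -> R) a l :
  (forall x, is_derive x 1 F (f x)) -> continuous f -> (forall x, 0 <= f x) ->
  F x @[x --> +oo] --> l ->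
  (\int[lam]_(x in `[a, +oo[) (f x)%:E = (l - F a)%:E)%E.
Proof.
move=> dF cf f0 Fl.
have FE : F^`()%classic = f by apply/funext => x; rewrite derive1E; have [_ ->] := dF x.
rewrite (@ge0_continuous_FTC2y _ f F _ l)//.
- exact: continuous_subspaceT.
- exact/cvg_at_right_filter/(is_derive_continuous (dF a)).
- by rewrite FE.
Qed.

End calculus.

Section poisson_kernel.
Variable R : realType.
Local Notation lam := (@lebesgue_measure R).
Implicit Types (eps v x s : R).

Let is_derive_expm eps x : is_derive x 1 (fun y => expR (- eps * y + 0)) (expR (- eps * x + 0) * - eps).
Proof. exact: is_derive_comp (is_derive_lin _ _ _) (is_derive_expR _). Qed.

Let is_derive_cosv v x : is_derive x 1 (fun y => cos (v * y + 0)) (- sin (v * x + 0) * v).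
Proof. exact: is_derive_comp (is_derive_lin _ _ _) (is_derive_cos _). Qed.

Let is_derive_sinv v x : is_derive x 1 (fun y => sin (v * y + 0)) (cos (v * x + 0) * v).
Proof. exact: is_derive_comp (is_derive_lin _ _ _) (is_derive_sin _). Qed.

Let cvg_exp_bounded eps (g : R -> R) C : 0 < eps -> (forall x, `|g x| <= C) ->
  expR (- eps * x + 0) * g x @[x --> +oo] --> 0.
Proof.
move=> eps0 gC.
have e0 : expR (- (eps * x)) * C @[x --> +oo] --> 0.
  rewrite -(mul0r C); apply: cvgM; last exact: cvg_cst.
  apply: (cvg_comp (fun x => eps * x) (fun x => expR (- x))); last exact: cvgr_expR.
  exact: gt0_cvgMry.
apply/norm_cvg0P; apply: (@squeeze_cvgr _ _ _ _ (cst 0) _ _ _ 0 _ e0).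
  apply: nearW => x /=; rewrite normr_ge0/= normrM ger0_norm ?expR_ge0//.
  by rewrite addr0 mulNr ler_wpM2l ?expR_ge0.
exact: cvg_cst.
Qed.

(** The factor [1 + cos] keeps the integrand nonnegative, as the fundamental theorem on a half line
    requires; the plain cosine is recovered by subtraction in [rintegral_exp_norm_cos]. *)
Lemma integral_exp_cos_half eps v : 0 < eps ->
  (\int[lam]_(x in `[0%R, +oo[) (expR (- eps * x + 0) * (1 + cos (v * x + 0)))%:E =
   (eps^-1 + eps / (eps ^+ 2 + v ^+ 2))%:E)%E.
Proof.
move=> eps0.
have D0 : 0 < eps ^+ 2 + v ^+ 2 by rewrite ltr_pwDl// ?sqr_ge0// exprn_gt0.
pose g x := - eps^-1 + (eps ^+ 2 + v ^+ 2)^-1 *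
  (- eps * cos (v * x + 0) + v * sin (v * x + 0)).
pose F x := expR (- eps * x + 0) * g x.
have alg (e c s : R) :
    e * ((eps ^+ 2 + v ^+ 2)^-1 * (- eps * (- s * v) + v * (c * v))) +
    (- eps^-1 + (eps ^+ 2 + v ^+ 2)^-1 * (- eps * c + v * s)) * (e * - eps) =
    e * (1 + c).
  by field; rewrite !gt_eqF.
have dF x : is_derive x 1 F (expR (- eps * x + 0) * (1 + cos (v * x + 0))).
  apply: (is_derive_eq (is_derive_mul (is_derive_expm _ _)
    (is_derive_add (is_derive_cst _ _ _) (is_derive_scale _ (is_derive_add
      (is_derive_scale _ (is_derive_cosv _ _))
      (is_derive_scale _ (is_derive_sinv _ _))))))).
  by rewrite add0r; exact: alg.
rewrite (ge0_ftc_itvcy 0 dF (l := 0)).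
- congr EFin; rewrite /F /g !mulr0 addr0 expR0 cos0 sin0.
  by field; rewrite !gt_eqF.
- move=> x; exact: is_derive_continuous (is_derive_mul (is_derive_expm _ _)
    (is_derive_add (is_derive_cst _ _ _) (is_derive_cosv _ _))).
- move=> x; rewrite mulr_ge0 ?expR_ge0//; by have := cos_geN1 (v * x + 0); lra.
- apply: (@cvg_exp_bounded _ _ (eps^-1 + (eps ^+ 2 + v ^+ 2)^-1 * (eps + `|v|))) => // x.
  rewrite /g; apply: (le_trans (ler_normD _ _)); rewrite normrN gtr0_norm ?invr_gt0// lerD2l.
  rewrite normrM gtr0_norm ?invr_gt0// ler_wpM2l ?invr_ge0 ?(ltW D0)//.
  apply: (le_trans (ler_normD _ _)); rewrite !normrM normrN (gtr0_norm eps0) lerD//.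
    by rewrite ler_piMr ?(ltW eps0)// cos_max.
  by rewrite ler_piMr// sin_max.
Qed.

Lemma integral_exp_cos eps v : 0 < eps ->
  (\int[lam]_x (expR (- eps * `|x|) * (1 + cos (v * x)))%:E =
   (2 * (eps^-1 + eps / (eps ^+ 2 + v ^+ 2)))%:E)%E.
Proof.
move=> eps0; rewrite ge0_symfun_integralT.
- rewrite EFinM -integral_exp_cos_half// -set_itvcy; congr (_ * _)%E.
  apply: eq_integral => x; rewrite inE/= in_itv/= andbT => x0.
  by rewrite ger0_norm// !addr0.
- move=> x; rewrite mulr_ge0 ?expR_ge0//; by have := cos_geN1 (v * x); lra.
- move=> x; apply: cvgM.
    apply: continuous_comp; last exact: continuous_expR.
    by apply: cvgMr; exact: norm_continuous.
  apply: cvgD; first exact: cvg_cst.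
  apply: continuous_comp; last exact: continuous_cos.
  exact: mulrl_continuous.
- by move=> x /=; rewrite normrN mulrN cosN.
Qed.

Lemma measurable_exp_norm eps :
  measurable_fun setT (fun x : R => expR (- eps * `|x|)).
Proof.
by apply: measurableT_comp => //; exact: measurable_funM.
Qed.

Lemma measurable_cos_lin v a : measurable_fun setT (fun x : R => cos (v * x + a)).
Proof.
apply: continuous_measurable_fun => x.
exact: is_derive_continuous (is_derive_comp (is_derive_lin _ _ _) (is_derive_cos _)).
Qed.

Lemma rintegrable_exp_norm eps : 0 < eps ->
  rintegrable lam (fun x => expR (- eps * `|x|)).
Proof.
move=> eps0; apply: (@le_rintegrable _ _ _ lam _ (fun x => expR (- eps * `|x|) * (1 + cos (0 * x + 0)))).
- exact: measurable_exp_norm.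
- move=> x; rewrite mul0r addr0 cos0 ger0_norm ?expR_ge0//.
  by have := expR_ge0 (- eps * `|x|); lra.
- apply: ge0_rintegrable.
  + apply: measurable_funM; first exact: measurable_exp_norm.
    by apply: measurable_funD => //; exact: measurable_cos_lin.
  + by move=> x; rewrite mulr_ge0 ?expR_ge0//; have := cos_geN1 (0 * x + 0); lra.
  + under eq_integral do rewrite addr0.
    by rewrite integral_exp_cos// ltry.
Qed.

Lemma rintegrable_exp_norm_cos eps v a : 0 < eps ->
  rintegrable lam (fun x => expR (- eps * `|x|) * cos (v * x + a)).
Proof.
move=> eps0; apply: (le_rintegrable _ _ (rintegrable_exp_norm eps0)).
  by apply: measurable_funM; [exact: measurable_exp_norm|exact: measurable_cos_lin].
by move=> x; rewrite normrM ger0_norm ?expR_ge0// ler_piMr ?expR_ge0// cos_max.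
Qed.

Lemma rintegral_exp_norm_cos eps v : 0 < eps ->
  \int[lam]_x (expR (- eps * `|x|) * cos (v * x)) =
  2 * eps / (eps ^+ 2 + v ^+ 2).
Proof.
move=> eps0.
have ei := rintegrable_exp_norm eps0.
have ci : rintegrable lam (fun x => expR (- eps * `|x|) * cos (v * x)).
  by apply: eq_rintegrable (rintegrable_exp_norm_cos v 0 eps0) => x; rewrite addr0.
have E w : rintegrable lam (fun x => expR (- eps * `|x|) * cos (w * x)) ->
  \int[lam]_x (expR (- eps * `|x|)) + \int[lam]_x (expR (- eps * `|x|) * cos (w * x)) =
  2 * (eps^-1 + eps / (eps ^+ 2 + w ^+ 2)).
  move=> wi; rewrite -rintegralD//; apply: EFin_inj.
  rewrite EFin_Rintegral; last exact: rintegrableD.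
  by rewrite -integral_exp_cos//; apply: eq_integral => x _; rewrite mulrDr mulr1.
(* At frequency 0 the two integrals in [E] coincide, which isolates the integral of the
   exponential. *)
have E0 : \int[lam]_x (expR (- eps * `|x|)) = 2 / eps.
  have i0 : rintegrable lam (fun x => expR (- eps * `|x|) * cos (0 * x)).
    by apply: eq_rintegrable ei => x; rewrite mul0r cos0 mulr1.
  have := E 0 i0.
  rewrite (_ : \int[lam]_x (expR (- eps * `|x|) * cos (0 * x)) =
    \int[lam]_x (expR (- eps * `|x|))); last first.
    by apply: eq_Rintegral => x _; rewrite mul0r cos0 mulr1.
  rewrite (_ : eps / (eps ^+ 2 + 0 ^+ 2) = eps^-1); first by lra.
  by field; rewrite gt_eqF.
have D0 : 0 < eps ^+ 2 + v ^+ 2 by rewrite ltr_pwDl// ?sqr_ge0// exprn_gt0.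
have := E v ci; rewrite E0 => /(canRL (addKr _)) ->.
by field; rewrite !gt_eqF.
Qed.

End poisson_kernel.

Section approximate_identity.
Variable R : realType.
Local Notation lam := (@lebesgue_measure R).
Implicit Types (g : R -> R) (eps v x s : R).

Let is_derive_atan1 (x : R) : is_derive x 1 atan (1 + x ^+ 2)^-1.
Proof.
by apply: DeriveDef; [exact: derivable_atan|rewrite -derive1E derive1_atan].
Qed.

Lemma integral_cauchy : (\int[lam]_v (1 + v ^+ 2)^-1%:E = pi%:E)%E.
Proof.
have d0 (x : R) : 0 < 1 + x ^+ 2 by rewrite ltr_pwDl// sqr_ge0.
have c (x : R) : {for x, continuous (fun y : R => (1 + y ^+ 2)^-1)}.
  apply: cvgV; first by rewrite gt_eqF.
  by apply: cvgD; [exact: cvg_cst|exact: exprn_continuous].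
rewrite ge0_symfun_integralT.
- rewrite -set_itvcy (ge0_ftc_itvcy 0 is_derive_atan1 c _ (@cvgy_atan R)).
    by rewrite atan0 subr0 -EFinM; congr EFin; field.
  by move=> x; rewrite invr_ge0 ltW.
- by move=> x; rewrite invr_ge0 ltW.
- exact: c.
- by move=> x /=; rewrite sqrrN.
Qed.

Lemma measurable_cauchy : measurable_fun setT (fun v : R => (1 + v ^+ 2)^-1).
Proof.
apply: continuous_measurable_fun => x; apply: cvgV.
  by rewrite gt_eqF// ltr_pwDl// sqr_ge0.
by apply: cvgD; [exact: cvg_cst|exact: exprn_continuous].
Qed.

Lemma rintegrable_cauchy : rintegrable lam (fun v => (1 + v ^+ 2)^-1).
Proof.
apply: ge0_rintegrable; first exact: measurable_cauchy.
- by move=> x; rewrite invr_ge0 addr_ge0// sqr_ge0.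
- by rewrite integral_cauchy ltry.
Qed.

(** This is [2 pi] times the Poisson kernel of the half-plane, hence the factor in
    [poisson_conv_cvg]. *)
Definition poisson eps v := 2 * eps / (eps ^+ 2 + v ^+ 2).

Lemma measurable_poisson eps : 0 < eps -> measurable_fun setT (poisson eps).
Proof.
move=> eps0; apply: continuous_measurable_fun => x; apply: cvgM.
  exact: cvg_cst.
apply: cvgV; first by rewrite gt_eqF// ltr_pwDl ?exprn_gt0// sqr_ge0.
by apply: cvgD; [exact: cvg_cst|exact: exprn_continuous].
Qed.

Lemma poisson_ge0 eps v : 0 < eps -> 0 <= poisson eps v.
Proof. by move=> e0; rewrite divr_ge0// ?mulr_ge0 ?(ltW e0)// addr_ge0 ?sqr_ge0. Qed.

Lemma poissonE eps v : 0 < eps ->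
  poisson eps v = 2 / eps * (1 + (eps^-1 * v + 0) ^+ 2)^-1.
Proof.
move=> e0; rewrite /poisson addr0; field.
by rewrite gt_eqF//= gt_eqF// ltr_pwDl// ?exprn_gt0// sqr_ge0.
Qed.

Lemma rintegrable_poisson eps : 0 < eps -> rintegrable lam (poisson eps).
Proof.
move=> e0; apply: (@eq_rintegrable _ _ _ lam (fun v => 2 / eps * (1 + (eps^-1 * v + 0) ^+ 2)^-1)).
  by move=> v; rewrite poissonE.
apply: rintegrableZl.
by apply: (rintegrable_affine 0 _ rintegrable_cauchy); rewrite invr_gt0.
Qed.

Lemma rintegrable_cauchy_bounded g C : measurable_fun setT g ->
  (forall x, `|g x| <= C) -> rintegrable lam (fun v => g v * (1 + v ^+ 2)^-1).
Proof.
move=> mg gC; apply: (@le_rintegrable _ _ _ lam _ (fun v => C * (1 + v ^+ 2)^-1)).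
- exact: measurable_funM mg measurable_cauchy.
- move=> x; rewrite normrM; apply: ler_pM => //.
  by rewrite ger0_norm// invr_ge0 addr_ge0// sqr_ge0.
- exact: rintegrableZl rintegrable_cauchy.
Qed.

Lemma rintegral_poisson_conv eps g C s : 0 < eps -> measurable_fun setT g ->
  (forall x, `|g x| <= C) ->
  \int[lam]_a (g a * poisson eps (a - s)) =
  2 * \int[lam]_v (g (s + eps * v) * (1 + v ^+ 2)^-1).
Proof.
move=> e0 mg gC.
pose f v := g (s + eps * v) * (1 + v ^+ 2)^-1.
have fi : rintegrable lam f.
  apply: (@rintegrable_cauchy_bounded (fun v => g (s + eps * v)) C) => //.
  by apply: (measurableT_comp mg); apply: measurable_funD => //; apply: measurable_funM.
have e1 : 0 < eps^-1 by rewrite invr_gt0.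
rewrite -rintegralZl//.
have := rintegral_affine (- (eps^-1 * s)) e1 (rintegrableZl (2 / eps) fi).
rewrite invrK [X in _ = eps * X]rintegralZl// mulrA.
rewrite (_ : eps * (2 / eps) = 2); last by field; rewrite gt_eqF.
rewrite -rintegralZl// => <-; apply: eq_Rintegral => a _.
rewrite /f poissonE// addr0 mulrCA -mulrBr; congr (_ * (_ * _)).
by congr g; field; rewrite gt_eqF.
Qed.

(** The substitution [a = s + eps v] moves the parameter from the kernel into [g]; boundedness of
    [g] then gives domination by a multiple of the Cauchy density, and continuity gives the
    pointwise limit. *)
Lemma poisson_conv_cvg g C s : continuous g -> (forall x, `|g x| <= C) ->
  \int[lam]_a (g a * poisson n.+1%:R^-1 (a - s)) @[n --> \oo] --> 2 * pi * g s.
Proof.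
move=> cg gC.
have mg : measurable_fun setT g by exact: continuous_measurable_fun.
under eq_fun do rewrite (rintegral_poisson_conv _ _ mg gC)//.
rewrite -mulrA; apply: cvgM; first exact: cvg_cst.
have -> : pi * g s = \int[lam]_v (g s * (1 + v ^+ 2)^-1).
  rewrite rintegralZl; last exact: rintegrable_cauchy.
  by rewrite mulrC /Rintegral integral_cauchy.
have [] := @rintegral_cvg _ _ _ lam (fun n v => g (s + n.+1%:R^-1 * v) * (1 + v ^+ 2)^-1)
  (fun v => g s * (1 + v ^+ 2)^-1) (fun v => C * (1 + v ^+ 2)^-1).
- move=> n; apply: measurable_funM measurable_cauchy.
  by apply: (measurableT_comp mg); apply: measurable_funD => //; apply: measurable_funM.
- move=> v; apply: cvgM; last exact: cvg_cst.
  have h : s + n.+1%:R^-1 * v @[n --> \oo] --> s + 0 * v.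
    apply: cvgD; first exact: cvg_cst.
    by apply: cvgM; [exact: cvg_harmonic|exact: cvg_cst].
  rewrite mul0r addr0 in h.
  exact: (cvg_comp _ g h (cg s)).
- exact: rintegrableZl rintegrable_cauchy.
- move=> n v; rewrite normrM ler_pM//.
  by rewrite ger0_norm// invr_ge0 addr_ge0// sqr_ge0.
- by [].
Qed.

End approximate_identity.

Section fourier_inversion.
Variable R : realType.
Local Notation lam := (@lebesgue_measure R).
Variables (q : R -> R) (C : R).
Hypotheses (cq : continuous q) (qC : forall x, `|q x| <= C) (qi : rintegrable lam q).

Definition cos_transform x := \int[lam]_r (q r * cos (x * r)).

Lemma measurable_cos_mul : measurable_fun setT (fun p : R * R => cos (p.1 * p.2)).
Proof.
apply: measurableT_comp; first by apply: continuous_measurable_fun; exact: continuous_cos.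
exact: measurable_funM.
Qed.

Lemma measurable_cos_mulr (x : R) : measurable_fun setT (fun r : R => cos (x * r)).
Proof.
apply: measurableT_comp; first by apply: continuous_measurable_fun; exact: continuous_cos.
exact: measurable_funM.
Qed.

Lemma rintegrable_mulcos (f : R -> R) x : rintegrable lam f ->
  rintegrable lam (fun r => f r * cos (x * r)).
Proof.
move=> fi; apply: (le_rintegrable _ _ (rintegrable_norm fi)).
  apply: measurable_funM; first exact: rintegrable_measurable fi.
  exact: measurable_cos_mulr.
by move=> r; rewrite normrM ler_piMr// cos_max.
Qed.

Lemma measurable_cos_transform : measurable_fun setT cos_transform.
Proof.
have := @measurable_rintegral2 _ _ (measurableTypeR R) (measurableTypeR R) R lam
  (fun p => q p.2 * cos (p.1 * p.2)); apply.
apply: measurable_funM; last exact: measurable_cos_mul.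
apply: measurableT_comp; last exact: measurable_snd.
exact: continuous_measurable_fun.
Qed.

Lemma cos_transform_even x : cos_transform (- x) = cos_transform x.
Proof. by apply: eq_Rintegral => r _; rewrite mulNr cosN. Qed.

(* Fubini against [exp (- eps `|x|)], whose transform is the Poisson kernel, and
   [eps --> 0]. *)
Lemma cos_transform_inversion s : rintegrable lam cos_transform ->
  \int[lam]_x (cos_transform x * cos (x * s)) = pi * (q s + q (- s)).
Proof.
move=> Ki.
pose e n : R := n.+1%:R^-1.
have e0 n : 0 < e n by rewrite invr_gt0.
pose u n := \int[lam]_x (expR (- e n * `|x|) * (cos_transform x * cos (x * s))).
have u1 : u n @[n --> \oo] --> \int[lam]_x (cos_transform x * cos (x * s)).
  have mKc : measurable_fun setT (fun x => cos_transform x * cos (x * s)).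
    apply: measurable_funM measurable_cos_transform _.
    by under eq_fun do rewrite mulrC; exact: measurable_cos_mulr.
  have [] := @rintegral_cvg _ _ _ lam
    (fun n x => expR (- e n * `|x|) * (cos_transform x * cos (x * s)))
    (fun x => cos_transform x * cos (x * s)) (fun x => `|cos_transform x|).
  - by move=> n; apply: measurable_funM mKc; exact: measurable_exp_norm.
  - move=> x; rewrite -[X in _ --> X]mul1r; apply: cvgM; last exact: cvg_cst.
    rewrite -expR0; apply: (cvg_comp _ expR); last exact: continuous_expR.
    have : - e n * `|x| @[n --> \oo] --> - 0 * `|x|.
      by apply: cvgM; [apply: cvgN; exact: cvg_harmonic|exact: cvg_cst].
    by rewrite oppr0 mul0r.
  - exact: rintegrable_norm.
  - move=> n x; rewrite normrM ger0_norm ?expR_ge0// normrM.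
    rewrite -[leRHS]mul1r; apply: ler_pM; rewrite ?expR_ge0 ?mulr_ge0//.
      by rewrite -expR0 ler_expR mulNr oppr_le0 mulr_ge0// ltW.
    by rewrite ler_piMr// cos_max.
  - by [].
pose v n := 2^-1 * (\int[lam]_a (q a * poisson (e n) (a - s)) +
                    \int[lam]_a (q a * poisson (e n) (a - - s))).
(* The product [cos (x r) cos (x s)] is half the sum of [cos (x (r - s))] and [cos (x (r + s))], so
   integrating in [x] first produces Poisson kernels centred at [s] and at [- s]. *)
have uv n : u n = v n.
  have pi_ a : rintegrable lam (fun r => q r * poisson (e n) (r - a)).
    apply: (@le_rintegrable _ _ _ lam _ (fun r => C * poisson (e n) (r - a))).
    - apply: measurable_funM; first exact: rintegrable_measurable qi.
      apply: (measurableT_comp (measurable_poisson (e0 n))).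
      exact: measurable_funD.
    - move=> r; rewrite normrM (ger0_norm (poisson_ge0 _ (e0 n))).
      by rewrite ler_wpM2r// poisson_ge0.
    - by apply: rintegrableZl; apply: rintegrable_sub; exact: rintegrable_poisson.
  rewrite /v -rintegralD// -rintegralZl; last exact: rintegrableD.
  pose f (p : measurableTypeR R * measurableTypeR R) :=
    expR (- e n * `|p.1|) * (q p.2 * cos (p.1 * p.2) * cos (p.1 * s)).
  have fi : rintegrable (lam \x lam)%E f.
    have := @rintegrableX _ _ _ _ _ lam lam _ _ (rintegrable_exp_norm (e0 n)) (rintegrable_norm qi).
    apply: le_rintegrable.
    - apply: measurable_funM.
        apply: (measurableT_comp (measurable_exp_norm (e n))); exact: measurable_fst.
      apply: measurable_funM; [apply: measurable_funM|].
      + by apply: (measurableT_comp (rintegrable_measurable qi)); exact: measurable_snd.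
      + exact: measurable_cos_mul.
      + apply: (@measurableT_comp _ _ _ _ _ _ (fun x : R => cos (x * s))); last exact: measurable_fst.
        by under eq_fun do rewrite mulrC; exact: measurable_cos_mulr.
    - move=> p; rewrite normrM ger0_norm ?expR_ge0// ler_wpM2l ?expR_ge0//.
      by rewrite !normrM -mulrA ler_piMr// mulr_ile1 ?cos_max.
  have := rintegral_fubini_eq fi; rewrite /f /=.
  rewrite (_ : \int[lam]_x _ = u n); last first.
    apply: eq_Rintegral => x _; rewrite rintegralZl.
      congr (_ * _); under eq_Rintegral do rewrite mulrC.
      rewrite rintegralZl 1?mulrC//; exact: rintegrable_mulcos.
    apply: (@eq_rintegrable _ _ _ lam (fun r => cos (x * s) * (q r * cos (x * r)))).
      by move=> r; rewrite mulrC.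
    by apply: rintegrableZl; exact: rintegrable_mulcos.
  move=> ->; apply: eq_Rintegral => r _.
  rewrite /poisson -!rintegral_exp_norm_cos//.
  have ci w : rintegrable lam (fun x => expR (- e n * `|x|) * cos (w * x)).
    by apply: eq_rintegrable (rintegrable_exp_norm_cos w 0 (e0 n)) => x; rewrite addr0.
  rewrite -!rintegralZl -?rintegralD -?rintegralZl//; try exact: rintegrableZl;
    try by apply: rintegrableD; exact: rintegrableZl.
  apply: eq_Rintegral => x _.
  rewrite opprK mulrBl mulrDl cosB cosD (mulrC x r) (mulrC x s).
  by field.
have v1 : v n @[n --> \oo] --> 2^-1 * (2 * pi * q s + 2 * pi * q (- s)).
  apply: cvgM; first exact: cvg_cst.
  by apply: cvgD; exact: poisson_conv_cvg.
have E : u = v by apply/funext.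
rewrite E in u1; have := cvg_unique _ u1 v1 => ->//.
by field.
Qed.

End fourier_inversion.

Section bump.
Variable R : realType.
Local Notation lam := (@lebesgue_measure R).

(* The larger [N], the faster the cosine transform of [bump N] decays; this
   transform is the kernel of the pairing. *)
Definition bump N (r : R) : R := Num.max 0 (1 - r ^+ 2) ^+ N.

Lemma bump_ge0 N r : 0 <= bump N r.
Proof. by rewrite exprn_ge0// le_max lexx. Qed.

Lemma bump_le1 N r : bump N r <= 1.
Proof.
rewrite exprn_ile1 ?le_max ?lexx// ge_max ler01/=.
by have := sqr_ge0 r; lra.
Qed.

Lemma bump_out N r : (0 < N)%N -> 1 <= `|r| -> bump N r = 0.
Proof.
move=> N0 r1; rewrite /bump (_ : Num.max 0 _ = 0) ?expr0n ?gtn_eqF//.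
apply/max_idPl; rewrite subr_le0 -[leRHS](real_normK (num_real r)).
by rewrite -(expr1n _ 2) ler_sqr// ?nnegrE.
Qed.

Lemma bump_in N r : `|r| <= 1 -> bump N r = (1 - r ^+ 2) ^+ N.
Proof.
move=> r1; rewrite /bump (_ : Num.max 0 _ = 1 - r ^+ 2)//.
apply/max_idPr; rewrite subr_ge0 -[leLHS](real_normK (num_real r)).
by rewrite -(expr1n _ 2) ler_sqr// ?nnegrE.
Qed.

Lemma bump0 N : bump N 0 = 1.
Proof. by rewrite bump_in ?normr0// expr0n subr0 expr1n. Qed.

Lemma bump_even N r : bump N (- r) = bump N r.
Proof. by rewrite /bump sqrrN. Qed.

Lemma continuous_bump N : continuous (bump N).
Proof.
move=> x; apply: (@continuous_comp _ _ _ (fun r : R => Num.max 0 (1 - r ^+ 2)) (fun y => y ^+ N)).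
  apply: (@continuous_max _ _ (fun=> 0) (fun r : R => 1 - r ^+ 2)); first exact: cvg_cst.
  by apply: cvgB; [exact: cvg_cst|exact: exprn_continuous].
exact: exprn_continuous.
Qed.

Lemma rintegrable_bump N : (0 < N)%N -> rintegrable lam (bump N).
Proof.
move=> N0; apply: (@le_rintegrable _ _ _ lam _ (\1_`[-1, 1])).
- by apply: continuous_measurable_fun; exact: continuous_bump.
- move=> x; rewrite ger0_norm ?bump_ge0// indicE mem_setE.
  have [x1|/negbTE x1] := boolP (x \in `[-1, 1]); first by rewrite bump_le1.
  rewrite bump_out//; move: x1; rewrite in_itv/= -ler_norml.
  by move/negbT; rewrite -ltNge => /ltW.
- exact: integrable_indic_itv.
Qed.

Definition bumphat N := cos_transform (bump N).

Lemma bumphat_itv N x : (0 < N)%N ->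
  bumphat N x = \int[lam]_(r in `[-1, 1]) ((1 - r ^+ 2) ^+ N * cos (x * r)).
Proof.
move=> N0; rewrite /bumphat /cos_transform [RHS]Rintegral_mkcond.
apply: eq_Rintegral => r _; rewrite patchE mem_setE.
have [r1|/negbTE r1] := boolP (r \in `[-1, 1]).
  by rewrite bump_in//; move: r1; rewrite in_itv/= -ler_norml.
rewrite bump_out ?mul0r//; move: r1; rewrite in_itv/= -ler_norml.
by move/negbT; rewrite -ltNge => /ltW.
Qed.

(* Two integrations by parts. *)
Lemma bumphat_rec n x :
  x ^+ 2 * bumphat n.+3 x =
  (4 * n.+3%:R * n.+2%:R + 2 * n.+3%:R) * bumphat n.+2 x -
  (4 * n.+3%:R * n.+2%:R) * bumphat n.+1 x.
Proof.
rewrite !bumphat_itv//.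
set A := 4 * _ * _.
pose Q (k : nat) (r : R) : R := (1 - r ^+ 2) ^+ k.
have dQ k (r : R) : is_derive r (1 : R) (Q k.+1) (- (2 * k.+1%:R) * (r * Q k r)).
  have h : is_derive r 1 (fun y : R => 1 - y ^+ 2) (- (2 * r)).
    by apply: is_derive_eq; rewrite /GRing.scale /= mulr1; ring.
  have -> : Q k.+1 = (fun y : R => 1 - y ^+ 2) ^+ k.+1 by rewrite exprfctE.
  apply: (is_derive_eq (is_deriveX k.+1 h)).
  by rewrite /Q /GRing.scale /=; ring.
(* [F] collects the boundary terms of both integrations: it vanishes at -1 and 1, and the integral
   of its derivative [f] is the difference of the two sides of the recursion. *)
pose F (r : R) : R := x * (Q n.+3 r * sin (x * r + 0)) + (- (2 * n.+3%:R)) * (r * Q n.+2 r * cos (x * r + 0)).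
pose f (r : R) : R := (x ^+ 2 * Q n.+3 r + A * Q n.+1 r - (A + 2 * n.+3%:R) * Q n.+2 r) * cos (x * r + 0).
have alg (r y c s : R) :
  x * ((1 - r ^+ 2) * ((1 - r ^+ 2) * y) * (c * x) +
       s * (- (2 * n.+3%:R) * (r * ((1 - r ^+ 2) * y)))) +
  - (2 * n.+3%:R) * (r * ((1 - r ^+ 2) * y) * (- s * x) +
    c * (r * (- (2 * n.+2%:R) * (r * y)) + (1 - r ^+ 2) * y * 1)) =
  (x ^+ 2 * ((1 - r ^+ 2) * ((1 - r ^+ 2) * y)) + 4 * n.+3%:R * n.+2%:R * y
   - (4 * n.+3%:R * n.+2%:R + 2 * n.+3%:R) * ((1 - r ^+ 2) * y)) * c.
  by ring.
have ds (r : R) : is_derive r 1 (fun y => sin (x * y + 0)) (cos (x * r + 0) * x).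
  exact: is_derive_comp (is_derive_lin _ _ _) (is_derive_sin _).
have dc (r : R) : is_derive r 1 (fun y => cos (x * y + 0)) (- sin (x * r + 0) * x).
  exact: is_derive_comp (is_derive_lin _ _ _) (is_derive_cos _).
have cQ k : continuous (Q k).
  case: k => [|k] r; last exact: is_derive_continuous (dQ k r).
  by rewrite (_ : Q 0%N = cst 1)//; exact: cvg_cst.
have dF (r : R) : is_derive r 1 F (f r).
  apply: (is_derive_eq (is_derive_add
     (is_derive_scale x (is_derive_mul (dQ n.+2 r) (ds r)))
     (is_derive_scale _ (is_derive_mul (is_derive_mul (is_derive_id _ _) (dQ n.+1 r)) (dc r))))).
  rewrite /f /A (_ : Q n.+3 r = (1 - r ^+ 2) * ((1 - r ^+ 2) * Q n.+1 r)); last first.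
    by rewrite /Q !exprS.
  rewrite (_ : Q n.+2 r = (1 - r ^+ 2) * Q n.+1 r); last by rewrite /Q exprS.
  exact: alg.
have cf : continuous f.
  move=> r; apply: cvgM; last exact: (is_derive_continuous (dc r)).
  apply: cvgB; last by apply: cvgM; [exact: cvg_cst|exact: cQ].
  by apply: cvgD; apply: cvgM; solve [exact: cvg_cst|exact: cQ].
have N11 : (- 1 : R) <= 1 by lra.
have := ftc_itvcc N11 dF cf.
rewrite /F /Q sqrrN expr1n subrr !exprS !mul0r !(mulr0, mul0r, addr0) subrr.
have cc : continuous (fun y : R => cos (x * y)).
  rewrite (_ : (fun y => cos (x * y)) = (fun y => cos (x * y + 0))).
    by move=> r; exact: is_derive_continuous (dc r).
  by apply/funext => y; rewrite addr0.
have gi k : lam.-integrable `[-1, 1] (EFin \o (fun r => (1 - r ^+ 2) ^+ k * cos (x * r))).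
  apply: continuous_compact_integrable; first exact: segment_compact.
  apply: continuous_subspaceT => r; apply: cvgM; first exact: cQ.
  exact: cc.
rewrite -!RintegralZl//.
move=> /esym E; apply/eqP; rewrite -subr_eq0; apply/eqP; rewrite [RHS]E.
have giZ k c : lam.-integrable `[-1, 1] (EFin \o (fun r => c * ((1 - r ^+ 2) ^+ k * cos (x * r)))).
  have := @integrableZl _ _ _ lam `[-1, 1] (measurable_itv _) c _ (gi k).
  by [].
have giB k c k' c' : lam.-integrable `[-1, 1] (EFin \o (fun r => c * ((1 - r ^+ 2) ^+ k * cos (x * r)) - c' * ((1 - r ^+ 2) ^+ k' * cos (x * r)))).
  by have := @integrableB _ _ _ lam `[-1, 1] (measurable_itv _) _ _ (giZ k c) (giZ k' c').
rewrite -!RintegralB//; apply: eq_Rintegral => r _.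
by rewrite /f /Q addr0; ring.
Qed.

End bump.

(** * Kernels with compactly supported transform *)

Section bump_decay.
Variable R : realType.
Local Notation lam := (@lebesgue_measure R).

Lemma measurable_bumphat N : measurable_fun setT (@bumphat R N).
Proof. exact: measurable_cos_transform (@continuous_bump R N). Qed.

(** Each use of [bumphat_rec] trades a factor [x ^+ 2] for a loss of at most two in the exponent of
    the bump, hence the condition [m.*2 <= N]. *)
Lemma bumphat_decay m N : (m.*2 <= N)%N ->
  exists C : R, forall x, `|x ^+ m.*2 * bumphat N.+1 x| <= C.
Proof.
elim: m N => [|m IH] N.
  move=> _; exists (\int[lam]_r `|bump N.+1 r|) => x; rewrite expr0 mul1r.
  have bi := @rintegrable_bump R N.+1 isT.
  apply: (le_trans (le_normr_Rintegral measurableT (rintegrable_mulcos x bi))).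
  apply: le_rintegral.
  - exact: rintegrable_norm (rintegrable_mulcos x bi).
  - exact: rintegrable_norm.
  - by move=> r; rewrite normrM ler_piMr// cos_max.
case: N => [//|[//|n]]; rewrite doubleS !ltnS => mn.
have [C1 H1] := IH n mn; have [C2 H2] := IH n.+1 (leqW mn).
exists ((4 * n.+3%:R * n.+2%:R + 2 * n.+3%:R) * C2 + (4 * n.+3%:R * n.+2%:R) * C1) => x.
rewrite -addn2 exprD -mulrA bumphat_rec mulrBr.
rewrite (le_trans (ler_normB _ _))// mulrCA [X in _ + `|X|]mulrCA.
by rewrite normrM [X in _ + X]normrM lerD// ger0_norm ?ler_wpM2l.
Qed.

Lemma bumphat_bound m : exists2 C : R, 0 < C &
  forall x, `|bumphat m.*2.+1 x| * (1 + x ^+ m.*2) <= C.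
Proof.
have [C0 H0] := @bumphat_decay 0 m.*2 isT.
have [C H] := @bumphat_decay m m.*2 (leqnn _).
exists (C0 + C + 1) => [|x].
  have := le_trans (normr_ge0 _) (H0 0); have := le_trans (normr_ge0 _) (H 0); lra.
have := H0 x; rewrite expr0 mul1r; have := H x.
have x0 : 0 <= x ^+ m.*2 by rewrite -mul2n exprM exprn_ge0// sqr_ge0.
by rewrite normrM ger0_norm// mulrDr mulr1 [X in _ -> _ -> _ + X <= _]mulrC; lra.
Qed.

(** Combined with [bumphat_bound], this dominates [K ^+ 2] times [|x|^k] by a multiple of the Cauchy
    density. *)
Lemma powR_cauchy_bound (m : nat) (k x : R) : (0 < m)%N -> 0 <= k <= m.*2%:R ->
  `|x| `^ k * (1 + x ^+ 2) <= 2 * (1 + x ^+ m.*2) ^+ 2.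
Proof.
move=> m0 /andP[k0 km].
have x0 : 0 <= x ^+ m.*2 by rewrite -mul2n exprM exprn_ge0// sqr_ge0.
have xE : x ^+ m.*2 = `|x| `^ m.*2%:R.
  by rewrite powR_mulrn// -mul2n !exprM real_normK// num_real.
have x2E : x ^+ 2 = `|x| ^+ 2 by rewrite real_normK// num_real.
have [x1|/ltW x1] := leP `|x| 1.
  have h1 : `|x| `^ k <= 1.
    have [->|x_neq0] := eqVneq `|x| 0.
      have [->|k_neq0] := eqVneq k 0; first by rewrite powRr0.
      by rewrite powR0// ler01.
    rewrite -(powRr0 `|x|) ger_powR// x1 andbT normr_gt0.
    by move: x_neq0; rewrite normr_eq0.
  have h2 : x ^+ 2 <= 1 by rewrite x2E exprn_ile1.
  apply: (@le_trans _ _ (1 * (1 + 1))); last by nra.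
  by apply: ler_pM; rewrite ?powR_ge0//; have := sqr_ge0 x; lra.
have h1 : `|x| `^ k <= x ^+ m.*2 by rewrite xE ler_powR.
have h2 : x ^+ 2 <= x ^+ m.*2.
  rewrite xE x2E -powR_mulrn//; apply: ler_powR => //.
  by rewrite ler_nat -addnn; case: m m0 {h1 km x0 xE} => // m _; rewrite addnS addSn.
apply: (@le_trans _ _ (x ^+ m.*2 * (1 + x ^+ m.*2))); last by nra.
by apply: ler_pM; rewrite ?powR_ge0//; have := sqr_ge0 x; lra.
Qed.

(** [K] is the cosine transform of a bump; inversion gives back [2 pi] times this bump, which is
    even, supported in [[-1, 1]] and equal to 1 at 0. The exponent of the bump is chosen according
    to [k0], which bounds the moments of [K ^+ 2] needed later. *)
Lemma exists_kernel (k0 : R) : exists K q : R -> R,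
  [/\ measurable_fun setT K, rintegrable lam K,
      (forall k, 0 <= k <= k0 -> rintegrable lam (fun x => K x ^+ 2 * `|x| `^ k)),
      (forall x, K (- x) = K x) &
      [/\ forall s, \int[lam]_x (K x * cos (x * s)) = q s,
          forall s, 1 <= `|s| -> q s = 0 & 0 < q 0]].
Proof.
have [m m0 km] : exists2 m, (0 < m)%N & k0 <= m.*2%:R.
  exists (Num.trunc `|k0|).+1 => //.
  have h := truncnS_gt `|k0|.
  rewrite (le_trans (ler_norm _))// (le_trans (ltW h))// ler_nat -addnn leq_addr//.
have [C C0 HC] := bumphat_bound m.
have mK := measurable_bumphat m.*2.+1.
have d0 (x : R) : 0 < 1 + x ^+ 2 by rewrite ltr_pwDl// sqr_ge0.
have xm0 (x : R) : 0 <= x ^+ m.*2 by rewrite -mul2n exprM exprn_ge0// sqr_ge0.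
have Ki : rintegrable lam (@bumphat R m.*2.+1).
  apply: (@le_rintegrable _ _ _ lam _ (fun x => 2 * C * (1 + x ^+ 2)^-1)) => //; last first.
    exact: rintegrableZl (@rintegrable_cauchy R).
  move=> x; rewrite ler_pdivlMr//.
  have h : 1 + x ^+ 2 <= 2 * (1 + x ^+ m.*2).
    have [x1|/ltW x1] := leP `|x| 1.
      have h2 : x ^+ 2 <= 1 by rewrite -(real_normK (num_real x)) exprn_ile1.
      by move: (x ^+ m.*2) (xm0 x) => y y0; lra.
    suff : x ^+ 2 <= x ^+ m.*2 by move: (x ^+ m.*2) (xm0 x) => y y0 ?; lra.
    rewrite -mul2n exprM -[leLHS]expr1; apply: ler_weXn2l => //.
    by rewrite -(real_normK (num_real x)) exprn_ege1.
  apply: (le_trans (ler_wpM2l (normr_ge0 _) h)).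
  by rewrite mulrCA ler_wpM2l.
exists (@bumphat R m.*2.+1), (fun s => 2 * pi * bump m.*2.+1 s); split => //.
- move=> k /andP[k_ge0 kk0].
  apply: (@le_rintegrable _ _ _ lam _ (fun x => 2 * C ^+ 2 * (1 + x ^+ 2)^-1)); last first.
  + exact: rintegrableZl (@rintegrable_cauchy R).
  + move=> x.
    have n0 : 0 <= bumphat m.*2.+1 x ^+ 2 * `|x| `^ k.
      by rewrite mulr_ge0 ?sqr_ge0 ?powR_ge0.
    rewrite (ger0_norm n0) ler_pdivlMr// -mulrA.
    apply: (@le_trans _ _ (bumphat m.*2.+1 x ^+ 2 * (2 * (1 + x ^+ m.*2) ^+ 2))).
      by rewrite ler_wpM2l ?sqr_ge0// powR_cauchy_bound// k_ge0 (le_trans kk0).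
    rewrite mulrCA ler_wpM2l// -(real_normK (num_real (bumphat _ _))) -exprMn.
    by rewrite lerXn2r ?nnegrE ?mulr_ge0 ?addr_ge0// ltW.
  + apply: measurable_funM; first exact: measurable_funX.
    apply: (@measurableT_comp _ _ _ _ _ _ (fun y : R => y `^ k)).
      exact: measurable_powR.
    exact: normr_measurable.
- by move=> x; exact: cos_transform_even.
- split.
  + move=> s; rewrite (@cos_transform_inversion _ (bump m.*2.+1) 1)//.
    * by rewrite bump_even; ring.
    * exact: continuous_bump.
    * by move=> x; rewrite ger0_norm ?bump_ge0// bump_le1.
    * exact: rintegrable_bump.
  + by move=> s s1; rewrite bump_out// mulr0.
  + by rewrite bump0 mulr1 mulr_gt0// pi_gt0.
Qed.

End bump_decay.

Section scaled_kernel.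
Variable R : realType.
Local Notation lam := (@lebesgue_measure R).
Variables (K q : R -> R).
Hypotheses (Ki : rintegrable lam K) (Keven : forall x, K (- x) = K x)
  (Kq : forall s, \int[lam]_x (K x * cos (x * s)) = q s).
Implicit Types (e s th k : R).

Lemma rintegrable_kernel_scaled e : 0 < e -> rintegrable lam (fun x => K (e * x)).
Proof.
move=> e0; apply: eq_rintegrable (rintegrable_affine 0 e0 Ki) => x.
by rewrite addr0.
Qed.

Lemma kernel_sin s : \int[lam]_x (K x * sin (x * s)) = 0.
Proof.
have si : rintegrable lam (fun x => K x * sin (x * s)).
  apply: (le_rintegrable _ _ (rintegrable_norm Ki)).
    apply: measurable_funM; first exact: rintegrable_measurable Ki.
    apply: measurableT_comp; last exact: measurable_funM.
    by apply: continuous_measurable_fun; exact: continuous_sin.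
  by move=> x; rewrite normrM ler_piMr// sin_max.
have := rintegral_opp si.
rewrite (_ : \int[lam]_x _ = - \int[lam]_x (K x * sin (x * s))); first by lra.
rewrite -mulN1r -rintegralZl//; apply: eq_Rintegral => x _.
by rewrite Keven mulNr sinN mulrN mulN1r.
Qed.

(** The phase [th] carries the remaining variables when one variable is integrated at a time; its
    sine part drops out because [K] is even. *)
Lemma kernel_cos_phase e s th : 0 < e ->
  \int[lam]_x (K (e * x) * cos (x * s + th)) = cos th * (e^-1 * q (s / e)).
Proof.
move=> e0.
have ci : rintegrable lam (fun x => K x * cos (x * (s / e))).
  by apply: eq_rintegrable (rintegrable_mulcos (s / e) Ki) => x; rewrite [x * _]mulrC.
have si : rintegrable lam (fun x => K x * sin (x * (s / e))).
  apply: (le_rintegrable _ _ (rintegrable_norm Ki)).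
    apply: measurable_funM; first exact: rintegrable_measurable Ki.
    apply: measurableT_comp; last exact: measurable_funM.
    by apply: continuous_measurable_fun; exact: continuous_sin.
  by move=> x; rewrite normrM ler_piMr// sin_max.
pose f x := cos th * (K x * cos (x * (s / e))) - sin th * (K x * sin (x * (s / e))).
have fi : rintegrable lam f by apply: rintegrableB; exact: rintegrableZl.
transitivity (\int[lam]_x f (e * x + 0)).
  apply: eq_Rintegral => x _; rewrite /f addr0 cosD.
  rewrite (_ : e * x * (s / e) = x * s); last by field; rewrite gt_eqF.
  by ring.
rewrite rintegral_affine// /f rintegralB; try exact: rintegrableZl.
by rewrite !rintegralZl// kernel_sin mulr0 subr0 Kq mulrCA.
Qed.

Lemma kernel_sqr_scaled e k : 0 < e ->
  rintegrable lam (fun x => K x ^+ 2 * `|x| `^ k) ->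
  rintegrable lam (fun x => K (e * x) ^+ 2 * `|x| `^ k) /\
  \int[lam]_x (K (e * x) ^+ 2 * `|x| `^ k) =
  e `^ (- (k + 1)) * \int[lam]_x (K x ^+ 2 * `|x| `^ k).
Proof.
move=> e0 fi; pose f x := K x ^+ 2 * `|x| `^ k.
have E x : e `^ (- k) * f (e * x + 0) = K (e * x) ^+ 2 * `|x| `^ k.
  rewrite /f addr0 normrM (gtr0_norm e0) powRM ?(ltW e0)// powRN.
  by field; rewrite gt_eqF// powR_gt0.
split.
  apply: (@eq_rintegrable _ _ _ lam _ _ E); apply: rintegrableZl.
  exact: (rintegrable_affine 0 e0 fi).
under eq_Rintegral do rewrite -E.
rewrite rintegralZl; last exact: (rintegrable_affine 0 e0 fi).
rewrite (rintegral_affine 0 e0 fi) mulrA; congr (_ * _).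
by rewrite opprD powRD ?powR_inv1 ?(ltW e0)// (gt_eqF e0) implybT.
Qed.

End scaled_kernel.

(** * Densities and the normal law *)

Section density.
Context d (T : measurableType d) (R : realType).
Variables (m nu : {measure set T -> \bar R}) (p : T -> R).
Hypotheses (mp : measurable_fun setT p) (p0 : forall x, 0 <= p x).
Hypothesis nuE : forall A, measurable A -> (nu A = \int[m]_(x in A) (p x)%:E)%E.

Import HBNNSimple.

Let integral_density_nnsfun (h : {nnsfun T >-> R}) :
  (\int[nu]_x (h x)%:E = \int[m]_x (h x * p x)%:E)%E.
Proof.
under eq_integral do rewrite fimfunE -fsumEFin//.
rewrite ge0_integral_fsum//; last 2 first.
  - by move=> r; exact/measurable_EFinP/measurableT_comp.
  - by move=> r x _; rewrite EFinM nnfun_muleindic_ge0.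
have E x : ((h x * p x)%:E = \sum_(r \in range h) ((r * \1_(h @^-1` [set r]) x)%:E * (p x)%:E))%E.
  by rewrite EFinM {1}fimfunE -fsumEFin// ge0_mule_fsuml// => r; rewrite EFinM nnfun_muleindic_ge0.
under [RHS]eq_integral do rewrite E.
rewrite ge0_integral_fsum//; last 2 first.
  - move=> r; apply: emeasurable_funM; apply/measurable_EFinP => //.
    exact: measurableT_comp.
  - move=> r x _; apply: mule_ge0; rewrite ?lee_fin//.
    by rewrite -lee_fin EFinM nnfun_muleindic_ge0.
apply: eq_fsbigr => r _.
rewrite integralZl_indic_nnsfun// integral_indic// setIT nuE//.
under [RHS]eq_integral do rewrite EFinM -muleA.
(* For [r < 0] the fibre of the nonnegative function [h] is empty and both sides vanish. *)
have [r0|r0] := leP 0 r.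
  rewrite ge0_integralZl//; last 2 first.
  - by apply: emeasurable_funM; apply/measurable_EFinP.
  - by move=> x _; rewrite mule_ge0 ?lee_fin.
  congr (_ * _)%E; rewrite [LHS]integral_mkcond; apply: eq_integral => x _.
  by rewrite patchE indicE; case: ifPn => _; rewrite ?mul1e ?mul0e.
rewrite preimage_nnfun0// integral_set0 mule0 integral0_eq// => x _.
by rewrite indic0 mul0e mule0.
Qed.

Lemma ge0_integral_density (f : T -> R) : measurable_fun setT f ->
  (forall x, 0 <= f x) ->
  (\int[nu]_x (f x)%:E = \int[m]_x (f x * p x)%:E)%E.
Proof.
move=> mf f0.
have mef : measurable_fun setT (EFin \o f) by exact/measurable_EFinP.
pose f_ := nnsfun_approx measurableT mef.
have f_f x : (f_ n x)%:E @[n --> \oo] --> (f x)%:E.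
  by apply: (@cvg_nnsfun_approx _ _ _ _ measurableT _ mef) => // y _; rewrite lee_fin.
have f_fp x : (f_ n x * p x)%:E @[n --> \oo] --> (f x * p x)%:E.
  under eq_fun do rewrite EFinM; rewrite EFinM.
  by apply: cvgeM => //; exact: cvg_cst.
transitivity (limn (fun n => \int[nu]_x (f_ n x)%:E)%E).
  rewrite -monotone_convergence//.
  - by apply: eq_integral => x _; apply/esym/cvg_lim => //; exact: f_f.
  - by move=> n; exact/measurable_EFinP.
  - by move=> n x _; rewrite lee_fin.
  - by move=> x _ a b ab; rewrite lee_fin; exact/lefP/nd_nnsfun_approx.
transitivity (limn (fun n => \int[m]_x (f_ n x * p x)%:E)%E).
  by congr (limn _); apply/funext => n; exact: integral_density_nnsfun.
rewrite -monotone_convergence//.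
- by apply: eq_integral => x _; apply/cvg_lim => //; exact: f_fp.
- by move=> n; apply/measurable_EFinP; exact: measurable_funM.
- by move=> n x _; rewrite lee_fin mulr_ge0.
- by move=> x _ a b ab; rewrite lee_fin ler_wpM2r//; exact/lefP/nd_nnsfun_approx.
Qed.

Lemma rintegrable_density (f : T -> R) : measurable_fun setT f ->
  rintegrable nu f <-> rintegrable m (fun x => f x * p x).
Proof.
move=> mf.
have E : (\int[nu]_x `|f x|%:E = \int[m]_x `|f x * p x|%:E)%E.
  rewrite (@ge0_integral_density (fun x => `|f x|))//; last exact: measurableT_comp.
  by apply: eq_integral => x _; rewrite normrM (ger0_norm (p0 x)).
split=> /integrableP[_ H]; apply/integrableP; split; try exact/measurable_EFinP.
- by apply/measurable_EFinP; exact: measurable_funM.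
- by move: H; rewrite [X in (X < _)%E]E.
- by rewrite [X in (X < _)%E]E.
Qed.

Lemma rintegral_density (f : T -> R) : rintegrable nu f ->
  \int[nu]_x f x = \int[m]_x (f x * p x).
Proof.
move=> fi; have mf := rintegrable_measurable fi.
have fpi := (rintegrable_density mf).1 fi.
have E : (fun x => f x) = (fun x => f^\+ x - f^\- x).
  by apply/funext => x; rewrite -{1}(funrposBneg f).
have pi_ := integrable_funrpos measurableT fi.
have ni := integrable_funrneg measurableT fi.
rewrite E rintegralB//.
have P g : rintegrable nu g -> (forall x, 0 <= g x) ->
    \int[nu]_x g x = \int[m]_x (g x * p x) /\ rintegrable m (fun x => g x * p x).
  move=> gi g0; have mg := rintegrable_measurable gi; split.
    by congr fine; exact: ge0_integral_density.
  exact/rintegrable_density.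
have [-> Pi] := P _ pi_ (fun x => funrpos_ge0 f x).
have [-> Ni] := P _ ni (fun x => funrneg_ge0 f x).
rewrite -rintegralB//; apply: eq_Rintegral => x _.
by rewrite -mulrBl -[in RHS](funrposBneg f).
Qed.

End density.

Section integral_derivative.
Variable R : realType.
Local Notation lam := (@lebesgue_measure R).

(** Integrability of [f] allows the integral to be computed along the intervals [[-n, n]], so the
    boundary terms are controlled only along the integers. *)
Lemma rintegral_derivative (F f : R -> R) :
  (forall x, is_derive x (1 : R) F (f x)) -> continuous f ->
  rintegrable lam f ->
  F n%:R @[n --> \oo] --> (0 : R) -> F (- n%:R) @[n --> \oo] --> (0 : R) ->
  \int[lam]_x f x = 0.
Proof.
move=> dF cf fi F1 F2.
have mf := rintegrable_measurable fi.
pose u (n : nat) := \int[lam]_x (f x * \1_(`[- n%:R, n%:R] : set R) x).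
have u_dom (n : nat) x : `|f x * \1_(`[- n%:R, n%:R] : set R) x| <= `|f x|.
  by rewrite normrM ler_piMr// indicE; case: (_ \in _); rewrite ?normr1 ?normr0.
have u_cvg x : f x * \1_(`[- n%:R, n%:R] : set R) x @[n --> \oo] --> f x.
  apply: cvg_near_cst; near=> n.
  rewrite indicE mem_setE in_itv/= -ler_norml.
  have -> : `|x| <= n%:R by near: n; exact: nbhs_infty_ger.
  by rewrite mulr1.
have [_ u1] := @rintegral_cvg _ _ _ lam (fun (n : nat) x => f x * \1_(`[- n%:R, n%:R] : set R) x)
  f (fun x => `|f x|)
  (fun n => measurable_funM mf (measurable_indic (measurable_itv _))) u_cvg
  (rintegrable_norm fi) u_dom.
have E : u = fun n => F n%:R - F (- n%:R).
  apply/funext => n; rewrite -(ftc_itvcc _ dF cf).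
    rewrite [RHS]Rintegral_mkcond; apply: eq_Rintegral => x _.
    by rewrite patchE indicE; case: ifPn; rewrite ?mulr1 ?mulr0.
  by rewrite (@le_trans _ _ 0)// oppr_le0.
have u2 : u n @[n --> \oo] --> (0 - 0 : R) by rewrite E; apply: cvgB.
by have := cvg_unique _ u1 u2 => ->//; rewrite subrr.
Unshelve. all: by end_near. Qed.

End integral_derivative.

Section normal_law.
Variable R : realType.
Local Notation lam := (@lebesgue_measure R).
Variable s : R.
Hypothesis s0 : s != 0.
Local Notation G := (normal_pdf 0 s).

Lemma normal_pdfE0 x : G x = normal_peak s * expR (- (2 * s ^+ 2)^-1 * x ^+ 2).
Proof.
rewrite normal_pdfE// /normal_fun subr0; congr (_ * expR _).
by rewrite mulNr mulrC -mulr_natl mulNr.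
Qed.

Lemma is_derive_normal_pdf (x : R) : is_derive x (1 : R) G (- (s ^+ 2)^-1 * (x * G x)).
Proof.
have -> : G = fun x => normal_peak s * expR (- (2 * s ^+ 2)^-1 * (x * x)).
  by apply/funext => y; rewrite normal_pdfE0.
apply: (is_derive_eq (is_derive_scale _ (is_derive_comp
  (is_derive_scale _ (is_derive_mul (is_derive_id _ _) (is_derive_id _ _)))
  (is_derive_expR _)))) => /=.
have alg (N e : R) : N * (e * (- (2 * s ^+ 2)^-1 * (x * 1 + x * 1))) =
  - (s ^+ 2)^-1 * (x * (N * e)) by field.
exact: alg.
Qed.

(** One domination serves both the integrability of functions of growth [1 + x ^+ 2] and the
    vanishing of boundary terms. *)
Lemma normal_pdf_bound : exists2 B : R, 0 <= B & forall x : R, (1 + x ^+ 2) * G x <= B * (1 + x ^+ 2)^-1.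
Proof.
(* With [u = x^2 / (2 s^2)], one has [1 + x^2 <= c (1 + u / 2) <= c exp (u / 2)]; squaring gives the
   bound. *)
pose c := 1 + 4 * s ^+ 2.
have c1 : 1 <= c by rewrite lerDl mulr_ge0// sqr_ge0.
exists (normal_peak s * c ^+ 2).
  by rewrite mulr_ge0 ?normal_peak_ge0// sqr_ge0.
move=> x; pose u := (2 * s ^+ 2)^-1 * x ^+ 2.
have d0 : 0 < 1 + x ^+ 2 by rewrite ltr_pwDl// sqr_ge0.
have u0 : 0 <= u by rewrite mulr_ge0 ?sqr_ge0// invr_ge0 mulr_ge0 ?sqr_ge0.
have xu : x ^+ 2 = 4 * s ^+ 2 * (u / 2) by rewrite /u; field.
have h1 : 1 + x ^+ 2 <= c * (1 + u / 2).
  have u2 : 0 <= u / 2 by rewrite divr_ge0.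
  have s2 : 0 <= s ^+ 2 by exact: sqr_ge0.
  by rewrite xu /c; nra.
have h2 : (1 + x ^+ 2) ^+ 2 <= c ^+ 2 * expR u.
  apply: (@le_trans _ _ ((c * expR (u / 2)) ^+ 2)).
    rewrite lerXn2r ?nnegrE ?(ltW d0)//.
      by rewrite mulr_ge0 ?expR_ge0// (le_trans _ c1).
    apply: (le_trans h1); rewrite ler_wpM2l ?(le_trans _ c1)//.
    exact: expR_ge1Dx.
  rewrite exprMn -expRM_natl.
  by rewrite (_ : 2 * (u / 2) = u)//; field.
rewrite normal_pdfE0 mulNr -/u ler_pdivlMr// expRN.
rewrite [leLHS](_ : _ = normal_peak s * ((1 + x ^+ 2) ^+ 2 / expR u)); last by ring.
by rewrite ler_wpM2l ?normal_peak_ge0// ler_pdivrMr ?expR_gt0.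
Qed.

Lemma measurable_normal : measurable_fun setT G.
Proof. exact: measurable_normal_pdf. Qed.

Lemma rintegrable_normal (f : R -> R) : measurable_fun setT f ->
  (forall x, `|f x| <= 1 + x ^+ 2) -> rintegrable lam (fun x => f x * G x).
Proof.
move=> mf fx; have [B B0 HB] := normal_pdf_bound.
apply: (@le_rintegrable _ _ _ lam _ (fun x => B * (1 + x ^+ 2)^-1)).
- exact: measurable_funM mf measurable_normal.
- move=> x; rewrite normrM (ger0_norm (normal_pdf_ge0 0 s x)).
  by apply: (le_trans _ (HB x)); rewrite ler_wpM2r// normal_pdf_ge0.
- exact: rintegrableZl (@rintegrable_cauchy R).
Qed.

Lemma normal_cvg0 (f : R -> R) (u : nat -> R) : (forall n, `|u n| = n%:R) ->
  (forall x, `|f x| <= 1 + x ^+ 2) -> f (u n) * G (u n) @[n --> \oo] --> (0 : R).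
Proof.
move=> un fx; have [B B0 HB] := normal_pdf_bound.
have B1 : B * n.+1%:R^-1 @[n --> \oo] --> (0 : R).
  by rewrite -(mulr0 B); apply: cvgM; [exact: cvg_cst|exact: cvg_harmonic].
have B2 : B * (1 + n%:R ^+ 2)^-1 @[n --> \oo] --> (0 : R).
  apply: (@squeeze_cvgr _ _ _ _ (cst 0) _ _ _ 0 _ B1); last exact: cvg_cst.
  apply: nearW => n /=; rewrite mulr_ge0 ?invr_ge0 ?addr_ge0 ?sqr_ge0//=.
  rewrite ler_wpM2l// lef_pV2 ?posrE ?ltr_pwDl ?sqr_ge0//.
  rewrite -nat1r lerD2l; case: n => [|n]; first exact: sqr_ge0.
  by rewrite -natrX ler_nat expnS expn1 leq_pmulr.
apply/norm_cvg0P; apply: (@squeeze_cvgr _ _ _ _ (cst 0) _ _ _ 0 _ B2); last exact: cvg_cst.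
apply: nearW => n /=; rewrite normr_ge0/= normrM (ger0_norm (normal_pdf_ge0 0 s _)).
rewrite -un real_normK ?num_real//.
by apply: (le_trans _ (HB _)); rewrite ler_wpM2r// normal_pdf_ge0.
Qed.

(** The derivative of [x G] is [G - x^2 G / s^2], whose total integral is 0. *)
Lemma normal_second_moment :
  rintegrable lam (fun x => x ^+ 2 * G x) /\ \int[lam]_x (x ^+ 2 * G x) = s ^+ 2.
Proof.
have i2 : rintegrable lam (fun x => x ^+ 2 * G x).
  apply: rintegrable_normal; first exact: measurable_funX.
  by move=> x; rewrite ger0_norm ?sqr_ge0// lerDr.
split => //.
have i1 : rintegrable lam (fun x => 1 * G x).
  by apply: rintegrable_normal => // x; rewrite normr1 lerDl sqr_ge0.
pose f (x : R) : R := 1 * G x - (s ^+ 2)^-1 * (x ^+ 2 * G x).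
have dG := is_derive_normal_pdf.
have dF (x : R) : is_derive x (1 : R) (fun x => x * G x) (f x).
  apply: (is_derive_eq (is_derive_mul (is_derive_id _ _) (dG x))).
  have alg (g : R) : x * (- (s ^+ 2)^-1 * (x * g)) + g * 1 = 1 * g - (s ^+ 2)^-1 * (x ^+ 2 * g) by ring.
  exact: alg.
have cG : continuous G by move=> x; exact: is_derive_continuous (dG x).
have cf : continuous f.
  move=> x; apply: cvgB; first by apply: cvgM; [exact: cvg_cst|exact: cG].
  apply: cvgM; first exact: cvg_cst.
  by apply: cvgM; [exact: exprn_continuous|exact: cG].
have fi : rintegrable lam f by apply: rintegrableB => //; exact: rintegrableZl.
have xle (x : R) : `|x| <= 1 + x ^+ 2.
  by rewrite -(real_normK (num_real x)); have := normr_ge0 x; nra.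
have := rintegral_derivative dF cf fi.
rewrite /f rintegralB//; last exact: rintegrableZl.
have iG : rintegrable lam G by apply: eq_rintegrable i1 => x; rewrite mul1r.
rewrite !rintegralZl// mul1r (_ : \int[lam]_x G x = 1); last first.
  by rewrite /Rintegral integral_normal_pdf.
move=> H; have : 1 - (s ^+ 2)^-1 * \int[lam]_x (x ^+ 2 * G x) = 0.
  have n1 n : `|n%:R : R| = n%:R by rewrite ger0_norm.
  have n2 n : `|- n%:R : R| = n%:R by rewrite normrN ger0_norm.
  exact: H (@normal_cvg0 id _ n1 xle) (@normal_cvg0 id _ n2 xle).
move/eqP; rewrite subr_eq0 => /eqP E.
by rewrite -[RHS]mulr1 E mulrA divff ?mul1r// expf_neq0.
Qed.

(* [Phi l = E cos (l X)] solves [Phi' = - s^2 l Phi]. *)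
Lemma normal_cos1 : \int[lam]_x (cos x * G x) = expR (- (s ^+ 2 / 2)).
Proof.
pose f (l x : R) : R := cos (l * x) * G x.
pose Phi (l : R) := \int[lam]_x f l x.
have mcos l : measurable_fun setT (fun x : R => cos (l * x)).
  exact: measurable_cos_mulr.
have sq1 (y x : R) : `|y| <= 1 -> `|y| <= 1 + x ^+ 2.
  by move=> y1; rewrite (le_trans y1)// lerDl sqr_ge0.
have xle (x : R) : `|x| <= 1 + x ^+ 2.
  by rewrite -(real_normK (num_real x)); have := normr_ge0 x; nra.
have fi l : rintegrable lam (f l).
  by apply: rintegrable_normal => // x; apply: sq1; exact: cos_max.
have msin l : measurable_fun setT (fun x : R => sin (l * x)).
  apply: measurableT_comp; last exact: measurable_funM.
  by apply: continuous_measurable_fun; exact: continuous_sin.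
have df l (x : R) : is_derive l (1 : R) (f ^~ x) (- (x * sin (l * x)) * G x).
  have dl : is_derive l (1 : R) (fun l => cos (x * l + 0)) (- sin (x * l + 0) * x).
    exact: is_derive_comp (is_derive_lin _ _ _) (is_derive_cos _).
  rewrite (_ : f ^~ x = fun l => G x * cos (x * l + 0)); last first.
    by apply/funext => y; rewrite /f addr0 mulrC [y * x]mulrC.
  apply: (is_derive_eq (is_derive_scale _ dl)).
  by rewrite addr0 [l * x]mulrC; ring.
have xsi l : rintegrable lam (fun x => (x * sin (l * x)) * G x).
  apply: rintegrable_normal; first exact: measurable_funM.
  by move=> x; rewrite normrM (le_trans _ (xle x))// ler_piMr// sin_max.
have dPhi (l : R) : is_derive l (1 : R) Phi (- \int[lam]_x ((x * sin (l * x)) * G x)).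
  have xG : rintegrable lam (fun x => `|x| * G x).
    by apply: rintegrable_normal => // x; rewrite normr_id.
  have l01 : (`]l - 1, l + 1[%classic : set R) l by rewrite /= in_itv/=; apply/andP; split; lra.
  have dom : forall x y : R, (`]l - 1, l + 1[%classic : set R) x -> setT y ->
      `|partial1of2 f x y| <= `|y| * G y.
    move=> x y _ _; rewrite partial1of2E.
    have [_ ->] := df x y.
    rewrite normrM normrN normrM (ger0_norm (normal_pdf_ge0 0 s y)).
    by rewrite ler_wpM2r ?normal_pdf_ge0// ler_piMr// sin_max.
  have G0 : forall y : R, 0 <= `|y| * G y by move=> y; rewrite mulr_ge0// normal_pdf_ge0.
  have der : forall x y : R, (`]l - 1, l + 1[%classic : set R) x -> setT y -> derivable (f ^~ y) x 1.
    by move=> x y _ _; have [] := df x y.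
  apply: DeriveDef.
    exact: (@derivable_under_integral _ _ _ lam f setT measurableT l _ _ l01 (fun x _ => fi x) der _ G0 xG dom).
  rewrite -derive1E (@differentiation_under_integral _ _ _ lam f setT measurableT l _ _ l01 (fun x _ => fi x) der _ G0 xG dom).
  rewrite -mulN1r -rintegralZl//; apply: eq_Rintegral => x _.
  by rewrite partial1of2E; have [_ ->] := df l x; ring.
(* The function [sin (l x) G] vanishes at both ends and has derivative
   [l cos (l x) G - x sin (l x) G / s^2]; this turns the derivative of [Phi] back into a multiple of
   [Phi]. *)
have ibp l : \int[lam]_x ((x * sin (l * x)) * G x) = s ^+ 2 * l * Phi l.
  pose F (x : R) : R := sin (l * x + 0) * G x.
  pose g (x : R) : R := l * (cos (l * x) * G x) - (s ^+ 2)^-1 * ((x * sin (l * x)) * G x).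
  have ds (x : R) : is_derive x (1 : R) (fun y => sin (l * y + 0)) (cos (l * x + 0) * l).
    exact: is_derive_comp (is_derive_lin _ _ _) (is_derive_sin _).
  have dc (x : R) : is_derive x (1 : R) (fun y => cos (l * y + 0)) (- sin (l * x + 0) * l).
    exact: is_derive_comp (is_derive_lin _ _ _) (is_derive_cos _).
  have dG := is_derive_normal_pdf.
  have dF (x : R) : is_derive x (1 : R) F (g x).
    apply: (is_derive_eq (is_derive_mul (ds x) (dG x))).
    have alg (s1 c1 g1 : R) : s1 * (- (s ^+ 2)^-1 * (x * g1)) + g1 * (c1 * l) =
      l * (c1 * g1) - (s ^+ 2)^-1 * (x * s1 * g1) by ring.
    by rewrite /g addr0; exact: alg.
  have cG : continuous G by move=> x; exact: is_derive_continuous (dG x).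
  have cc : continuous (fun y : R => cos (l * y)).
    rewrite (_ : (fun y => cos (l * y)) = (fun y => cos (l * y + 0))).
      by move=> r; exact: is_derive_continuous (dc r).
    by apply/funext => y; rewrite addr0.
  have cs : continuous (fun y : R => sin (l * y)).
    rewrite (_ : (fun y => sin (l * y)) = (fun y => sin (l * y + 0))).
      by move=> r; exact: is_derive_continuous (ds r).
    by apply/funext => y; rewrite addr0.
  have cg : continuous g.
    move=> x; apply: cvgB; apply: cvgM; try exact: cvg_cst.
      by apply: cvgM; [exact: cc|exact: cG].
    by apply: cvgM; [apply: cvgM; [exact: cvg_id|exact: cs]|exact: cG].
  have gi : rintegrable lam g.
    by apply: rintegrableB; apply: rintegrableZl; [exact: fi|exact: xsi].
  have := rintegral_derivative dF cg gi.
  rewrite /g rintegralB; try (apply: rintegrableZl; solve [exact: fi|exact: xsi]).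
  rewrite !rintegralZl//; try exact: fi.
  move=> H; have : l * Phi l - (s ^+ 2)^-1 * \int[lam]_x (x * sin (l * x) * G x) = 0.
    have n1 n : `|n%:R : R| = n%:R by rewrite ger0_norm.
    have n2 n : `|- n%:R : R| = n%:R by rewrite normrN ger0_norm.
    have sb (x : R) : `|sin (l * x + 0)| <= 1 + x ^+ 2 by apply: sq1; exact: sin_max.
    exact: H (normal_cvg0 n1 sb) (normal_cvg0 n2 sb).
  move/eqP; rewrite subr_eq0 => /eqP E.
  by rewrite -mulrA E mulrA divff ?mul1r// expf_neq0.
pose h (l : R) : R := Phi l * expR (s ^+ 2 / 2 * (l * l)).
have dh (l : R) : is_derive l (1 : R) h 0.
  have dl2 : is_derive l (1 : R) (fun l => expR (s ^+ 2 / 2 * (l * l)))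
     (expR (s ^+ 2 / 2 * (l * l)) * (s ^+ 2 / 2 * (l * 1 + l * 1))).
    exact: is_derive_comp (is_derive_scale _ (is_derive_mul (is_derive_id _ _) (is_derive_id _ _))) (is_derive_expR _).
  apply: (is_derive_eq (is_derive_mul (dPhi l) dl2)); rewrite ibp.
  have alg (p e : R) : p * (e * (s ^+ 2 / 2 * (l * 1 + l * 1))) + e * - (s ^+ 2 * l * p) = 0 by field.
  exact: alg.
have := is_derive_0_is_cst 1 0 dh; rewrite /h !mulr0 expR0 !mulr1.
rewrite (_ : Phi 0 = 1); last first.
  rewrite /Phi /f; under eq_Rintegral do rewrite mul0r cos0 mul1r.
  by rewrite /Rintegral integral_normal_pdf.
rewrite (_ : Phi 1 = \int[lam]_x (cos x * G x)); last first.
  by apply: eq_Rintegral => x _; rewrite /f mul1r.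
move=> H; rewrite expRN -[LHS](mulfK (lt0r_neq0 (expR_gt0 (s ^+ 2 / 2)))) H.
by rewrite div1r.
Qed.

End normal_law.

(** * Fourier uniqueness *)

Section image_law.
Context d1 d2 (T1 : measurableType d1) (T2 : measurableType d2) (R : realType).
Variables (P : {measure set T1 -> \bar R}) (nu : {measure set T2 -> \bar R}).
Variable Y : T1 -> T2.
Hypothesis mY : measurable_fun setT Y.
Hypothesis law : forall A, measurable A -> (P [set w | A (Y w)] = nu A)%E.

Lemma ge0_integral_law (f : T2 -> \bar R) : measurable_fun setT f ->
  (forall x, 0 <= f x)%E -> (\int[P]_w f (Y w) = \int[nu]_x f x)%E.
Proof.
move=> mf f0; rewrite [RHS](eq_measure_integral (pushforward P Y)); last first.
  by move=> A mA _; rewrite -law.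
by rewrite [RHS]ge0_integral_pushforward.
Qed.

Lemma rintegrable_law (f : T2 -> R) : measurable_fun setT f ->
  rintegrable P (fun w => f (Y w)) <-> rintegrable nu f.
Proof.
move=> mf.
have E : (\int[P]_w `|f (Y w)|%:E = \int[nu]_x `|f x|%:E)%E.
  apply: (@ge0_integral_law (fun x => `|f x|%:E)) => //.
  by apply/measurable_EFinP; exact: measurableT_comp.
split=> /integrableP[_ H]; apply/integrableP; split; try exact/measurable_EFinP.
- by rewrite -[X in (X < _)%E]E.
- by apply/measurable_EFinP; exact: (measurableT_comp mf mY).
- by move: H; rewrite -[X in (X < _)%E]E.
Qed.

Lemma rintegral_law (f : T2 -> R) : measurable_fun setT f ->
  \int[P]_w f (Y w) = \int[nu]_x f x.
Proof.
move=> mf; have mfi : measurable_fun setT (EFin \o f) by exact/measurable_EFinP.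
congr fine; rewrite integralE [in RHS]integralE; congr (_ - _)%E.
- rewrite -(ge0_integral_law (measurable_funepos mfi))//.
  by apply: eq_integral => x _; rewrite !funeposE.
- rewrite -(ge0_integral_law (measurable_funeneg mfi))//.
  by apply: eq_integral => x _; rewrite !funenegE.
Qed.

End image_law.

Section centered_gaussian_theory.
Context (R : realType) (dO : measure_display) (Omega : measurableType dO).
Variable P : probability Omega R.
Local Notation lam := (@lebesgue_measure R).

Lemma bounded_rintegrable (Y : Omega -> R) C : measurable_fun setT Y ->
  (forall w, `|Y w| <= C) -> rintegrable P Y.
Proof.
move=> mY YC; apply: (@le_rintegrable _ _ _ P _ (fun=> C)) => //.
by apply: finite_measure_integrable_cst.
Qed.

Lemma rintegral_prob_cst (C : R) : \int[P]_w C = C.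
Proof. rewrite Rintegral_cst; last exact: measurableT.
have E : (P : {measure set Omega -> \bar R}) setT = 1%E by exact: probability_setT.
by rewrite [X in C * X](congr1 fine E) mulr1. Qed.

(** Only frequency 1 of the characteristic function is recorded: the Gaussian hypothesis covers all
    linear combinations, and their multiples give the other frequencies. The Dirac mass obeys the
    same formula with variance 0. *)
Lemma centered_gaussianP (Y : Omega -> R) : measurable_fun setT Y ->
  centered_gaussian P Y ->
  [/\ rintegrable P (fun w => Y w ^+ 2),
      \int[P]_w cos (Y w) = expR (- ((\int[P]_w (Y w ^+ 2)) / 2)) &
      \int[P]_w sin (Y w) = 0].
Proof.
move=> mY [s law].
have mcos : measurable_fun setT (@cos R).
  by apply: continuous_measurable_fun; exact: continuous_cos.
have msin : measurable_fun setT (@sin R).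
  by apply: continuous_measurable_fun; exact: continuous_sin.
have msq : measurable_fun setT (fun x : R => x ^+ 2) by exact: measurable_funX.
have [s0|s0] := eqVneq s 0; rewrite ?s0 ?eqxx ?(negbTE s0) in law.
  have i (f : R -> R) : measurable_fun setT f -> rintegrable (\d_(0 : R)) f.
    move=> mf; apply/integrableP; split; first exact/measurable_EFinP.
    rewrite integral_dirac ?diracT ?mul1e ?ltry//.
    by apply/measurable_EFinP; exact: measurableT_comp.
  have e (f : R -> R) : measurable_fun setT f -> \int[P]_w f (Y w) = f 0.
    move=> mf; rewrite (rintegral_law mY law)//.
    by rewrite /Rintegral integral_dirac ?diracT ?mul1e//; exact/measurable_EFinP.
  split.
  - exact/(rintegrable_law mY law msq)/i.
  - by rewrite e// (e (fun x => x ^+ 2))// expr0n/= mul0r oppr0 expR0 cos0.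
  - by rewrite e// sin0.
pose G : R -> R := normal_pdf 0 s.
have mG : measurable_fun setT G by exact: measurable_normal_pdf.
have G0 x : 0 <= G x by exact: normal_pdf_ge0.
pose nu : {measure set (measurableTypeR R) -> \bar R} := normal_prob 0 s.
have nuE A : measurable A -> (nu A = \int[lam]_(x in A) (G x)%:E)%E by [].
have nulaw A : measurable A -> (P [set w | A (Y w)] = nu A)%E by exact: law.
have e (f : R -> R) : measurable_fun setT f -> (forall x, `|f x| <= 1 + x ^+ 2) ->
    rintegrable P (fun w => f (Y w)) /\ \int[P]_w f (Y w) = \int[lam]_x (f x * G x).
  move=> mf fx.
  have fi : rintegrable nu f.
    by apply: (@rintegrable_density _ (measurableTypeR R) R lam nu G mG G0 nuE f mf).2;
      exact: rintegrable_normal.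
  split; first exact: (@rintegrable_law _ _ _ (measurableTypeR R) R P nu Y mY nulaw f mf).2.
  rewrite (@rintegral_law _ _ _ (measurableTypeR R) R P nu Y mY nulaw f)//.
  exact: (@rintegral_density _ (measurableTypeR R) R lam nu G mG G0 nuE f).
have sq1 (y x : R) : `|y| <= 1 -> `|y| <= 1 + x ^+ 2.
  by move=> y1; rewrite (le_trans y1)// lerDl sqr_ge0.
have [sqi sqE] : rintegrable P (fun w => Y w ^+ 2) /\
    \int[P]_w (Y w ^+ 2) = \int[lam]_x (x ^+ 2 * G x).
  by apply: (e (fun x => x ^+ 2)) => // x; rewrite ger0_norm ?sqr_ge0// lerDr.
split => //.
- rewrite (e cos _ _).2// => [|x]; last by apply: sq1; exact: cos_max.
  by rewrite normal_cos1// sqE (normal_second_moment s0).2.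
- have sb (x : R) : `|sin x| <= 1 + x ^+ 2 by apply: sq1; exact: sin_max.
  rewrite (e sin _ _).2//.
  have si : rintegrable lam (fun x => sin x * G x) by exact: rintegrable_normal.
  have := rintegral_opp si.
  rewrite (_ : \int[lam]_x (sin (- x) * G (- x)) = - \int[lam]_x (sin x * G x)); first by lra.
  rewrite -mulN1r -rintegralZl//; apply: eq_Rintegral => x _.
  by rewrite sinN /G !normal_pdfE0// sqrrN; ring.
Qed.

End centered_gaussian_theory.

Section uniqueness.
Context (R : realType) (dO : measure_display) (Omega : measurableType dO).
Variable P : probability Omega R.
Local Notation lam := (@lebesgue_measure R).

Lemma rintegrable_mul_bounded (z f : Omega -> R) C : rintegrable P z ->
  measurable_fun setT f -> (forall w, `|f w| <= C) ->
  rintegrable P (fun w => z w * f w).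
Proof.
move=> zi mf fC; apply: (@le_rintegrable _ _ _ P _ (fun w => C * `|z w|)).
- exact: measurable_funM (rintegrable_measurable zi) mf.
- by move=> w; rewrite normrM mulrC ler_wpM2r.
- by apply: rintegrableZl; exact: rintegrable_norm.
Qed.

Lemma measurable_cos_fun (V : Omega -> R) : measurable_fun setT V ->
  measurable_fun setT (fun w => cos (V w)).
Proof.
move=> mV; apply: measurableT_comp => //.
by apply: continuous_measurable_fun; exact: continuous_cos.
Qed.

(** Integrating the hypothesis over frequencies against [exp (- eps |x|)] shows that [z] is
    orthogonal to the Poisson kernel centred at any [a] and evaluated at [V]. Integrating this in
    [a] against [g] and letting [eps] tend to 0 recovers [g (V)]. *)
Lemma fourier_uniqueness_continuous (z V : Omega -> R) (g : R -> R) C :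
  rintegrable P z -> measurable_fun setT V ->
  (forall s th, \int[P]_w (z w * cos (s * V w + th)) = 0) ->
  continuous g -> (forall x, `|g x| <= C) ->
  \int[P]_w (z w * g (V w)) = 0.
Proof.
move=> zi mV H cg gC.
have mz := rintegrable_measurable zi.
have mg : measurable_fun setT g by exact: continuous_measurable_fun.
pose e n : R := n.+1%:R^-1.
have e0 n : 0 < e n by rewrite invr_gt0.
have Hp n a : \int[P]_w (z w * poisson (e n) (a - V w)) = 0.
  pose f (p : Omega * measurableTypeR R) := z p.1 * (expR (- e n * `|p.2|) * cos ((a - V p.1) * p.2)).
  have mf : measurable_fun setT f.
    apply: measurable_funM; first exact: measurableT_comp mz measurable_fst.
    apply: measurable_funM.
      exact: measurableT_comp (measurable_exp_norm (e n)) measurable_snd.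
    apply: measurableT_comp.
      by apply: continuous_measurable_fun; exact: continuous_cos.
    apply: measurable_funM; last exact: measurable_snd.
    by apply: measurable_funB => //; exact: measurableT_comp mV measurable_fst.
  have fi : rintegrable (P \x lam)%E f.
    have := @rintegrableX _ _ _ _ _ P lam _ _ (rintegrable_norm zi) (rintegrable_exp_norm (e0 n)).
    apply: le_rintegrable => // p; rewrite normrM ler_wpM2l//.
    by rewrite normrM ger0_norm ?expR_ge0// ler_piMr ?expR_ge0// cos_max.
  have := rintegral_fubini_eq fi; rewrite /f /=.
  rewrite (_ : \int[P]_w _ = \int[P]_w (z w * poisson (e n) (a - V w))); last first.
    apply: eq_Rintegral => w _; rewrite rintegralZl ?rintegral_exp_norm_cos//.
    by apply: eq_rintegrable (rintegrable_exp_norm_cos (a - V w) 0 (e0 n)) => x; rewrite addr0.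
  move=> ->; rewrite -[RHS](@rintegral0 _ _ _ lam); apply: eq_Rintegral => x _.
  have zci : rintegrable P (fun w => z w * cos ((- x) * V w + a * x)).
    apply: (rintegrable_mul_bounded (C := 1)) => //; last by move=> w; exact: cos_max.
    apply: measurable_cos_fun; apply: measurable_funD => //.
    exact: measurable_funM.
  rewrite -[RHS](mulr0 (expR (- e n * `|x|))) -(H (- x) (a * x)) -rintegralZl//.
  apply: eq_Rintegral => w _; rewrite mulrCA; congr (_ * (_ * cos _)).
  by ring.
have Hg n : \int[P]_w (z w * \int[lam]_a (g a * poisson (e n) (a - V w))) = 0.
  pose f (p : Omega * measurableTypeR R) := z p.1 * (g p.2 * poisson (e n) (p.2 - V p.1)).
  have mf : measurable_fun setT f.
    apply: measurable_funM; first exact: measurableT_comp mz measurable_fst.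
    apply: measurable_funM; first exact: measurableT_comp mg measurable_snd.
    apply: (measurableT_comp (measurable_poisson (e0 n))).
    apply: measurable_funB; first exact: measurable_snd.
    exact: measurableT_comp mV measurable_fst.
  have gpi w : rintegrable lam (fun a => g a * poisson (e n) (a - V w)).
    apply: (@le_rintegrable _ _ _ lam _ (fun a => C * poisson (e n) (a - V w))).
    - apply: measurable_funM => //; apply: (measurableT_comp (measurable_poisson (e0 n))).
      exact: measurable_funB.
    - move=> a; rewrite normrM (ger0_norm (poisson_ge0 _ (e0 n))).
      by rewrite ler_wpM2r// poisson_ge0.
    - by apply: rintegrableZl; apply: rintegrable_sub; exact: rintegrable_poisson.
  have fi : rintegrable (P \x lam)%E f.
    apply: (@rintegrable_product_le _ _ _ _ _ P lam f
      (fun w => (C * \int[lam]_a poisson (e n) a) * `|z w|)) => //.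
      by apply: rintegrableZl; exact: rintegrable_norm.
    apply: nearW => w /=.
    have psi : rintegrable lam (fun a => poisson (e n) (a - V w)).
      by apply: rintegrable_sub; exact: rintegrable_poisson.
    apply: (@le_trans _ _ (\int[lam]_a (`|z w| * (C * poisson (e n) (a - V w)))%:E)%E).
      apply: ge0_le_integral => //.
      - apply/measurable_EFinP; apply: measurableT_comp => //.
        apply: (@measurable_funM _ _ _ _ (fun=> z w) (fun a => g a * poisson (e n) (a - V w))) => //.
        exact: (rintegrable_measurable (gpi w)).
      - apply/measurable_EFinP; apply: measurable_funM => //; apply: measurable_funM => //.
        exact: (rintegrable_measurable psi).
      - move=> a _; rewrite lee_fin -[f _]/(z w * (g a * poisson (e n) (a - V w))).
        rewrite 2!normrM ler_wpM2l//.
        by rewrite (ger0_norm (poisson_ge0 _ (e0 n))) ler_wpM2r// poisson_ge0.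
    rewrite -EFin_Rintegral; last by do 2 apply: rintegrableZl.
    rewrite lee_fin rintegralZl; last exact: rintegrableZl.
    rewrite rintegralZl// (rintegral_sub _ (rintegrable_poisson (e0 n))).
    by rewrite mulrC.
  have <- : \int[P]_w \int[lam]_a (z w * (g a * poisson (e n) (a - V w))) =
      \int[P]_w (z w * \int[lam]_a (g a * poisson (e n) (a - V w))).
    by apply: eq_Rintegral => w _; rewrite rintegralZl.
  have -> := rintegral_fubini_eq fi.
  rewrite -[RHS](@rintegral0 _ _ _ lam); apply: eq_Rintegral => a _.
  have zpi : rintegrable P (fun w => z w * poisson (e n) (a - V w)).
    apply: (rintegrable_mul_bounded (C := 2 / e n)) => //.
      apply: (measurableT_comp (measurable_poisson (e0 n))).
      exact: measurable_funB.
    move=> w; rewrite (ger0_norm (poisson_ge0 _ (e0 n))) /poisson.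
    have h : 0 < e n ^+ 2 + (a - V w) ^+ 2 by rewrite ltr_pwDl ?exprn_gt0// sqr_ge0.
    rewrite ler_pdivrMr//.
    rewrite [leLHS](_ : _ = 2 / e n * e n ^+ 2); last by field; rewrite gt_eqF.
    by rewrite ler_wpM2l ?divr_ge0 ?(ltW (e0 n))// lerDl sqr_ge0.
  rewrite -[RHS](mulr0 (g a)) -(Hp n a) -rintegralZl//.
  by apply: eq_Rintegral => w _; rewrite mulrCA.
have mconv n : measurable_fun setT (fun w => \int[lam]_a (g a * poisson (e n) (a - V w))).
  have := @measurable_rintegral2 _ _ Omega (measurableTypeR R) R lam
    (fun p => g p.2 * poisson (e n) (p.2 - V p.1)); apply.
  apply: measurable_funM; first exact: measurableT_comp mg measurable_snd.
  apply: (measurableT_comp (measurable_poisson (e0 n))).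
  apply: measurable_funB; first exact: measurable_snd.
  exact: measurableT_comp mV measurable_fst.
have pi0 := @pi_gt0 R.
have convb n w : `|\int[lam]_a (g a * poisson (e n) (a - V w))| <= 2 * (C * pi).
  have Ci := rintegrableZl C (@rintegrable_cauchy R).
  have gi : rintegrable lam (fun v => g (V w + e n * v) * (1 + v ^+ 2)^-1).
    apply: (@rintegrable_cauchy_bounded _ (fun v => g (V w + e n * v)) C) => //.
    by apply: (measurableT_comp mg); apply: measurable_funD => //; exact: measurable_funM.
  rewrite (rintegral_poisson_conv _ (e0 n) mg gC) normrM ger0_norm// ler_wpM2l//.
  apply: (le_trans (le_normr_Rintegral measurableT gi)).
  apply: (@le_trans _ _ (\int[lam]_v (C * (1 + v ^+ 2)^-1))).
    apply: le_rintegral => //; first exact: rintegrable_norm.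
    move=> v; have h : 0 <= (1 + v ^+ 2)^-1 by rewrite invr_ge0 addr_ge0// sqr_ge0.
    by rewrite normrM (ger0_norm h) ler_wpM2r.
  by rewrite rintegralZl ?[\int[lam]_v _]/Rintegral ?integral_cauchy//; exact: rintegrable_cauchy.
pose I n w := \int[lam]_a (g a * poisson (e n) (a - V w)).
have dom n w : `|z w * I n w| <= 2 * (C * pi) * `|z w|.
  by rewrite normrM mulrC ler_wpM2r// convb.
have pw w : z w * I n w @[n --> \oo] --> z w * (2 * pi * g (V w)).
  by apply: cvgM; [exact: cvg_cst|exact: (@poisson_conv_cvg _ g C)].
have [_ lim] := @rintegral_cvg _ _ _ P (fun n w => z w * I n w)
  (fun w => z w * (2 * pi * g (V w))) (fun w => 2 * (C * pi) * `|z w|)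
  (fun n => measurable_funM mz (mconv n)) pw
  (rintegrableZl _ (rintegrable_norm zi)) dom.
have lim0 : \int[P]_w (z w * \int[lam]_a (g a * poisson (e n) (a - V w))) @[n --> \oo] --> (0 : R).
  by under eq_fun do rewrite Hg; exact: cvg_cst.
have zgi : rintegrable P (fun w => z w * g (V w)).
  by apply: (rintegrable_mul_bounded (C := C)) => //; exact: measurableT_comp.
have E : 2 * pi * \int[P]_w (z w * g (V w)) = 0.
  rewrite -rintegralZl// -[RHS](cvg_unique (@Rhausdorff R) lim lim0).
  by apply: eq_Rintegral => w _; rewrite mulrCA.
have p0 : 2 * pi != 0 :> R by rewrite gt_eqF// mulr_gt0.
by apply: (mulfI p0); rewrite E mulr0.
Qed.

End uniqueness.

Section set_integrals.
Context (R : realType) (dO : measure_display) (Omega : measurableType dO).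
Variable P : {measure set Omega -> \bar R}.
Variable z : Omega -> R.
Hypothesis zi : rintegrable P z.

Lemma rintegral_set_indic A : \int[P]_(w in A) z w = \int[P]_w (z w * \1_A w).
Proof.
rewrite Rintegral_mkcond; apply: eq_Rintegral => w _.
by rewrite patchE indicE; case: ifPn; rewrite ?mulr1 ?mulr0.
Qed.

Lemma rintegral_set0_setC A : measurable A -> \int[P]_w z w = 0 ->
  \int[P]_(w in A) z w = 0 -> \int[P]_(w in ~` A) z w = 0.
Proof.
move=> mA z0 zA; rewrite -z0 -(setUv A) Rintegral_setU//.
- by rewrite zA add0r.
- exact: measurableC.
- by rewrite setUv.
- by apply/disj_setPS => w [].
Qed.

Lemma rintegral_set0_bigcup (F : nat -> set Omega) : (forall k, measurable (F k)) ->
  trivIset setT F -> (forall k, \int[P]_(w in F k) z w = 0) ->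
  \int[P]_(w in \bigcup_k F k) z w = 0.
Proof.
move=> mF tF zF; have mU := bigcupT_measurable F mF.
have ziS A : measurable A -> P.-integrable A (EFin \o z).
  by move=> mA; apply: integrableS zi.
rewrite /Rintegral integral_bigcup//; last exact: ziS.
rewrite (eq_eseriesr (g := fun=> 0%E)); first by rewrite eseries0.
move=> k _; have := zF k; rewrite /Rintegral => zk.
by rewrite -[LHS]fineK ?zk//; apply: integrable_fin_num => //; exact: ziS.
Qed.

(** The measurable sets over which [z] integrates to 0 form a Dynkin system, the total integral 0
    giving the complements; the pi-lambda theorem concludes. *)
Lemma rintegral_set0_sigma (G : set (set Omega)) : setI_closed G ->
  G `<=` measurable -> \int[P]_w z w = 0 ->
  (forall A, G A -> \int[P]_(w in A) z w = 0) ->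
  forall A, <<s G >> A -> measurable A /\ \int[P]_(w in A) z w = 0.
Proof.
move=> GI Gm z0 zG A; rewrite -setI_closed_g_dynkin_g_sigma_algebra//.
move=> dA; suff: [set B | measurable B /\ \int[P]_(w in B) z w = 0] A by [].
move: A dA; apply: smallest_sub.
  split.
  - by split => //.
  - by move=> B [mB zB]; split; [exact: measurableC|exact: rintegral_set0_setC].
  - move=> F tF FD; split.
      by apply: bigcupT_measurable => k; have [] := FD k.
    by apply: rintegral_set0_bigcup => // k; have [] := FD k.
by move=> B GB; split; [exact: Gm|exact: zG].
Qed.

End set_integrals.

Section fourier_uniqueness.
Context (R : realType) (dO : measure_display) (Omega : measurableType dO).
Variable P : probability Omega R.

Lemma fourier_uniqueness_itv (z V : Omega -> R) c :
  rintegrable P z -> measurable_fun setT V ->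
  (forall s th, \int[P]_w (z w * cos (s * V w + th)) = 0) ->
  \int[P]_(w in V @^-1` `]-oo, c[) z w = 0.
Proof.
move=> zi mV H; have mz := rintegrable_measurable zi.
(* Continuous ramps tending pointwise to the indicator of the open half-line: at [x = c] they are
   all 0. *)
pose g (n : nat) (x : R) : R := Num.min 1 (Num.max 0 (n%:R * (c - x))).
have g0 n x : 0 <= g n x by rewrite le_min ler01 le_max lexx.
have g1 n x : `|g n x| <= 1 by rewrite ger0_norm// ge_min lexx.
have cg n : continuous (g n).
  move=> x; apply: (@continuous_min _ _ (fun=> 1) (fun x => Num.max 0 (n%:R * (c - x)))).
    exact: cvg_cst.
  apply: (@continuous_max _ _ (fun=> 0) (fun x => n%:R * (c - x))); first exact: cvg_cst.
  apply: cvgM; first exact: cvg_cst.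
  by apply: cvgB; [exact: cvg_cst|exact: cvg_id].
have mg n : measurable_fun setT (fun w => g n (V w)).
  by apply: measurableT_comp mV; exact: continuous_measurable_fun.
have glim w : z w * g n (V w) @[n --> \oo] --> z w * \1_(V @^-1` `]-oo, c[) w.
  apply: cvgM; first exact: cvg_cst.
  have memE : (w \in V @^-1` `]-oo, c[%classic) = (V w < c).
    by apply/idP/idP; rewrite inE/= in_itv.
  apply: cvg_near_cst; rewrite indicE memE.
  have [Vc|Vc] := ltP (V w) c.
    have cV0 : 0 < c - V w by rewrite subr_gt0.
    near=> n.
    have : (c - V w)^-1 <= n%:R by near: n; exact: nbhs_infty_ger.
    rewrite -(ler_pM2r cV0) mulVf ?gt_eqF// => h.
    by rewrite /g; apply/min_idPl; rewrite le_max h orbT.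
  near=> n.
  rewrite /g (_ : Num.max 0 _ = 0); first by apply/min_idPr.
  by apply/max_idPl; rewrite mulr_ge0_le0// subr_le0.
have [_ lim] := @rintegral_cvg _ _ _ P (fun n w => z w * g n (V w))
  (fun w => z w * \1_(V @^-1` `]-oo, c[) w) (fun w => `|z w|)
  (fun n => measurable_funM mz (mg n)) glim (rintegrable_norm zi)
  (fun n w => le_trans (eq_ind_r (fun t => t <= _) (ler_piMr (normr_ge0 _) (g1 n _)) (normrM _ _)) (lexx _)).
have lim0 : \int[P]_w (z w * g n (V w)) @[n --> \oo] --> (0 : R).
  under eq_fun do rewrite (fourier_uniqueness_continuous zi mV H (cg _) (g1 _)).
  exact: cvg_cst.
by rewrite rintegral_set_indic (cvg_unique (@Rhausdorff R) lim lim0).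
Unshelve. all: by end_near. Qed.

Lemma fourier_uniqueness1 (z V : Omega -> R) (B : set R) :
  rintegrable P z -> measurable_fun setT V ->
  (forall s th, \int[P]_w (z w * cos (s * V w + th)) = 0) ->
  measurable B -> \int[P]_(w in V @^-1` B) z w = 0.
Proof.
move=> zi mV H mB.
have z0 : \int[P]_w z w = 0.
  by rewrite -[RHS](H 0 0); apply: eq_Rintegral => w _; rewrite mul0r addr0 cos0 mulr1.
pose G : set (set Omega) := [set V @^-1` `]-oo, c[%classic | c in [set: R]].
suff : <<s G >> (V @^-1` B).
  have GI : setI_closed G.
    move=> _ _ [a _ <-] [b _ <-]; exists (Num.min a b) => //.
    by apply/seteqP; split => w /=; rewrite !in_itv/= lt_min => /andP.
  have Gm : G `<=` measurable.
    by move=> _ [c _ <-]; rewrite -[X in measurable X]setTI; exact: mV.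
  have zG A : G A -> \int[P]_(w in A) z w = 0.
    by move=> [c _ <-]; exact: fourier_uniqueness_itv.
  by move=> /(rintegral_set0_sigma zi GI Gm z0 zG)[].
have GB : (@RGenInftyO.G R).-sigma.-measurable B by rewrite -RGenInftyO.measurableE.
suff: [set B | <<s G >> (V @^-1` B)] B by [].
move: B GB {mB}; apply: smallest_sub.
  split => /=.
  - by rewrite preimage_set0; exact: sigma_algebra0.
  - by move=> C sC; rewrite setTD preimage_setC; exact: sigma_algebraC.
  - by move=> F sF; rewrite preimage_bigcup; exact: sigma_algebra_bigcup.
by move=> _ [c ->]; apply: sub_sigma_algebra; exists c.
Qed.

(** Induction on the number of variables: the indicator of the event on the first one is absorbed
    into [z]. The new [z] satisfies the hypothesis by the one-variable case applied to [z] times a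
    cosine of the other variables, since a product of two cosines is a half-sum of cosines of
    combinations of all variables. *)
Lemma fourier_uniqueness_box n (z : Omega -> R) (V : 'I_n -> Omega -> R)
    (B : 'I_n -> set R) : rintegrable P z ->
  (forall j, measurable_fun setT (V j)) -> (forall j, measurable (B j)) ->
  (forall (s : 'I_n -> R) th,
     \int[P]_w (z w * cos (\sum_(j < n) s j * V j w + th)) = 0) ->
  \int[P]_(w in \bigcap_(j in [set: 'I_n]) (V j @^-1` B j)) z w = 0.
Proof.
elim: n z V B => [|n IH] z V B zi mV mB H.
  have -> : \bigcap_(j in [set: 'I_0]) (V j @^-1` B j) = setT.
    by apply/seteqP; split => // w _ [].
  rewrite -[RHS](H (fun=> 0) 0); apply: eq_Rintegral => w _.
  by rewrite big_ord0 addr0 cos0 mulr1.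
pose A0 := V ord0 @^-1` B ord0.
have mA0 : measurable A0 by rewrite -[X in measurable X]setTI; exact: mV.
pose z' w := z w * \1_A0 w.
have mcs (s : 'I_n -> R) th : measurable_fun setT (fun w => cos (\sum_(j < n) s j * V (lift ord0 j) w + th)).
  apply: measurable_cos_fun; apply: measurable_funD => //.
  by apply: measurable_sum => j; exact: measurable_funM.
have z'i : rintegrable P z'.
  apply: (@rintegrable_mul_bounded _ _ _ P _ _ 1) => //.
  by move=> w; rewrite indicE; case: (_ \in _); rewrite ?normr1 ?normr0.
have -> : \int[P]_(w in \bigcap_(j in [set: 'I_n.+1]) (V j @^-1` B j)) z w =
    \int[P]_(w in \bigcap_(j in [set: 'I_n]) (V (lift ord0 j) @^-1` B (lift ord0 j))) z' w.
  rewrite [LHS]rintegral_set_indic [RHS]rintegral_set_indic; apply: eq_Rintegral => w _.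
  rewrite /z' -mulrA; congr (_ * _); rewrite !indicE -natrM mulnb; congr ((_ : nat)%:R).
  congr nat_of_bool; apply/idP/andP.
    by rewrite !inE => h; split => [|j _]; exact: h.
  rewrite !inE => -[h0 h1] j _; case: (unliftP ord0 j) => [k ->|->] //.
  exact: h1.
apply: (IH z' (fun j => V (lift ord0 j)) (fun j => B (lift ord0 j))) => // s th.
pose zc w := z w * cos (\sum_(j < n) s j * V (lift ord0 j) w + th).
have zci : rintegrable P zc.
  exact: rintegrable_mul_bounded zi (mcs s th) (fun w => cos_max _).
suff Hz s0 th0 : \int[P]_w (zc w * cos (s0 * V ord0 w + th0)) = 0.
  have h := fourier_uniqueness1 zci (mV ord0) Hz (mB ord0).
  rewrite rintegral_set_indic in h; rewrite -[RHS]h.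
  by apply: eq_Rintegral => w _; rewrite /z' /zc mulrAC.
have E e : \int[P]_w (z w * cos (\sum_(j < n) s j * V (lift ord0 j) w + e * s0 * V ord0 w + (th + e * th0))) = 0.
  rewrite -[RHS](H (fun j => if unlift ord0 j is Some k then s k else e * s0) (th + e * th0)).
  apply: eq_Rintegral => w _; congr (_ * cos (_ + _)).
  rewrite big_ord_recl unlift_none addrC; congr (_ + _).
  by apply: eq_bigr => j _; rewrite liftK.
have i e : rintegrable P (fun w => z w * cos (\sum_(j < n) s j * V (lift ord0 j) w + e * s0 * V ord0 w + (th + e * th0))).
  apply: (@rintegrable_mul_bounded _ _ _ P _ _ 1) => //; last by move=> w; exact: cos_max.
  apply: measurable_cos_fun; apply: measurable_funD => //; apply: measurable_funD.
    by apply: measurable_sum => j; exact: measurable_funM.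
  exact: measurable_funM.
transitivity (2^-1 * (\int[P]_w (z w * cos (\sum_(j < n) s j * V (lift ord0 j) w + 1 * s0 * V ord0 w + (th + 1 * th0))) +
  \int[P]_w (z w * cos (\sum_(j < n) s j * V (lift ord0 j) w + (-1) * s0 * V ord0 w + (th + (-1) * th0))))); last first.
  by rewrite !E addr0 mulr0.
rewrite -rintegralD// -rintegralZl; last exact: rintegrableD.
apply: eq_Rintegral => w _; rewrite /zc.
set a := \sum_(j < n) _.
rewrite [a + 1 * _ * _ + _](_ : _ = (a + th) + (s0 * V ord0 w + th0)); last by ring.
rewrite [a + -1 * _ * _ + _](_ : _ = (a + th) - (s0 * V ord0 w + th0)); last by ring.
by move: (a + th) (s0 * _ + th0) => x y; rewrite cosB cosD; field.
Qed.

Lemma fourier_uniqueness n (z : Omega -> R) (V : 'I_n -> Omega -> R) :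
  rintegrable P z -> (forall j, measurable_fun setT (V j)) ->
  (forall (s : 'I_n -> R) th,
     \int[P]_w (z w * cos (\sum_(j < n) s j * V j w + th)) = 0) ->
  forall A, g_sigma_preimage V A -> measurable A /\ \int[P]_(w in A) z w = 0.
Proof.
move=> zi mV H A SA.
pose G : set (set Omega) := [set A | exists2 B : 'I_n -> set R,
  (forall j, measurable (B j)) & A = \bigcap_(j in [set: 'I_n]) (V j @^-1` B j)].
have z0 : \int[P]_w z w = 0.
  rewrite -[RHS](H (fun=> 0) 0); apply: eq_Rintegral => w _.
  by rewrite big1 ?addr0 ?cos0 ?mulr1// => j _; rewrite mul0r.
have GI : setI_closed G.
  move=> _ _ [B mB ->] [C mC ->]; exists (fun j => B j `&` C j).
    by move=> j; exact: measurableI.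
  apply/seteqP; split => w /=.
    by move=> [h1 h2] j _; split; [exact: h1|exact: h2].
  by move=> h; split => j _; have [] := h j I.
have Gm : G `<=` measurable.
  move=> _ [B mB ->]; apply: fin_bigcap_measurable; first exact: finite_finset.
  by move=> j _; rewrite -[X in measurable X]setTI; exact: mV.
have zG C : G C -> \int[P]_(w in C) z w = 0.
  by move=> [B mB ->]; exact: fourier_uniqueness_box.
apply: (rintegral_set0_sigma zi GI Gm z0 zG).
move: A SA; apply: sub_sigma_algebra2 => C.
(* A generating event constrains one variable; it is a box whose other sides are the whole line. *)
rewrite -bigcup_seq => -[i _ [B mB <-]].
exists (fun j => if j == i then B else setT).
  by move=> j; case: ifP.
apply/seteqP; split => w /=.
  by move=> [_ Bw] j _; case: eqP => [->|].
by move=> h; split => //; have := h i I; rewrite eqxx.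
Qed.

End fourier_uniqueness.

(** * Square-integrable functions and Gaussian conditioning *)

Section square_integrable.
Context (R : realType) (dO : measure_display) (Omega : measurableType dO).
Variable P : {measure set Omega -> \bar R}.
Implicit Types f g : Omega -> R.

Definition L2 f := measurable_fun setT f /\ rintegrable P (fun w => f w ^+ 2).

Definition dotL2 f g := \int[P]_w (f w * g w).

Lemma L2_mul f g : L2 f -> L2 g -> rintegrable P (fun w => f w * g w).
Proof.
move=> [mf f2] [mg g2]; apply: (le_rintegrable _ _ (rintegrableD f2 g2)).
  exact: measurable_funM.
move=> w; rewrite normrM -(real_normK (num_real (f w))) -(real_normK (num_real (g w))).
by have := normr_ge0 (f w); have := normr_ge0 (g w); nra.
Qed.

Lemma L2D f g : L2 f -> L2 g -> L2 (fun w => f w + g w).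
Proof.
move=> Lf Lg; split; first by apply: measurable_funD; [exact: Lf.1|exact: Lg.1].
apply: (@eq_rintegrable _ _ _ P (fun w => (f w ^+ 2 + 2 * (f w * g w)) + g w ^+ 2)).
  by move=> w; ring.
apply: rintegrableD; last exact: Lg.2.
by apply: rintegrableD; [exact: Lf.2|apply: rintegrableZl; exact: L2_mul].
Qed.

Lemma L2Z k f : L2 f -> L2 (fun w => k * f w).
Proof.
move=> Lf; split; first by apply: measurable_funM => //; exact: Lf.1.
apply: (@eq_rintegrable _ _ _ P (fun w => k ^+ 2 * f w ^+ 2)).
  by move=> w; ring.
by apply: rintegrableZl; exact: Lf.2.
Qed.

Lemma L2_0 : L2 (fun=> 0).
Proof.
split; first exact: measurable_cst.
by apply: (eq_rintegrable _ (@rintegrable0 _ _ _ P)) => w; rewrite expr0n.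
Qed.

Lemma L2_sum (I : Type) (s : seq I) (F : I -> Omega -> R) :
  (forall i, L2 (F i)) -> L2 (fun w => \sum_(i <- s) F i w).
Proof.
move=> LF; elim: s => [|i s IH].
  by under eq_fun do rewrite big_nil; exact: L2_0.
by under eq_fun do rewrite big_cons; exact: L2D.
Qed.

Lemma L2B f g : L2 f -> L2 g -> L2 (fun w => f w - g w).
Proof.
move=> Lf Lg; have := L2D Lf (L2Z (-1) Lg).
by under [fun w => f w + -1 * g w]eq_fun do rewrite mulN1r.
Qed.

Lemma dotL2C f g : dotL2 f g = dotL2 g f.
Proof. by apply: eq_Rintegral => w _; rewrite mulrC. Qed.

Lemma dotL2Dl f g k : L2 f -> L2 g -> L2 k ->
  dotL2 (fun w => f w + g w) k = dotL2 f k + dotL2 g k.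
Proof.
move=> Lf Lg Lk; rewrite /dotL2 -rintegralD; try exact: L2_mul.
by apply: eq_Rintegral => w _; rewrite mulrDl.
Qed.

Lemma dotL2Bl f g k : L2 f -> L2 g -> L2 k ->
  dotL2 (fun w => f w - g w) k = dotL2 f k - dotL2 g k.
Proof.
move=> Lf Lg Lk; rewrite /dotL2 -rintegralB; try exact: L2_mul.
by apply: eq_Rintegral => w _; rewrite mulrBl.
Qed.

Lemma dotL2Zl a f k : L2 f -> L2 k -> dotL2 (fun w => a * f w) k = a * dotL2 f k.
Proof.
move=> Lf Lk; rewrite /dotL2 -rintegralZl; last exact: L2_mul.
by apply: eq_Rintegral => w _; rewrite mulrA.
Qed.

Lemma dotL2_suml (I : Type) (s : seq I) (F : I -> Omega -> R) k :
  (forall i, L2 (F i)) -> L2 k ->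
  dotL2 (fun w => \sum_(i <- s) F i w) k = \sum_(i <- s) dotL2 (F i) k.
Proof.
move=> LF Lk; rewrite /dotL2 -rintegral_sum; last by move=> i; exact: L2_mul.
by apply: eq_Rintegral => w _; rewrite mulr_suml.
Qed.

Lemma dotL2_comb n (s : 'I_n -> R) (V : 'I_n -> Omega -> R) k :
  (forall i, L2 (V i)) -> L2 k ->
  dotL2 (fun w => \sum_(i < n) s i * V i w) k = \sum_(i < n) s i * dotL2 (V i) k.
Proof.
move=> LV Lk; rewrite dotL2_suml//; last by move=> i; exact: L2Z.
by apply: eq_bigr => i _; rewrite dotL2Zl.
Qed.

Lemma dotL2_sqr_lin l f g : L2 f -> L2 g ->
  dotL2 (fun w => l * f w + g w) (fun w => l * f w + g w) =
  l ^+ 2 * dotL2 f f + 2 * l * dotL2 f g + dotL2 g g.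
Proof.
move=> Lf Lg; have ff := L2_mul Lf Lf; have fg := L2_mul Lf Lg; have gg := L2_mul Lg Lg.
have ff' := rintegrableZl (l ^+ 2) ff; have fg' := rintegrableZl (2 * l) fg.
rewrite /dotL2 -!rintegralZl// -!rintegralD//; last exact: rintegrableD.
by apply: eq_Rintegral => w _; ring.
Qed.

Lemma dotL2_ge0 f : 0 <= dotL2 f f.
Proof. by apply: rintegral_ge0 => w; rewrite -expr2 sqr_ge0. Qed.

Lemma dotL2_eq0 f g : L2 f -> L2 g -> dotL2 f f = 0 -> dotL2 g f = 0.
Proof.
move=> Lf Lg f0.
have h : {ae P, forall w, f w * f w = 0}.
  by apply: ge0_rintegral_eq0 => //; [exact: L2_mul|move=> w; rewrite -expr2 sqr_ge0].
rewrite /dotL2 (@ae_eq_rintegral _ _ _ P _ (fun=> 0)) ?rintegral0//.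
- by apply: measurable_funM; [exact: Lg.1|exact: Lf.1].
- by apply: filterS h => w /= /eqP; rewrite mulf_eq0 orbb => /eqP ->; rewrite mulr0.
Qed.

(** Gram-Schmidt by induction: [Y] and the first vector are both projected on the remaining ones,
    then the residual of [Y] on the residual of that vector. Linearly dependent families are
    included. *)
Lemma L2_projection n (V : 'I_n -> Omega -> R) (Y : Omega -> R) :
  (forall i, L2 (V i)) -> L2 Y ->
  exists a : 'I_n -> R, forall k,
    dotL2 (fun w => Y w - \sum_(j < n) a j * V j w) (V k) = 0.
Proof.
elim: n V Y => [|n IH] V Y LV LY; first by exists (fun=> 0) => -[].
pose V' j := V (lift ord0 j).
have LV' j : L2 (V' j) by exact: LV.
have [a' Ha'] := IH V' Y LV' LY.
have [c Hc] := IH V' (V ord0) LV' (LV ord0).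
pose Z w := Y w - \sum_(j < n) a' j * V' j w.
pose U w := V ord0 w - \sum_(j < n) c j * V' j w.
have LS (b : 'I_n -> R) : L2 (fun w => \sum_(j < n) b j * V' j w).
  by apply: L2_sum => j; exact: L2Z.
have LZ : L2 Z by exact: L2B.
have LU : L2 U by exact: L2B.
pose t := dotL2 Z U / dotL2 U U.
(* When [U] has norm 0 the quotient [t] is 0 by convention, and the identity persists because [Z] is
   orthogonal to a null function. *)
have tU : dotL2 Z U = t * dotL2 U U.
  have [U0|U0] := eqVneq (dotL2 U U) 0; last by rewrite divfK.
  by rewrite U0 mulr0; exact: dotL2_eq0.
pose b j := if unlift ord0 j is Some k then a' k - t * c k else t.
exists b.
have E : (fun w => Y w - \sum_(j < n.+1) b j * V j w) = (fun w => Z w - t * U w).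
  apply/funext => w; rewrite big_ord_recl /b unlift_none /Z /U.
  under eq_bigr do rewrite liftK mulrBl -mulrA.
  by rewrite sumrB -mulr_sumr /V'; ring.
rewrite E => k; case: (unliftP ord0 k) => [j ->|->].
  rewrite dotL2Bl ?dotL2Zl//; first by rewrite [dotL2 Z _]Ha' [dotL2 U _]Hc mulr0 subr0.
  exact: L2Z.
have LZU : L2 (fun w => Z w - t * U w) by apply: L2B => //; exact: L2Z.
have V0E : V ord0 = fun w => U w + \sum_(j < n) c j * V' j w.
  by apply/funext => w; rewrite /U subrK.
rewrite dotL2C V0E dotL2Dl// dotL2_comb// big1 ?addr0.
  by rewrite dotL2C dotL2Bl ?dotL2Zl -?tU ?subrr//; exact: L2Z.
move=> j _; rewrite dotL2C dotL2Bl ?dotL2Zl//; last exact: L2Z.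
by rewrite [dotL2 Z _]Ha' [dotL2 U _]Hc !(mulr0, subr0).
Qed.

End square_integrable.

Section lipschitz.
Variable R : realType.

Lemma derive_lipschitz (f df : R -> R) (x y : R) :
  (forall t, is_derive t (1 : R) f (df t)) -> (forall t, `|df t| <= 1) ->
  `|f x - f y| <= `|x - y|.
Proof.
move=> fdf df1.
have cf : continuous f by move=> t; exact: is_derive_continuous (fdf t).
have H a b : a <= b -> `|f b - f a| <= `|b - a|.
  move=> ab; have [c _ ->] := @MVT_segment _ f df a b ab (fun t _ => fdf t)
    (continuous_subspaceT cf).
  by rewrite normrM ler_piMl.
by have [/H|/ltW /H//] := leP x y; rewrite distrC (distrC y).
Qed.

Lemma cos_lipschitz (x y : R) : `|cos x - cos y| <= `|x - y|.
Proof.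
apply: (derive_lipschitz _ _ (fun t => is_derive_cos t)) => t.
by rewrite normrN sin_max.
Qed.

Lemma sin_lipschitz (x y : R) : `|sin x - sin y| <= `|x - y|.
Proof. exact: (derive_lipschitz _ _ (fun t => is_derive_sin t) (@cos_max R)). Qed.

Lemma normr_sin_le (x : R) : `|sin x| <= `|x|.
Proof. by have := sin_lipschitz x 0; rewrite sin0 !subr0. Qed.

(** The limits [l --> 0] in the residual lemmas are taken along the inverses of the positive
    integers and along their squares. *)
Lemma cvg_diff_quotient (f : R -> R) (a : R) (t : nat -> R) :
  is_derive (0 : R) (1 : R) f a -> f 0 = 0 -> (forall n, t n != 0) ->
  t n @[n --> \oo] --> (0 : R) -> (t n)^-1 * f (t n) @[n --> \oo] --> a.
Proof.
move=> [df <-] f0 t0 tl.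
have := df; rewrite /derivable => /cvg_ex[/= l hl].
have E : 'D_1 f 0 = l by rewrite /derive; exact: cvg_lim hl.
rewrite E; have /cvgr_dnbhsP/(_ t) := hl => /(_ (conj t0 tl)).
apply: cvg_trans; apply: near_eq_cvg; apply: nearW => n /=.
by rewrite f0 subr0 addr0 /GRing.scale/= mulr1.
Qed.

Lemma cvg_harmonic0 : n.+1%:R^-1 @[n --> \oo] --> (0 : R).
Proof. exact: cvg_harmonic. Qed.

Lemma cvg_sin_quotient (z : R) :
  n.+1%:R * sin (n.+1%:R^-1 * z) @[n --> \oo] --> z.
Proof.
have d : is_derive (0 : R) (1 : R) (fun l => sin (z * l + 0)) z.
  apply: (is_derive_eq (is_derive_comp (is_derive_lin _ _ _) (is_derive_sin _))).
  by rewrite mulr0 addr0 cos0 mul1r.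
have := @cvg_diff_quotient _ _ (fun n => n.+1%:R^-1) d _ _ cvg_harmonic0.
rewrite mulr0 addr0 sin0 => /(_ erefl (fun n => invr_neq0 (lt0r_neq0 (ltr0Sn R n)))).
apply: cvg_trans; apply: near_eq_cvg; apply: nearW => n /=.
by rewrite invrK addr0 [z * _]mulrC.
Qed.

End lipschitz.

Section gaussian_conditioning.
Context (R : realType) (dO : measure_display) (Omega : measurableType dO).
Variable P : probability Omega R.

Lemma L2_rintegrable (f : Omega -> R) : L2 P f -> rintegrable P f.
Proof.
move=> [mf f2]; apply: (@le_rintegrable _ _ _ P _ (fun w => 1 + f w ^+ 2)) => //.
  by move=> w; rewrite -(real_normK (num_real (f w))); have := normr_ge0 (f w); nra.
by apply: rintegrableD => //; exact: finite_measure_integrable_cst.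
Qed.

(** Joint Gaussianity in the form in which it is used: the characteristic function at frequency 1 of
    every combination, degenerate ones included. *)
Definition jointly_gaussian n (Y : Omega -> R) (V : 'I_n -> Omega -> R) :=
  forall (b0 : R) (b : 'I_n -> R),
    let L w := b0 * Y w + \sum_(j < n) b j * V j w in
    \int[P]_w cos (L w) = expR (- (dotL2 P L L / 2)) /\ \int[P]_w sin (L w) = 0.

Variables (n : nat) (Y : Omega -> R) (V : 'I_n -> Omega -> R) (a : 'I_n -> R).
Hypotheses (LY : L2 P Y) (LV : forall j, L2 P (V j)) (G : jointly_gaussian Y V).
Let Z w := Y w - \sum_(j < n) a j * V j w.
Hypothesis Zorth : forall k, dotL2 P Z (V k) = 0.
Let S (s : 'I_n -> R) w := \sum_(j < n) s j * V j w.
Local Notation var := (dotL2 P Z Z).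

Let LS s : L2 P (S s). Proof. by apply: L2_sum => j; exact: L2Z. Qed.
Let LZ : L2 P Z. Proof. by apply: L2B => //; exact: LS. Qed.
Let mZ : measurable_fun setT Z. Proof. exact: LZ.1. Qed.

Let mcosS s th l : measurable_fun setT (fun w => cos (l * Z w + S s w + th)).
Proof.
apply: measurable_cos_fun; apply: measurable_funD => //.
by apply: measurable_funD; [exact: measurable_funM|exact: (LS s).1].
Qed.

Let icosS s th l : rintegrable P (fun w => cos (l * Z w + S s w + th)).
Proof. exact: bounded_rintegrable (mcosS s th l) (fun w => cos_max _). Qed.

(** Orthogonality splits the variance of [l Z + S], so [l] enters only through the factor
    [exp (- l^2 var / 2)]. This factorisation is the form taken by the independence of the residual
    and the conditioning variables. *)
Let cosE s th l : \int[P]_w cos (l * Z w + S s w + th) =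
  cos th * expR (- ((l ^+ 2 * var + dotL2 P (S s) (S s)) / 2)).
Proof.
pose b j := s j - l * a j.
have LE : (fun w => l * Z w + S s w) = (fun w => l * Y w + \sum_(j < n) b j * V j w).
  apply/funext => w; rewrite /Z /S /b; under [in RHS]eq_bigr do rewrite mulrBl -mulrA.
  by rewrite sumrB -mulr_sumr; ring.
have LEw w : l * Z w + S s w = l * Y w + \sum_(j < n) b j * V j w.
  exact: (congr1 (fun f => f w) LE).
have Gc : \int[P]_w cos (l * Z w + S s w) =
    expR (- (dotL2 P (fun w => l * Z w + S s w) (fun w => l * Z w + S s w) / 2)).
  by rewrite LE; under eq_Rintegral do rewrite LEw; exact: (G l b).1.
have Gs : \int[P]_w sin (l * Z w + S s w) = 0.
  by under eq_Rintegral do rewrite LEw; exact: (G l b).2.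
have LZS : L2 P (fun w => l * Z w + S s w) by apply: L2D => //; exact: L2Z.
have ZS : dotL2 P Z (S s) = 0.
  by rewrite dotL2C dotL2_comb// big1// => j _; rewrite dotL2C Zorth mulr0.
have -> : l ^+ 2 * var + dotL2 P (S s) (S s) =
    dotL2 P (fun w => l * Z w + S s w) (fun w => l * Z w + S s w).
  by rewrite dotL2_sqr_lin// ZS mulr0 addr0.
rewrite -Gc.
have ic : rintegrable P (fun w => cos (l * Z w + S s w)).
  apply: bounded_rintegrable (fun w => cos_max _).
  by apply: measurable_cos_fun; exact: LZS.1.
have is_ : rintegrable P (fun w => sin (l * Z w + S s w)).
  apply: bounded_rintegrable (fun w => sin_max _).
  apply: measurableT_comp LZS.1.
  by apply: continuous_measurable_fun; exact: continuous_sin.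
transitivity (\int[P]_w (cos th * cos (l * Z w + S s w) - sin th * sin (l * Z w + S s w))).
  by apply: eq_Rintegral => w _; rewrite cosD; ring.
rewrite rintegralB; try exact: rintegrableZl.
by rewrite !rintegralZl// Gs mulr0 subr0.
Qed.

(* [E cos (l Z + S + th)] is even in [l]; the odd part in [l] is divided by [l]
   and [l --> 0]. *)
Lemma residual_sin0 s th : \int[P]_w (Z w * sin (S s w + th)) = 0.
Proof.
have msS : measurable_fun setT (fun w => sin (S s w + th)).
  apply: measurableT_comp; last by apply: measurable_funD => //; exact: (LS s).1.
  by apply: continuous_measurable_fun; exact: continuous_sin.
have H l : \int[P]_w (sin (l * Z w) * sin (S s w + th)) = 0.
  transitivity (\int[P]_w (2^-1 * (cos (- l * Z w + S s w + th) - cos (l * Z w + S s w + th)))).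
    apply: eq_Rintegral => w _.
    rewrite -!addrA mulNr; move: (l * Z w) (S s w + th) => x y.
    by rewrite !cosD cosN sinN; field.
  rewrite rintegralZl; last exact: rintegrableB.
  by rewrite rintegralB// !cosE sqrrN subrr mulr0.
pose f k w := k.+1%:R * sin (k.+1%:R^-1 * Z w) * sin (S s w + th).
have mf k : measurable_fun setT (f k).
  apply: measurable_funM => //; apply: measurable_funM => //.
  apply: measurableT_comp; last exact: measurable_funM.
  by apply: continuous_measurable_fun; exact: continuous_sin.
have fl w : f k w @[k --> \oo] --> Z w * sin (S s w + th).
  by apply: cvgM; [exact: cvg_sin_quotient|exact: cvg_cst].
have fb k w : `|f k w| <= `|Z w|.
  rewrite /f normrM (le_trans (ler_piMr _ (sin_max _)))// normrM.
  rewrite (le_trans (ler_wpM2l _ (normr_sin_le _)))// normrM mulrA.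
  by rewrite normfV mulfV ?mul1r// normr_eq0.
have [_ lim] := rintegral_cvg mf fl (rintegrable_norm (L2_rintegrable LZ)) fb.
have lim0 : \int[P]_w f k w @[k --> \oo] --> (0 : R).
  rewrite (_ : (fun k => \int[P]_w f k w) = fun=> 0); first exact: cvg_cst.
  apply/funext => k; rewrite -[RHS](mulr0 k.+1%:R) -(H k.+1%:R^-1) -rintegralZl.
    by apply: eq_Rintegral => w _; rewrite mulrA.
  apply: (@bounded_rintegrable _ _ _ P _ 1).
    apply: measurable_funM => //.
    apply: measurableT_comp; last exact: measurable_funM.
    by apply: continuous_measurable_fun; exact: continuous_sin.
  by move=> w; rewrite normrM mulr_ile1 ?sin_max.
by rewrite -[RHS](cvg_unique (@Rhausdorff R) lim lim0).
Qed.

Lemma residual_cos0 s th : \int[P]_w (Z w * cos (S s w + th)) = 0.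
Proof.
rewrite -[RHS](residual_sin0 s (th + pi / 2)); apply: eq_Rintegral => w _.
by rewrite addrA sinDpihalf.
Qed.

(* Second-order version: [2 (1 - cos (l Z)) / l^2] tends to [Z^2]. *)
Lemma residual_sqr_cos0 s th : \int[P]_w ((Z w ^+ 2 - var) * cos (S s w + th)) = 0.
Proof.
have mcS : measurable_fun setT (fun w => cos (S s w + th)).
  by apply: measurable_cos_fun; apply: measurable_funD => //; exact: (LS s).1.
have icS : rintegrable P (fun w => cos (S s w + th)).
  exact: bounded_rintegrable mcS (fun w => cos_max _).
pose c := var / 2.
have H l : \int[P]_w ((1 - cos (l * Z w)) * cos (S s w + th)) =
    (1 - expR (- (c * l ^+ 2))) * \int[P]_w cos (S s w + th).
  have E0 : \int[P]_w cos (S s w + th) = cos th * expR (- (dotL2 P (S s) (S s) / 2)).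
    have := cosE s th 0; rewrite expr0n/= mul0r add0r => <-.
    by apply: eq_Rintegral => w _; rewrite mul0r add0r.
  transitivity (\int[P]_w (cos (S s w + th) -
     2^-1 * (cos (- l * Z w + S s w + th) + cos (l * Z w + S s w + th)))).
    apply: eq_Rintegral => w _.
    rewrite -!addrA mulNr; move: (l * Z w) (S s w + th) => x y.
    by rewrite !cosD cosN sinN; field.
  rewrite rintegralB//; last by apply: rintegrableZl; exact: rintegrableD.
  rewrite rintegralZl; last exact: rintegrableD.
  rewrite rintegralD// !cosE sqrrN E0 mulrDl opprD expRD.
  rewrite (_ : l ^+ 2 * var / 2 = c * l ^+ 2); first by field.
  by rewrite /c; field.
(* This is [k^2 (1 - cos (Z / k))] up to the shift of [k]; written with the square of a sine it is
   visibly dominated by [Z^2 / 2], and its limit follows from [cvg_sin_quotient]. *)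
pose f k w := 2 * (k.+1%:R * sin (k.+1%:R^-1 * (Z w / 2))) ^+ 2 * cos (S s w + th).
have fE k w : f k w = k.+1%:R ^+ 2 * ((1 - cos (k.+1%:R^-1 * Z w)) * cos (S s w + th)).
  rewrite /f [k.+1%:R^-1 * Z w](_ : _ = (k.+1%:R^-1 * (Z w / 2)) *+ 2); last first.
    by rewrite -mulr_natr; field.
  by rewrite cos_mulr2n exprMn sin2cos2 -[_ *+ 2]mulr_natr; ring.
have mf k : measurable_fun setT (f k).
  apply: measurable_funM => //; apply: measurable_funM => //; apply: measurable_funX.
  apply: measurable_funM => //.
  apply: measurableT_comp; last first.
    by apply: measurable_funM => //; exact: measurable_funM.
  by apply: continuous_measurable_fun; exact: continuous_sin.
have fl w : f k w @[k --> \oo] --> 2 * (Z w / 2) ^+ 2 * cos (S s w + th).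
  apply: cvgM; last exact: cvg_cst; apply: cvgM; first exact: cvg_cst.
  by rewrite expr2; under eq_fun do rewrite expr2; apply: cvgM; exact: cvg_sin_quotient.
have fb k w : `|f k w| <= 2^-1 * Z w ^+ 2.
  rewrite /f normrM (le_trans (ler_piMr _ (cos_max _)))// normrM ger0_norm//.
  rewrite (_ : 2^-1 * Z w ^+ 2 = 2 * `|Z w / 2| ^+ 2); last first.
    by rewrite real_normK ?num_real//; field.
  rewrite ler_wpM2l// normrX lerXn2r ?nnegrE// normrM.
  rewrite (le_trans (ler_wpM2l _ (normr_sin_le _)))// normrM mulrA.
  by rewrite normfV mulfV ?mul1r// normr_eq0.
have [_ lim] := rintegral_cvg mf fl (rintegrableZl 2^-1 LZ.2) fb.
have lim0 : \int[P]_w f k w @[k --> \oo] --> c * \int[P]_w cos (S s w + th).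
  have d : is_derive (0 : R) (1 : R) (fun l => 1 + -1 * expR (- c * l + 0)) c.
    apply: (is_derive_eq (is_derive_add (is_derive_cst _ _ _) (is_derive_scale _
      (is_derive_comp (is_derive_lin _ _ _) (is_derive_expR _))))).
    by rewrite mulr0 addr0 expR0; ring.
  have t0 (k : nat) : k.+1%:R^-1 ^+ 2 != 0 :> R by rewrite expf_neq0// invr_neq0.
  have tl : k.+1%:R^-1 ^+ 2 @[k --> \oo] --> (0 : R).
    rewrite -(mulr0 0); under eq_fun do rewrite expr2.
    by apply: cvgM; exact: cvg_harmonic0.
  have f00 : 1 + -1 * expR (- c * 0 + 0) = 0 :> R by rewrite mulr0 addr0 expR0; ring.
  rewrite (_ : (fun k => \int[P]_w f k w) = fun k => (k.+1%:R^-1 ^+ 2)^-1 *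
    (1 + -1 * expR (- c * k.+1%:R^-1 ^+ 2 + 0)) * \int[P]_w cos (S s w + th)).
    by apply: cvgM; [exact: (cvg_diff_quotient d f00 t0 tl)|exact: cvg_cst].
  apply/funext => k; rewrite -mulrA.
  transitivity (k.+1%:R ^+ 2 * \int[P]_w ((1 - cos (k.+1%:R^-1 * Z w)) * cos (S s w + th))).
    rewrite -rintegralZl; first by apply: eq_Rintegral => w _; rewrite fE.
    apply: (rintegrable_mul_bounded (C := 1)) => //; last by move=> w; exact: cos_max.
    apply: (@bounded_rintegrable _ _ _ P _ 2).
      apply: measurable_funB => //; apply: measurable_cos_fun; exact: measurable_funM.
    by move=> w; rewrite (le_trans (ler_normB _ _))// normr1 -[leRHS]/(1 + 1) lerD2l cos_max.
  by rewrite H exprVn invrK addr0 mulN1r mulNr.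
have E : \int[P]_w (2 * (Z w / 2) ^+ 2 * cos (S s w + th)) = c * \int[P]_w cos (S s w + th).
  by rewrite -[RHS](cvg_unique (@Rhausdorff R) lim lim0).
have i2 : rintegrable P (fun w => 2 * (Z w / 2) ^+ 2 * cos (S s w + th)).
  apply: (rintegrable_mul_bounded (C := 1)) => //; last by move=> w; exact: cos_max.
  apply: (@eq_rintegrable _ _ _ P (fun w => 2^-1 * Z w ^+ 2)); first by move=> w; field.
  by apply: rintegrableZl; exact: LZ.2.
transitivity (2 * (\int[P]_w (2 * (Z w / 2) ^+ 2 * cos (S s w + th)) -
    c * \int[P]_w cos (S s w + th))); last by rewrite E subrr mulr0.
rewrite -rintegralZl// -rintegralB//; last exact: rintegrableZl.
rewrite -rintegralZl; last by apply: rintegrableB => //; exact: rintegrableZl.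
by apply: eq_Rintegral => w _; rewrite /c; field.
Qed.

End gaussian_conditioning.

Section conditional_expectation.
Context (R : realType) (dO : measure_display) (Omega : measurableType dO).
Variable P : probability Omega R.
Variables (n : nat) (V : 'I_n -> Omega -> R).
Hypothesis mV : forall j, measurable_fun setT (V j).
Local Notation gens := (\big[setU/set0]_(i < n) preimage_set_system setT (V i) measurable).
Local Notation S := (g_sigma_preimage V).

Lemma g_sigma_preimage_sub A : S A -> measurable A.
Proof.
move: A; apply: smallest_sub; first exact: sigma_algebra_measurable.
by move=> A; rewrite -bigcup_seq => -[i _ [B mB <-]]; exact: mV.
Qed.

Lemma measurable_g_sigma_preimageP (f : Omega -> R) :
  (forall B : set R, measurable B -> S (f @^-1` B)) <->
  measurable_fun (setT : set (g_sigma_algebraType gens)) f.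
Proof.
split=> [h _ B mB|h B mB]; first by rewrite setTI; exact: h.
by have := h measurableT B mB; rewrite setTI.
Qed.

Lemma g_sigma_preimage_proj j B : measurable B -> S (V j @^-1` B).
Proof.
move=> mB; apply: sub_sigma_algebra; rewrite -bigcup_seq.
by exists j; [rewrite /= mem_index_enum|exists B => //; rewrite setTI].
Qed.

Lemma g_sigma_preimage_comb (a : 'I_n -> R) (B : set R) : measurable B ->
  S ((fun w => \sum_(j < n) a j * V j w) @^-1` B).
Proof.
move: B; apply/measurable_g_sigma_preimageP.
apply: measurable_sum => j; apply: measurable_funM => //.
by apply/measurable_g_sigma_preimageP => B; exact: g_sigma_preimage_proj.
Qed.

Lemma is_cond_exp_measurable Y Z : is_cond_exp P S Y Z -> measurable_fun setT Z.
Proof.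
by move=> [SZ _ _] _ B mB; rewrite setTI; apply: g_sigma_preimage_sub; exact: SZ.
Qed.

(** The event [Z2 < Z1] belongs to the sigma-algebra and both versions have the same integral over
    it, so it is null. Exchanging the roles gives uniqueness. *)
Lemma is_cond_exp_le Y Z1 Z2 : is_cond_exp P S Y Z1 -> is_cond_exp P S Y Z2 ->
  {ae P, forall w, Z1 w <= Z2 w}.
Proof.
move=> [S1 i1 E1] [S2 i2 E2].
pose A := [set w | Z2 w < Z1 w].
have SA : S A.
  have m := measurable_fun_ltr ((measurable_g_sigma_preimageP _).1 S2)
    ((measurable_g_sigma_preimageP _).1 S1).
  by have := m measurableT [set true] I; rewrite setTI; exact.
have mA := g_sigma_preimage_sub SA.
have di : rintegrable P (fun w => Z1 w - Z2 w) by exact: rintegrableB.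
have d0 : \int[P]_(w in A) (Z1 w - Z2 w) = 0.
  rewrite RintegralB//; try by apply: (integrableS measurableT) => //.
  by rewrite /Rintegral E1// E2// subrr.
rewrite (rintegral_set_indic P (fun w => Z1 w - Z2 w)) in d0.
have f0 w : 0 <= (Z1 w - Z2 w) * \1_A w.
  rewrite indicE; have [|] := boolP (w \in A); last by rewrite mulr0.
  by rewrite inE/= mulr1 subr_ge0 => /ltW.
have fi : rintegrable P (fun w => (Z1 w - Z2 w) * \1_A w).
  apply: (@rintegrable_mul_bounded _ _ _ P _ _ 1) => //.
  by move=> w; rewrite indicE; case: (_ \in _); rewrite ?normr1 ?normr0.
apply: filterS (ge0_rintegral_eq0 fi f0 d0) => w /=.
rewrite indicE; have [|] := boolP (w \in A); last first.
  by rewrite notin_setE /A /= => /negP; rewrite -leNgt.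
by rewrite mulr1 => _ /eqP; rewrite subr_eq0 => /eqP ->.
Qed.

(** [cond_exp] is a choice with a default value: it becomes accessible only once some version has
    been exhibited. *)
Lemma cond_exp_ae Y Z : is_cond_exp P S Y Z ->
  {ae P, forall w, cond_exp P S Y w = Z w}.
Proof.
move=> YZ; have Yc : is_cond_exp P S Y (cond_exp P S Y).
  by apply: xgetPex; exists Z.
apply: filterS2 (is_cond_exp_le Yc YZ) (is_cond_exp_le YZ Yc) => w h1 h2.
by apply/eqP; rewrite eq_le h1 h2.
Qed.

Lemma eq_integral_set (f g : Omega -> R) A : measurable A ->
  rintegrable P f -> rintegrable P g ->
  \int[P]_(w in A) (f w - g w) = 0 ->
  (\int[P]_(w in A) (f w)%:E = \int[P]_(w in A) (g w)%:E)%E.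
Proof.
move=> mA fi gi.
have fA : P.-integrable A (EFin \o f) by exact: (integrableS measurableT).
have gA : P.-integrable A (EFin \o g) by exact: (integrableS measurableT).
rewrite RintegralB// => /eqP; rewrite subr_eq0 => /eqP E.
rewrite -[LHS]fineK; last exact: integrable_fin_num.
rewrite -[RHS]fineK; last exact: integrable_fin_num.
by congr EFin.
Qed.

Variables (Y : Omega -> R) (a : 'I_n -> R).
Hypotheses (LY : L2 P Y) (LV : forall j, L2 P (V j)) (G : jointly_gaussian P Y V).
Let Z w := Y w - \sum_(j < n) a j * V j w.
Hypothesis Zorth : forall k, dotL2 P Z (V k) = 0.

(** The projection is a version of the conditional expectation because [Z] is orthogonal to all
    cosines of combinations of the conditioning variables; the constant is a version of the
    conditional variance because [Z^2 - var] is orthogonal to them too. [fourier_uniqueness] passes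
    from cosines to events in both cases. *)
Theorem cond_var_gaussian : {ae P, forall w, cond_var P Y V w = dotL2 P Z Z}.
Proof.
have LS : L2 P (fun w => \sum_(j < n) a j * V j w) by apply: L2_sum => j; exact: L2Z.
have LZ : L2 P Z by exact: L2B.
have Zi := L2_rintegrable LZ.
have cei : rintegrable P (fun=> dotL2 P Z Z) by exact: finite_measure_integrable_cst.
have Z2i : rintegrable P (fun w => Z w ^+ 2 - dotL2 P Z Z).
  by apply: rintegrableB => //; exact: LZ.2.
have ceY : is_cond_exp P S Y (fun w => \sum_(j < n) a j * V j w).
  split; first exact: g_sigma_preimage_comb.
    exact: L2_rintegrable.
  move=> A SA; apply/esym/eq_integral_set; [exact: g_sigma_preimage_sub|exact: L2_rintegrable|exact: L2_rintegrable|].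
  by have [] := fourier_uniqueness Zi mV (residual_cos0 LY LV G Zorth) SA.
have ceE := cond_exp_ae ceY.
have mce : measurable_fun setT (cond_exp P S Y).
  apply: (@is_cond_exp_measurable Y); apply: xgetPex.
  by exists (fun w => \sum_(j < n) a j * V j w).
apply: cond_exp_ae; split.
- by apply/measurable_g_sigma_preimageP; exact: measurable_cst.
- by [].
- move=> A SA; have mA := g_sigma_preimage_sub SA.
  (* [cond_var] contains the chosen version of the conditional expectation; being almost surely the
     projection, it may be replaced by it under the integral. *)
  transitivity (\int[P]_(w in A) (Z w ^+ 2)%:E)%E.
    apply/esym/eq_integral_set => //; first exact: LZ.2.
    by have [] := fourier_uniqueness Z2i mV (residual_sqr_cos0 LY LV G Zorth) SA.
  apply: ae_eq_integral => //.
  + apply/measurable_EFinP; apply: measurable_funS (measurable_funX 2 LZ.1) => //.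
  + apply/measurable_EFinP; apply: (@measurable_funS _ _ _ _ setT) => //.
    by apply: measurable_funX; apply: measurable_funB => //; exact: LY.1.
  + by apply: filterS ceE => w /= -> _.
Qed.

End conditional_expectation.

(** * Fourier transforms of test functions and the noise *)

Section continuous_measurable.
Variables (R : realType) (d : nat).

Let grid (k : nat) (x : R) : R := (Num.floor (k.+1%:R * x))%:~R / k.+1%:R.

Let grid_bound k x : `|grid k x - x| <= k.+1%:R^-1.
Proof.
have k0 : 0 < k.+1%:R :> R by [].
have /andP[h1 h2] := floor_itv (k.+1%:R * x).
rewrite ler_norml; apply/andP; split.
  rewrite lerBrDr -(ler_pM2l k0) mulrDr mulrN mulfV ?gt_eqF//.
  rewrite /grid [k.+1%:R * (_ / _)]mulrCA mulfV ?gt_eqF// mulr1 addrC lerBlDr.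
  by rewrite (le_trans (ltW h2))// intrD.
rewrite lerBlDr (@le_trans _ _ x)//; last by rewrite lerDr invr_ge0 ltW.
by rewrite /grid ler_pdivrMr// [leRHS]mulrC h1.
Qed.

(* A continuous function is the limit of its compositions with the roundings
   to the grids (1/k)Z^(1+d), which take countably many values. *)
Lemma continuous_measurable_tx (f : R * 'rV[R]_d -> R) : continuous f ->
  measurable_fun [set: R * 'rV[R]_d] f.
Proof.
move=> cf.
pose D (k : nat) (p : R * 'rV[R]_d) : R * 'rV[R]_d :=
  (grid k p.1, \row_j grid k (p.2 ord0 j)).
have Dl p : D n p @[n --> \oo] --> p.
  have h1 : grid n p.1 @[n --> \oo] --> p.1.
    apply/cvgrPdist_le => e e0; near=> n.
    rewrite distrC (le_trans (grid_bound _ _))//.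
    by near: n; have := @cvg_harmonic0 R => /cvgrPdist_le/(_ e e0);
       apply: filterS => n; rewrite sub0r normrN ger0_norm.
  have h2 : (\row_j grid n (p.2 ord0 j)) @[n --> \oo] --> p.2.
    apply/cvg_ballP => e e0; near=> n; split => // i j; rewrite mxE (ord1 i).
    rewrite -ball_normE /ball_/= distrC (le_lt_trans (grid_bound _ _))//.
    by near: n; have := @cvg_harmonic0 R => /cvgrPdist_lt/(_ e e0);
       apply: filterS => n; rewrite sub0r normrN ger0_norm.
  case: p h1 h2 => a b h1 h2. exact: (cvg_pair h1 h2).
apply: (measurable_fun_cvg (h := fun n p => f (D n p))); last first.
  by move=> p _; have := cvg_comp (fun n => D n p) f (Dl p) (cf p).
move=> k _ B mB; rewrite setTI.
pose E (z : int) := [set x : R | Num.floor (k.+1%:R * x) = z].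
have mE z : measurable (E z).
  rewrite (_ : E z = (fun x : R => k.+1%:R * x) @^-1` `[z%:~R, (z + 1)%:~R[%classic).
    rewrite -[X in measurable X]setTI; apply: measurable_funM => //.
  apply/seteqP; split => x; rewrite /E /= in_itv/=.
    by move=> <-; exact: floor_itv.
  by move=> h; apply/eqP; rewrite floor_eq.
pose val (z : int * 'rV[int]_d) : R * 'rV[R]_d :=
  (z.1%:~R / k.+1%:R, \row_j ((z.2 ord0 j)%:~R / k.+1%:R)).
pose cell (z : int * 'rV[int]_d) : set (R * 'rV[R]_d) :=
  [set p : R * 'rV[R]_d | E z.1 p.1 /\ forall j, E (z.2 ord0 j) (p.2 ord0 j)].
have mcell z : measurable (cell z).
  rewrite (_ : cell z = (E z.1 `*` setT) `&`
      \bigcap_(j in [set: 'I_d]) (setT `*` ((fun y : 'rV[R]_d => y ord0 j) @^-1` E (z.2 ord0 j)))).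
    apply: measurableI; first exact: measurableX.
    apply: fin_bigcap_measurable; first exact: finite_finset.
    move=> j _; apply: measurableX => //.
    by rewrite -[X in measurable X]setTI; apply: measurable_coord.
  apply/seteqP; split => p /=.
    by move=> [h1 h2]; split=> // j _; split => //; exact: h2.
  by move=> [[h1 _] h2]; split=> // j; have [] := h2 j I.
rewrite (_ : _ @^-1` B = \bigcup_(z in [set: int * 'rV[int]_d])
    (if `[< B (f (val z)) >] then cell z else set0)).
  apply: countable_bigcupT_measurable => [|z]; last by case: ifP.
  exact: countableP.
apply/seteqP; split => p /=.
  move=> Bp; exists (Num.floor (k.+1%:R * p.1), \row_j Num.floor (k.+1%:R * p.2 ord0 j)) => //.
  have -> : val (Num.floor (k.+1%:R * p.1), \row_j Num.floor (k.+1%:R * p.2 ord0 j)) = D k p.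
    by rewrite /val /D /grid /=; congr pair; apply/rowP => j; rewrite !mxE.
  rewrite asboolT//; split => [//|j]; by rewrite /E /= mxE.
move=> [z _]; case: asboolP => // Bz [h1 h2].
suff -> : D k p = val z by [].
rewrite /D /val /grid h1; congr pair; apply/rowP => j; rewrite !mxE.
by rewrite (h2 j).
Unshelve. all: by end_near. Qed.

End continuous_measurable.

Section fourier_parts.
Variables (R : realType) (d : nat).
Local Notation tx := (@lebesgue_tx R d).
Implicit Types phi : R * 'rV[R]_d -> R.

Lemma measurable_dotp : measurable_fun setT (fun z : 'rV[R]_d * 'rV[R]_d => dotp z.1 z.2).
Proof.
apply: measurable_sum => j; apply: measurable_funM.
- exact: measurableT_comp (measurable_coord j) measurable_fst.
- exact: measurableT_comp (measurable_coord j) measurable_snd.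
Qed.

Definition phase (q p : R * 'rV[R]_d) : R := q.1 * p.1 + dotp q.2 p.2.

Lemma measurable_phase :
  measurable_fun setT (fun z : (R * 'rV[R]_d) * (R * 'rV[R]_d) => phase z.1 z.2).
Proof.
apply: measurable_funD.
  apply: measurable_funM.
  - exact: measurableT_comp measurable_fst measurable_fst.
  - exact: measurableT_comp measurable_fst measurable_snd.
have m : measurable_fun setT
    (fun z : (R * 'rV[R]_d) * (R * 'rV[R]_d) => (z.1.2, z.2.2)).
  apply/measurable_fun_pair => /=.
  - exact: measurableT_comp measurable_snd measurable_fst.
  - exact: measurableT_comp measurable_snd measurable_snd.
by have := measurableT_comp measurable_dotp m.
Qed.

Lemma Re_fourier phi q : complex.Re (fourier phi q.1 q.2) =
  \int[tx]_p (cos (phase q p) * phi p).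
Proof.
apply: eq_Rintegral => p _ /=; rewrite mulr0 subr0; congr (_ * _).
by rewrite -opprD cosN.
Qed.

Lemma Im_fourier phi q : complex.Im (fourier phi q.1 q.2) =
  \int[tx]_p (- sin (phase q p) * phi p).
Proof.
apply: eq_Rintegral => p _ /=; rewrite mulr0 add0r; congr (_ * _).
by rewrite -opprD sinN.
Qed.

Let measurable_trig (f : R -> R) phi : continuous f -> measurable_fun setT phi ->
  measurable_fun setT (fun q => \int[tx]_p (f (phase q p) * phi p)).
Proof.
move=> cf mphi.
have mf : measurable_fun setT (fun z : (R * 'rV[R]_d) * (R * 'rV[R]_d) =>
    f (phase z.1 z.2) * phi z.2).
  apply: measurable_funM; last exact: measurableT_comp mphi measurable_snd.
  by apply: measurableT_comp measurable_phase; exact: continuous_measurable_fun.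
(* [tx] is typed as a plain measure; the integral is carried over to [lebesgue_rV R d.+1], typed as
   sigma-finite, for [measurable_rintegral2]. *)
have E q : \int[tx]_p (f (phase q p) * phi p) =
    \int[lebesgue_rV R d.+1]_x (f (phase q (rV_uncons x)) * phi (rV_uncons x)).
  symmetry; apply: (@rintegral_law _ _ _ _ R (lebesgue_rV R d.+1) tx (@rV_uncons R d)
    (@measurable_rV_uncons R d) _ (fun p => f (phase q p) * phi p)).
    move=> A mA; rewrite -[RHS]/(tx (id @^-1` A)); congr (tx _).
    by apply/seteqP; split => p /=; rewrite rV_consK.
  exact: (measurableT_comp mf (measurable_pair1 q)).
under eq_fun do rewrite E.
apply: (@measurable_rintegral2 _ _ (R * 'rV[R]_d)%type 'rV[R]_d.+1 R (lebesgue_rV R d.+1)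
  (fun z => f (phase z.1 (rV_uncons z.2)) * phi (rV_uncons z.2))).
have m : measurable_fun setT
    (fun z : (R * 'rV[R]_d) * 'rV[R]_d.+1 => (z.1, rV_uncons z.2)).
  apply/measurable_fun_pair => //=.
  exact: measurableT_comp (@measurable_rV_uncons R d) measurable_snd.
by have := measurableT_comp mf m.
Qed.

Lemma measurable_Re_fourier phi : measurable_fun setT phi ->
  measurable_fun setT (fun q => complex.Re (fourier phi q.1 q.2)).
Proof.
move=> mphi; under eq_fun do rewrite Re_fourier.
by apply: measurable_trig => //; exact: continuous_cos.
Qed.

Lemma measurable_Im_fourier phi : measurable_fun setT phi ->
  measurable_fun setT (fun q => complex.Im (fourier phi q.1 q.2)).
Proof.
move=> mphi; under eq_fun do rewrite Im_fourier.
apply: (@measurable_trig (fun x => - sin x)) => // x.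
by apply: cvgN; exact: continuous_sin.
Qed.

End fourier_parts.

Section L2_approximation.
Context (R : realType) (dO : measure_display) (Omega : measurableType dO).

Lemma dotL2_sum_sum (P : {measure set Omega -> \bar R}) n (b : 'I_n -> R) (F : 'I_n -> Omega -> R) :
  (forall i, L2 P (F i)) ->
  dotL2 P (fun w => \sum_(i < n) b i * F i w) (fun w => \sum_(i < n) b i * F i w) =
  \sum_(i < n) \sum_(j < n) b i * (b j * dotL2 P (F i) (F j)).
Proof.
move=> LF; have LS : L2 P (fun w => \sum_(i < n) b i * F i w).
  by apply: L2_sum => i; exact: L2Z.
rewrite dotL2_comb//; apply: eq_bigr => i _.
rewrite dotL2C dotL2_comb// mulr_sumr; apply: eq_bigr => j _.
by rewrite dotL2C.
Qed.

Lemma le_dotL2D (P : {measure set Omega -> \bar R}) f g : L2 P f -> L2 P g ->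
  dotL2 P (fun w => f w + g w) (fun w => f w + g w) <=
  2 * dotL2 P f f + 2 * dotL2 P g g.
Proof.
move=> Lf Lg; have ff := L2_mul Lf Lf; have gg := L2_mul Lg Lg.
have LD := L2D Lf Lg.
rewrite /dotL2 -!rintegralZl// -rintegralD; try exact: rintegrableZl.
apply: le_rintegral; first exact: L2_mul.
  by apply: rintegrableD; exact: rintegrableZl.
by move=> w; have := sqr_ge0 (f w - g w); nra.
Qed.

(** The factor [2 ^+ n] comes from iterating [(a + b)^2 <= 2 a^2 + 2 b^2]. It is harmless, since [n]
    and [b] stay fixed while [e] tends to 0. *)
Lemma le_dotL2_sum (P : {measure set Omega -> \bar R}) n (b : 'I_n -> R) (F : 'I_n -> Omega -> R) e :
  (forall i, L2 P (F i)) -> (forall i, dotL2 P (F i) (F i) <= e) -> 0 <= e ->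
  dotL2 P (fun w => \sum_(i < n) b i * F i w) (fun w => \sum_(i < n) b i * F i w) <=
  2 ^+ n * (\sum_(i < n) b i ^+ 2) * e.
Proof.
move=> + + e0; elim: n b F => [|n IH] b F LF Fe.
  rewrite big_ord0 mulr0 mul0r /dotL2.
  by under eq_Rintegral do rewrite big_ord0 mul0r; rewrite rintegral0.
have E : (fun w => \sum_(i < n.+1) b i * F i w) =
    (fun w => b ord0 * F ord0 w + \sum_(i < n) b (lift ord0 i) * F (lift ord0 i) w).
  by apply/funext => w; rewrite big_ord_recl.
have LS : L2 P (fun w => \sum_(i < n) b (lift ord0 i) * F (lift ord0 i) w).
  by apply: L2_sum => i; exact: L2Z.
rewrite E (le_trans (le_dotL2D (L2Z _ (LF _)) LS))//.
have h1 := IH (fun i => b (lift ord0 i)) (fun i => F (lift ord0 i)) (fun i => LF _) (fun i => Fe _).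
have h0 : dotL2 P (fun w => b ord0 * F ord0 w) (fun w => b ord0 * F ord0 w) <= b ord0 ^+ 2 * e.
  rewrite dotL2Zl//; last exact: L2Z.
  by rewrite dotL2C dotL2Zl// mulrA -expr2 ler_wpM2l ?sqr_ge0.
rewrite big_ord_recl exprS; set S := \sum_(i < n) _ in h1 *.
have p1 : 1 <= 2 ^+ n :> R by rewrite exprn_ege1// ler1n.
have h2 : b ord0 ^+ 2 * e <= 2 ^+ n * (b ord0 ^+ 2 * e).
  by rewrite ler_peMl// mulr_ge0 ?sqr_ge0.
rewrite (_ : 2 * 2 ^+ n * (b ord0 ^+ 2 + S) * e =
  2 * (2 ^+ n * (b ord0 ^+ 2 * e)) + 2 * (2 ^+ n * S * e)); last by ring.
by lra.
Qed.

Variable P : probability Omega R.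

Lemma expRN_lipschitz (x y : R) : 0 <= x -> 0 <= y ->
  `|expR (- x) - expR (- y)| <= `|x - y|.
Proof.
have H (s t : R) : 0 <= s -> s <= t -> `|expR (- s) - expR (- t)| <= `|s - t|.
  move=> s0 st; rewrite distrC [leRHS]distrC (ger0_norm (_ : 0 <= t - s)) ?subr_ge0//.
  rewrite distrC ger0_norm ?subr_ge0 ?ler_expR ?lerN2//.
  have -> : expR (- t) = expR (- s) * expR (- (t - s)) by rewrite -expRD; congr expR; ring.
  have h1 : expR (- s) <= 1 by rewrite -expR0 ler_expR oppr_le0.
  have h2 := expR_ge1Dx (- (t - s)); have h3 := expR_ge0 (- s).
  have h4 : 0 <= t - s by rewrite subr_ge0.
  have h5 : expR (- (t - s)) <= 1 by rewrite -expR0 ler_expR oppr_le0.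
  by nra.
move=> x0 y0; have [xy|/ltW yx] := leP x y; first exact: H.
by rewrite distrC [leRHS]distrC; exact: H.
Qed.

(** Both identities are closed under mean-square limits: [cos], [sin] and, on the half-line,
    [exp (- x)] are 1-Lipschitz, and the second moment is continuous. *)
Lemma gaussian_limit (Y : Omega -> R) : L2 P Y ->
  (forall e, 0 < e -> exists X : Omega -> R,
    [/\ L2 P X, dotL2 P (fun w => X w - Y w) (fun w => X w - Y w) <= e,
        \int[P]_w cos (X w) = expR (- (dotL2 P X X / 2)) & \int[P]_w sin (X w) = 0]) ->
  \int[P]_w cos (Y w) = expR (- (dotL2 P Y Y / 2)) /\ \int[P]_w sin (Y w) = 0.
Proof.
move=> LY H; pose v := dotL2 P Y Y.
have v0 : 0 <= v by exact: dotL2_ge0.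
have mtrig (f : R -> R) Z : continuous f -> L2 P Z -> measurable_fun setT (fun w => f (Z w)).
  by move=> cf [mZ _]; apply: measurableT_comp mZ; exact: continuous_measurable_fun.
have trig (f : R -> R) Z : continuous f -> (forall x, `|f x| <= 1) -> L2 P Z ->
    rintegrable P (fun w => f (Z w)).
  by move=> cf f1 LZ; exact: bounded_rintegrable (mtrig f Z cf LZ) (fun w => f1 _).
have lip (f : R -> R) X Z eta : continuous f -> (forall x, `|f x| <= 1) ->
    (forall x y, `|f x - f y| <= `|x - y|) -> L2 P X -> L2 P Z -> 0 < eta ->
    dotL2 P (fun w => X w - Z w) (fun w => X w - Z w) <= eta ^+ 2 ->
    `|\int[P]_w f (X w) - \int[P]_w f (Z w)| <= eta.
  move=> cf f1 fl LX LZ eta0 XZ.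
  have LD := L2B LX LZ; have DD := L2_mul LD LD.
  have di : rintegrable P (fun w => f (X w) - f (Z w)) by apply: rintegrableB; exact: trig.
  have bi : rintegrable P (fun w => 2^-1 * (eta + eta^-1 * ((X w - Z w) * (X w - Z w)))).
    apply: rintegrableZl; apply: rintegrableD; last exact: rintegrableZl.
    exact: finite_measure_integrable_cst.
  rewrite -rintegralB; try exact: trig.
  apply: (le_trans (le_normr_Rintegral measurableT di)).
  apply: (@le_trans _ _ (\int[P]_w (2^-1 * (eta + eta^-1 * ((X w - Z w) * (X w - Z w)))))).
    apply: le_rintegral => //; first exact: rintegrable_norm.
    move=> w; apply: (le_trans (fl _ _)).
    rewrite -[(X w - Z w) * _]expr2 -(real_normK (num_real (X w - Z w))).
    set r := `|X w - Z w|; have r0 : 0 <= r by rewrite /r normr_ge0.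
    (* Expanding gives [r <= (eta + r^2 / eta) / 2], which after integration plays the role of
       Cauchy-Schwarz. *)
    have : 0 <= eta^-1 * (eta - r) ^+ 2 by rewrite mulr_ge0 ?sqr_ge0 ?invr_ge0 ?(ltW eta0).
    rewrite (_ : eta^-1 * (eta - r) ^+ 2 = eta - 2 * r + eta^-1 * r ^+ 2); first by lra.
    by field; rewrite gt_eqF.
  rewrite rintegralZl; last first.
    by apply: rintegrableD; [exact: finite_measure_integrable_cst|exact: rintegrableZl].
  rewrite rintegralD; [|exact: finite_measure_integrable_cst|exact: rintegrableZl].
  rewrite rintegralZl// rintegral_prob_cst.
  have : eta^-1 * dotL2 P (fun w => X w - Z w) (fun w => X w - Z w) <= eta.
    by rewrite ler_pdivrMl// -expr2.
  by rewrite /dotL2; lra.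
have var X eta : L2 P X -> 0 < eta -> eta <= 1 ->
    dotL2 P (fun w => X w - Y w) (fun w => X w - Y w) <= eta ^+ 2 ->
    `|dotL2 P X X - v| <= eta * (2 + v).
  move=> LX eta0 eta1 XY; pose D w := X w - Y w.
  have LD : L2 P D by exact: L2B.
  have XE : X = fun w => 1 * D w + Y w by apply/funext => w; rewrite /D mul1r subrK.
  have -> : dotL2 P X X - v = dotL2 P D D + 2 * dotL2 P D Y.
    by rewrite {1 2}XE dotL2_sqr_lin// expr1n; rewrite /v; ring.
  have D0 := dotL2_ge0 P D.
  have DY : `|2 * dotL2 P D Y| <= eta^-1 * dotL2 P D D + eta * v.
    have h1 := dotL2_ge0 P (fun w => eta^-1 * D w + Y w).
    have h2 := dotL2_ge0 P (fun w => - eta^-1 * D w + Y w).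
    rewrite !dotL2_sqr_lin// -/v in h1 h2.
    have g1 : 0 <= eta * (eta^-1 ^+ 2 * dotL2 P D D + 2 * eta^-1 * dotL2 P D Y + v).
      by rewrite mulr_ge0 ?(ltW eta0).
    have g2 : 0 <= eta * ((- eta^-1) ^+ 2 * dotL2 P D D + 2 * - eta^-1 * dotL2 P D Y + v).
      by rewrite mulr_ge0 ?(ltW eta0).
    rewrite (_ : eta * _ = eta^-1 * dotL2 P D D + 2 * dotL2 P D Y + eta * v) in g1; last first.
      by field; rewrite gt_eqF.
    rewrite (_ : eta * _ = eta^-1 * dotL2 P D D - 2 * dotL2 P D Y + eta * v) in g2; last first.
      by field; rewrite gt_eqF.
    by rewrite ler_norml; apply/andP; split; lra.
  have DDe : eta^-1 * dotL2 P D D <= eta by rewrite ler_pdivrMl// -expr2.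
  apply: (le_trans (ler_normD _ _)); rewrite (ger0_norm D0).
  have e2 : eta ^+ 2 <= eta by rewrite expr2 ler_piMl// ltW.
  by move: XY; rewrite -/D; lra.
have main e : 0 < e ->
    `|\int[P]_w cos (Y w) - expR (- (v / 2))| <= e /\ `|\int[P]_w sin (Y w)| <= e.
  move=> e0; pose K := 2 + v; have K0 : 0 < K by rewrite /K; lra.
  (* The expected cosine moves by at most [eta] and the second moment by at most [eta * K]; their
     sum is at most [e]. *)
  pose eta := Num.min 1 (e / (1 + K)).
  have K1 : 0 < 1 + K by lra.
  have eta0 : 0 < eta by rewrite lt_min ltr01 divr_gt0.
  have eta1 : eta <= 1 by rewrite ge_min lexx.
  have etae : eta * (1 + K) <= e.
    by rewrite -ler_pdivlMr// ge_min lexx orbT.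
  have [X [LX XY cX sX]] := H (eta ^+ 2) (exprn_gt0 2 eta0).
  have lc := lip _ X Y eta (@continuous_cos R) (@cos_max R) (@cos_lipschitz R) LX LY eta0 XY.
  have ls := lip _ X Y eta (@continuous_sin R) (@sin_max R) (@sin_lipschitz R) LX LY eta0 XY.
  have vX := var X eta LX eta0 eta1 XY.
  have eX : `|expR (- (dotL2 P X X / 2)) - expR (- (v / 2))| <= eta * K.
    apply: le_trans (expRN_lipschitz _ _) _; rewrite ?divr_ge0 ?dotL2_ge0//.
    rewrite -mulrBl normrM (ger0_norm (_ : 0 <= 2^-1))//.
    have := normr_ge0 (dotL2 P X X - v); move: vX; rewrite -/K; lra.
  have eK : 0 <= eta * K by rewrite mulr_ge0 ?ltW.
  rewrite mulrDr mulr1 in etae.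
  split; last by move: ls; rewrite sX sub0r normrN; lra.
  rewrite (_ : _ - _ = (\int[P]_w cos (Y w) - \int[P]_w cos (X w)) +
    (expR (- (dotL2 P X X / 2)) - expR (- (v / 2)))); last by rewrite cX; ring.
  by apply: (le_trans (ler_normD _ _)); rewrite distrC; lra.
split.
- apply/eqP; rewrite -subr_eq0 -normr_le0; apply/ler_addgt0Pr => e e0.
  by rewrite add0r; exact: (main e e0).1.
- apply/eqP; rewrite -normr_le0; apply/ler_addgt0Pr => e e0.
  by rewrite add0r; exact: (main e e0).2.
Qed.

End L2_approximation.

Section noise_spectral.
Context (R : realType) (d : nat) (H : R) (h : 'rV[R]_d -> R).
Hypotheses (mh : measurable_fun setT h) (h0 : forall xi, 0 <= h xi).
Local Notation tx := (@lebesgue_tx R d).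
Local Notation c := (cHd d H).
Hypothesis c0 : 0 < c.
Implicit Types phi g : R * 'rV[R]_d -> R.

Definition spectral_weight (q : R * 'rV[R]_d) : R := `|q.1| `^ (1 - 2 * H) * h q.2.

(** Multiplying by the square root of the weight turns the complex weighted space into pairs of real
    functions in L2 of Lebesgue measure, so that the real lemmas on [L2] apply. *)
Definition specRe phi (q : R * 'rV[R]_d) : R :=
  Num.sqrt (spectral_weight q) * complex.Re (fourier phi q.1 q.2).

Definition specIm phi (q : R * 'rV[R]_d) : R :=
  Num.sqrt (spectral_weight q) * complex.Im (fourier phi q.1 q.2).

Lemma spectral_weight_ge0 q : 0 <= spectral_weight q.
Proof. by rewrite mulr_ge0 ?powR_ge0. Qed.

Lemma measurable_spectral_weight : measurable_fun setT spectral_weight.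
Proof.
apply: measurable_funM; last exact: measurableT_comp mh measurable_snd.
have m : measurable_fun setT (fun x : R => `|x| `^ (1 - 2 * H)).
  by have := measurableT_comp (measurable_powR (1 - 2 * H)) (@normr_measurable R setT).
by have := measurableT_comp m (@measurable_fst _ _ (measurableTypeR R) 'rV[R]_d).
Qed.

Lemma measurable_sqrt_spectral_weight :
  measurable_fun setT (fun q => Num.sqrt (spectral_weight q)).
Proof.
have m : measurable_fun setT (@Num.sqrt R).
  by apply: continuous_measurable_fun; exact: sqrt_continuous.
by have := measurableT_comp m measurable_spectral_weight.
Qed.

Lemma measurable_specRe phi : measurable_fun setT phi -> measurable_fun setT (specRe phi).
Proof.
move=> mphi; apply: measurable_funM; first exact: measurable_sqrt_spectral_weight.
exact: measurable_Re_fourier.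
Qed.

Lemma measurable_specIm phi : measurable_fun setT phi -> measurable_fun setT (specIm phi).
Proof.
move=> mphi; apply: measurable_funM; first exact: measurable_sqrt_spectral_weight.
exact: measurable_Im_fourier.
Qed.

Definition spectral_L2 phi := L2 tx (specRe phi) /\ L2 tx (specIm phi).

Lemma test_function_measurable phi : test_function phi -> measurable_fun setT phi.
Proof. by move=> [/(_ 0%N) + _]; exact: continuous_measurable_tx. Qed.

Lemma noise_dist2E phi g : noise_dist2 H h phi g =
  (c%:E * \int[tx]_q ((specRe phi q - specRe g q) ^+ 2 +
                      (specIm phi q - specIm g q) ^+ 2)%:E)%E.
Proof.
congr (_ * _)%E; apply: eq_integral => q _; congr EFin.
have sq : Num.sqrt (spectral_weight q) ^+ 2 = spectral_weight q.
  by rewrite sqr_sqrtr// spectral_weight_ge0.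
rewrite /specRe /specIm -!mulrBr !exprMn sq -mulrDr /normsq.
by case: (fourier phi _ _) => ? ?; case: (fourier g _ _) => ? ?.
Qed.

Context (dO : measure_display) (Omega : measurableType dO) (P : probability Omega R).
Variable W : (R * 'rV[R]_d -> R) -> {RV P >-> R}.
Hypothesis noiseW : gaussian_noise H h W.

Lemma noise_L2 phi : test_function phi -> L2 P (W phi).
Proof.
move=> tphi; split; first exact: measurable_funPT.
have := noise_gaussian noiseW (fun=> 1) (fun _ : 'I_1 => tphi).
have E : (fun w => \sum_(i < 1) 1 * W phi w) = W phi.
  by apply/funext => w; rewrite big_ord1 mul1r.
rewrite E => /centered_gaussianP[] //; exact: measurable_funPT.
Qed.

(** The real part of [z * conjc w] is the real inner product of [z] and [w]; square integrability
    allows the integral to be split in two. *)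
Lemma noise_covRe phi psi : test_function phi -> test_function psi ->
  spectral_L2 phi -> spectral_L2 psi ->
  dotL2 P (W phi) (W psi) =
  c * (dotL2 tx (specRe phi) (specRe psi) + dotL2 tx (specIm phi) (specIm psi)).
Proof.
move=> tphi tpsi [A1 B1] [A2 B2].
have ReZ (k : R) z : complex.Re (k%:C * z)%C = k * complex.Re z.
  by case: z => x y /=; rewrite mul0r subr0.
have := congr1 (@complex.Re R) (noise_covE noiseW tphi tpsi).
rewrite /noise_cov ReZ => E; rewrite [LHS]E; congr (_ * _).
rewrite /dotL2 -rintegralD; [|exact: L2_mul|exact: L2_mul].
apply: eq_Rintegral => q _; rewrite ReZ -/(spectral_weight q).
have sq : Num.sqrt (spectral_weight q) ^+ 2 = spectral_weight q.
  by rewrite sqr_sqrtr// spectral_weight_ge0.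
rewrite /specRe /specIm; set s := Num.sqrt _ in sq *; rewrite -sq.
case: (fourier phi _ _) => a1 b1; case: (fourier psi _ _) => a2 b2 /=.
by ring.
Qed.

Lemma cvge0_ge0_small (a : nat -> \bar R) e : (forall n, 0 <= a n)%E -> 0 < e ->
  a n @[n --> \oo] --> 0%E -> \forall n \near \oo, a n \is a fin_num /\ fine (a n) <= e.
Proof.
move=> a0 e0 /fine_cvgP[fa la].
near=> n; split; first by near: n.
rewrite (le_trans (ler_norm _))// -[fine _]subr0 distrC.
by near: n; move/cvgrPdist_le : la => /(_ e e0).
Unshelve. all: by end_near. Qed.

Lemma rintegrable_fin_num dT (T : measurableType dT) (mu : {measure set T -> \bar R}) (k : R)
    (f : T -> R) : 0 < k -> measurable_fun setT f -> (forall x, 0 <= f x) ->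
  (k%:E * \int[mu]_x (f x)%:E \is a fin_num)%E -> rintegrable mu f.
Proof.
move=> k0 mf f0 fin; apply: ge0_rintegrable => //; rewrite ltey.
by apply: contraTneq fin => ->; rewrite gt0_muley ?lte_fin.
Qed.

(** Convergence to 0 in the extended reals makes the distances eventually finite. Finiteness then
    passes from [g] to the approximating test functions on the spectral side, and from [W phi] to
    [Y] on the probability side. *)
Lemma wiener_approx g (Y : {RV P >-> R}) : spectral_L2 g -> wiener_integral H h W g Y ->
  L2 P Y /\ forall e, 0 < e -> exists phi,
    [/\ test_function phi, spectral_L2 phi,
      dotL2 tx (fun q => specRe phi q - specRe g q) (fun q => specRe phi q - specRe g q) <= e,
      dotL2 tx (fun q => specIm phi q - specIm g q) (fun q => specIm phi q - specIm g q) <= e &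
      dotL2 P (fun w => W phi w - Y w) (fun w => W phi w - Y w) <= e].
Proof.
move=> [Ag Bg] [phi [tphi dl Wl]].
have D0 n : (0 <= noise_dist2 H h (phi n) g)%E.
  rewrite noise_dist2E; apply: mule_ge0; first by rewrite lee_fin ltW.
  by apply: integral_ge0 => q _; rewrite lee_fin addr_ge0 ?sqr_ge0.
have W0 n : (0 <= \int[P]_w ((W (phi n) w - Y w) ^+ 2)%:E)%E.
  by apply: integral_ge0 => q _; rewrite lee_fin sqr_ge0.
have main e : 0 < e -> L2 P Y /\ exists phi,
    [/\ test_function phi, spectral_L2 phi,
      dotL2 tx (fun q => specRe phi q - specRe g q) (fun q => specRe phi q - specRe g q) <= e,
      dotL2 tx (fun q => specIm phi q - specIm g q) (fun q => specIm phi q - specIm g q) <= e &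
      dotL2 P (fun w => W phi w - Y w) (fun w => W phi w - Y w) <= e].
  move=> e0; have ce0 : 0 < c * e by rewrite mulr_gt0.
  have [n [] ] := filter_ex (filterI (cvge0_ge0_small D0 ce0 dl) (cvge0_ge0_small W0 e0 Wl)).
  rewrite noise_dist2E => -[fD De] [fW We].
  have mphi := test_function_measurable (tphi n).
  have mA := measurable_specRe mphi; have mB := measurable_specIm mphi.
  pose fA q := specRe (phi n) q - specRe g q; pose fB q := specIm (phi n) q - specIm g q.
  have mfA : measurable_fun setT fA by apply: measurable_funB => //; exact: Ag.1.
  have mfB : measurable_fun setT fB by apply: measurable_funB => //; exact: Bg.1.
  have Di : rintegrable tx (fun q => fA q ^+ 2 + fB q ^+ 2).
    apply: (rintegrable_fin_num c0) fD.
      by apply: measurable_funD; apply: measurable_funX.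
    by move=> q; rewrite addr_ge0 ?sqr_ge0.
  have LA : L2 tx fA.
    split=> //; apply: (le_rintegrable _ _ Di); first exact: measurable_funX.
    by move=> q; rewrite ger0_norm ?sqr_ge0// lerDl sqr_ge0.
  have LB : L2 tx fB.
    split=> //; apply: (le_rintegrable _ _ Di); first exact: measurable_funX.
    by move=> q; rewrite ger0_norm ?sqr_ge0// lerDr sqr_ge0.
  have LW := noise_L2 (tphi n).
  have mY : measurable_fun setT Y by exact: measurable_funPT.
  have LWY : L2 P (fun w => W (phi n) w - Y w).
    have m : measurable_fun setT (fun w => W (phi n) w - Y w).
      by apply: measurable_funB => //; exact: LW.1.
    split=> //; apply: (@rintegrable_fin_num _ _ P 1) => //.
    - exact: measurable_funX.
    - by move=> w; rewrite sqr_ge0.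
    - by rewrite mul1e.
  split.
    have := L2B LW LWY; congr (L2 _); apply/funext => w; ring.
  have De' : dotL2 tx fA fA + dotL2 tx fB fB <= e.
    rewrite -(ler_pM2l c0); apply: le_trans De.
    rewrite -EFin_Rintegral// -EFinM/= ler_pM2l// /dotL2.
    rewrite -rintegralD; [|exact: L2_mul|exact: L2_mul].
    apply: le_rintegral => [| |q]; last by rewrite -!expr2.
      by apply: rintegrableD; exact: L2_mul.
    exact: Di.
  have A0 := dotL2_ge0 tx fA; have B0 := dotL2_ge0 tx fB.
  exists (phi n); split => //.
  - split.
    + have := L2D LA Ag; congr (L2 _); apply/funext => q; rewrite /fA; ring.
    + have := L2D LB Bg; congr (L2 _); apply/funext => q; rewrite /fB; ring.
  - by apply: le_trans De'; rewrite lerDl.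
  - by apply: le_trans De'; rewrite lerDr.
split; first exact: (main 1 ltr01).1.
by move=> e /main[].
Qed.

Variables (n : nat) (g : 'I_n -> R * 'rV[R]_d -> R) (Y : 'I_n -> {RV P >-> R}).
Hypotheses (Lg : forall i, spectral_L2 (g i)) (gY : forall i, wiener_integral H h W (g i) (Y i)).
Variable b : 'I_n -> R.
Let S (F : 'I_n -> Omega -> R) w := \sum_(i < n) b i * F i w.
Let T (F : 'I_n -> R * 'rV[R]_d -> R) q := \sum_(i < n) b i * F i q.
Let K := 2 ^+ n * (\sum_(i < n) b i ^+ 2).

Let K0 : 0 <= K.
Proof. by rewrite mulr_ge0 ?exprn_ge0// sumr_ge0// => i _; rewrite sqr_ge0. Qed.

Let LY i : L2 P (Y i). Proof. exact: (wiener_approx (Lg i) (gY i)).1. Qed.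
Let LSY : L2 P (S Y). Proof. by apply: L2_sum => i; exact: L2Z. Qed.

Let approx e : 0 < e -> exists phi : 'I_n -> R * 'rV[R]_d -> R,
  [/\ forall i, test_function (phi i), forall i, spectral_L2 (phi i),
    dotL2 tx (fun q => T (fun i => specRe (phi i)) q - T (fun i => specRe (g i)) q)
      (fun q => T (fun i => specRe (phi i)) q - T (fun i => specRe (g i)) q) <= K * e,
    dotL2 tx (fun q => T (fun i => specIm (phi i)) q - T (fun i => specIm (g i)) q)
      (fun q => T (fun i => specIm (phi i)) q - T (fun i => specIm (g i)) q) <= K * e &
    dotL2 P (fun w => S (fun i => W (phi i)) w - S Y w)
      (fun w => S (fun i => W (phi i)) w - S Y w) <= K * e].
Proof.
move=> e0.
have /choice[phi phiP] := fun i => (wiener_approx (Lg i) (gY i)).2 e e0.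
have t i : test_function (phi i) by have [] := phiP i.
have L i : spectral_L2 (phi i) by have [] := phiP i.
exists phi; split => //.
- have -> : (fun q => T (fun i => specRe (phi i)) q - T (fun i => specRe (g i)) q) =
      T (fun i q => specRe (phi i) q - specRe (g i) q).
    by apply/funext => q; rewrite /T -sumrB; apply: eq_bigr => i _; rewrite mulrBr.
  apply: le_dotL2_sum => [i|i|]; [|by case: (phiP i) => _ _ hA hB hW; exact: hA|exact: ltW].
  by apply: L2B; [exact: (L i).1|exact: (Lg i).1].
- have -> : (fun q => T (fun i => specIm (phi i)) q - T (fun i => specIm (g i)) q) =
      T (fun i q => specIm (phi i) q - specIm (g i) q).
    by apply/funext => q; rewrite /T -sumrB; apply: eq_bigr => i _; rewrite mulrBr.
  apply: le_dotL2_sum => [i|i|]; [|by case: (phiP i) => _ _ hA hB hW; exact: hB|exact: ltW].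
  by apply: L2B; [exact: (L i).2|exact: (Lg i).2].
- have -> : (fun w => S (fun i => W (phi i)) w - S Y w) =
      S (fun i w => W (phi i) w - Y i w).
    by apply/funext => q; rewrite /S -sumrB; apply: eq_bigr => i _; rewrite mulrBr.
  apply: le_dotL2_sum => [i|i|]; [|by case: (phiP i) => _ _ hA hB hW; exact: hW|exact: ltW].
  by apply: L2B => //; exact: noise_L2.
Qed.

Lemma wiener_gaussian :
  \int[P]_w cos (S Y w) = expR (- (dotL2 P (S Y) (S Y) / 2)) /\ \int[P]_w sin (S Y w) = 0.
Proof.
apply: gaussian_limit => // e e0.
have K1 : 0 < 1 + K by apply: ltr_wpDr.
have [phi [t L _ _ hY]] := approx (divr_gt0 e0 K1).
have LX : L2 P (S (fun i => W (phi i))).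
  by apply: L2_sum => i; apply: L2Z; exact: noise_L2.
exists (S (fun i => W (phi i))).
have [_ cX sX] := centered_gaussianP LX.1 (noise_gaussian noiseW b t).
split=> //; apply: (le_trans hY).
by rewrite mulrA ler_pdivrMr// mulrC ler_pM2l// lerDr.
Qed.

(** The isometry would give equality with [c]; only a lower bound is wanted. The 4 comes from two
    uses of [(a + b)^2 <= 2 a^2 + 2 b^2], one on the spectral side and one in [L2 P], the
    approximation errors being removed by [e --> 0]. *)
Lemma wiener_lower_bound :
  c / 4 * (dotL2 tx (T (fun i => specRe (g i))) (T (fun i => specRe (g i))) +
           dotL2 tx (T (fun i => specIm (g i))) (T (fun i => specIm (g i)))) <=
  dotL2 P (S Y) (S Y).
Proof.
have alg (k r e NA NB a1 b1 dA dB v : R) : 0 < k -> k * (a1 + b1) <= 2 * v + 2 * (r * e) ->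
    dA <= r * e -> dB <= r * e -> NA <= 2 * a1 + 2 * dA -> NB <= 2 * b1 + 2 * dB ->
    k / 4 * (NA + NB) <= v + (1 + k) * r * e.
  move=> k0 h1 h2 h3 h4 h5.
  have : k * (NA + NB) <= k * (2 * (a1 + b1) + 4 * (r * e)) by rewrite ler_pM2l//; lra.
  by lra.
set NA := dotL2 tx _ _; set NB := dotL2 tx _ _.
have sqB dT (O : measurableType dT) (mu : {measure set O -> \bar R}) (f k : O -> R) :
    L2 mu f -> L2 mu k -> dotL2 mu f f <= 2 * dotL2 mu k k +
      2 * dotL2 mu (fun w => k w - f w) (fun w => k w - f w).
  move=> Lf Lk; have Ld := L2Z (-1) (L2B Lk Lf).
  have := le_dotL2D Lk Ld.
  rewrite (_ : (fun w => k w + -1 * (k w - f w)) = f); last by apply/funext => w; ring.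
  rewrite [X in _ + 2 * X](_ : _ = dotL2 mu (fun w => k w - f w) (fun w => k w - f w))//.
  by apply: eq_Rintegral => w _; ring.
suff H1 e : 0 < e -> c / 4 * (NA + NB) <= dotL2 P (S Y) (S Y) + (1 + c) * K * e.
  apply/ler_addgt0Pr => e e0.
  have K1 : 0 < 1 + (1 + c) * K by rewrite ltr_wpDr// mulr_ge0// addr_ge0 ?ltW.
  apply: (le_trans (H1 _ (divr_gt0 e0 K1))); rewrite lerD2l.
  by rewrite mulrA ler_pdivrMr// mulrC ler_pM2l// lerDr.
move=> e0; have [phi [t L hA hB hY]] := approx e0.
have LX : L2 P (S (fun i => W (phi i))).
  by apply: L2_sum => i; apply: L2Z; exact: noise_L2.
have LTA : L2 tx (T (fun i => specRe (phi i))).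
  by apply: L2_sum => i; apply: L2Z; exact: (L i).1.
have LTB : L2 tx (T (fun i => specIm (phi i))).
  by apply: L2_sum => i; apply: L2Z; exact: (L i).2.
have LgA : L2 tx (T (fun i => specRe (g i))).
  by apply: L2_sum => i; apply: L2Z; exact: (Lg i).1.
have LgB : L2 tx (T (fun i => specIm (g i))).
  by apply: L2_sum => i; apply: L2Z; exact: (Lg i).2.
have EX : dotL2 P (S (fun i => W (phi i))) (S (fun i => W (phi i))) =
    c * (dotL2 tx (T (fun i => specRe (phi i))) (T (fun i => specRe (phi i))) +
         dotL2 tx (T (fun i => specIm (phi i))) (T (fun i => specIm (phi i)))).
  rewrite !dotL2_sum_sum; [|by move=> i; exact: (L i).2|by move=> i; exact: (L i).1|by move=> i; exact: noise_L2].
  rewrite -big_split mulr_sumr; apply: eq_bigr => i _.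
  rewrite -big_split mulr_sumr; apply: eq_bigr => j _.
  rewrite noise_covRe//; set x := dotL2 tx _ _; set y := dotL2 tx _ _.
  by rewrite mulrDr !mulrDr; congr (_ + _); rewrite !(mulrCA c).
have hA' := sqB _ _ tx _ _ LgA LTA; have hB' := sqB _ _ tx _ _ LgB LTB.
have hX : dotL2 P (S (fun i => W (phi i))) (S (fun i => W (phi i))) <=
    2 * dotL2 P (S Y) (S Y) + 2 * (K * e).
  apply: (le_trans (sqB _ _ P _ _ LX LSY)).
  rewrite lerD2l ler_pM2l// (le_trans _ hY)// le_eqVlt; apply/orP; left; apply/eqP.
  by apply: eq_Rintegral => w _; ring.
rewrite EX in hX; exact: (alg _ _ _ _ _ _ _ _ _ _ c0 hX hA hB hA' hB').
Qed.

End noise_spectral.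

(** * The transform of the Green function *)

Section levy_density_theory.
Context (R : realType) (d : nat) (dX : measure_display) (OmegaX : measurableType dX).
Context (PX : probability OmegaX R) (X : R -> OmegaX -> 'rV[R]_d) (Psi : 'rV[R]_d -> R).
Hypotheses (levyX : symmetric_levy PX X) (PsiX : char_exponent PX X Psi)
  (densityX : has_levy_density PX X Psi).
Local Notation leb := (lebesgue_rV R d).
Local Notation p := (levy_density Psi).

Let measurable_levy t : 0 <= t -> measurable_fun setT (X t).
Proof. by move=> t0; case: levyX => mX _ _ _ _ _; exact: mX. Qed.

Lemma levy_cos t xi : 0 <= t -> \int[PX]_w cos (dotp xi (X t w)) = expR (- t * Psi xi).
Proof. by move=> t0; have := congr1 (@complex.Re R) (PsiX xi t0). Qed.

Lemma levy_sin t xi : 0 <= t -> \int[PX]_w sin (dotp xi (X t w)) = 0.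
Proof. by move=> t0; have := congr1 (@complex.Im R) (PsiX xi t0). Qed.

Lemma measurable_cosdotp dT (T : measurableType dT) (f g : T -> 'rV[R]_d) :
  measurable_fun setT f -> measurable_fun setT g ->
  measurable_fun setT (fun z => cos (dotp (f z) (g z))).
Proof.
move=> mf mg; apply: measurableT_comp.
  by apply: continuous_measurable_fun; exact: continuous_cos.
have m : measurable_fun setT (fun z => (f z, g z)) by exact/measurable_fun_pair.
by have := measurableT_comp (@measurable_dotp R d) m.
Qed.

(** [Psi] is minus the logarithm of the characteristic function of [X 1], an integral depending
    measurably on its parameter. *)
Lemma measurable_exponent : measurable_fun setT Psi.
Proof.
rewrite (_ : Psi = fun xi => - ln (\int[PX]_w cos (dotp xi (X 1 w)))); last first.
  by apply/funext => xi; rewrite levy_cos// expRK mulN1r opprK.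
apply: measurableT_comp => //; apply: measurableT_comp; first exact: measurable_ln.
apply: (@measurable_rintegral2 _ _ _ _ R PX (fun z => cos (dotp z.1 (X 1 z.2)))).
apply: measurable_cosdotp => //.
exact: measurableT_comp (measurable_levy ler01) measurable_snd.
Qed.

Lemma levy_densityE t x :
  p t x = (2 * pi) ^- d * \int[leb]_xi (cos (dotp xi x) * expR (- t * Psi xi)).
Proof.
by congr (_ * _); apply: eq_Rintegral => xi _ /=; rewrite mulr0 subr0 cosN.
Qed.

Lemma levy_density_subC t x y : p t (x - y) = p t (y - x).
Proof.
rewrite !levy_densityE; congr (_ * _); apply: eq_Rintegral => xi _; congr (_ * _).
rewrite -cosN; congr cos; rewrite /dotp -sumrN; apply: eq_bigr => j _.
by rewrite !mxE -mulrN opprB.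
Qed.

Lemma measurable_levy_density :
  measurable_fun setT (fun z : R * 'rV[R]_d => p z.1 z.2).
Proof.
under eq_fun do rewrite levy_densityE.
apply: measurable_funM => //.
apply: (@measurable_rintegral2 _ _ (R * 'rV[R]_d)%type _ R leb
  (fun z => cos (dotp z.2 z.1.2) * expR (- z.1.1 * Psi z.2))).
apply: measurable_funM.
  apply: measurable_cosdotp => //.
  exact: measurableT_comp measurable_snd measurable_fst.
apply: measurableT_comp => //; apply: measurable_funM.
  by apply: measurableT_comp => //; exact: measurableT_comp measurable_fst measurable_fst.
exact: measurableT_comp measurable_exponent measurable_snd.
Qed.

Lemma measurable_levy_density_time t : measurable_fun setT (p t).
Proof. exact: (measurableT_comp measurable_levy_density (measurable_pair1 t)). Qed.

(** The defining integral shows no sign, but over the set where [p t] is negative its integral is a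
    probability, hence nonnegative; so that set is null. *)
Lemma levy_density_ge0 t : 0 < t -> {ae leb, forall y, 0 <= p t y}.
Proof.
move=> t0; pose A := [set y | p t y < 0].
have mp := measurable_levy_density_time t.
have mA : measurable A.
  have m := measurable_fun_ltr mp (@measurable_cst _ _ 'rV[R]_d R setT 0).
  by have := m measurableT [set true] I; rewrite setTI.
have mpA : measurable_fun A (EFin \o p t).
  by apply/measurable_EFinP; exact: measurable_funS mp.
have E : (\int[leb]_(y in A) `|(p t y)%:E| = 0)%E.
  have h1 : (0 <= \int[leb]_(y in A) (p t y)%:E)%E by rewrite -densityX.
  have h2 : (\int[leb]_(y in A) `|(p t y)%:E| = \int[leb]_(y in A) (- p t y)%:E)%E.
    by apply: eq_integral => y; rewrite inE => Ay; rewrite abse_EFin ltr0_norm.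
  apply/eqP; rewrite eq_le; apply/andP; split; last exact: integral_ge0.
  rewrite h2 -oppe_ge0 -integral_ge0N; last first.
    by move=> y Ay; rewrite lee_fin oppr_ge0 ltW.
  rewrite (le_trans h1)// le_eqVlt; apply/orP; left; apply/eqP.
  by apply: eq_integral => y _; rewrite -EFinN opprK.
have /(ae_eq_integral_abs leb mA mpA) := E.
apply: filterS => y /= h; rewrite leNgt; apply/negP => py.
by have [p0] := h py; rewrite p0 ltxx in py.
Qed.

Lemma integral_norm_levy_density t : 0 < t -> (\int[leb]_y `|p t y|%:E = 1)%E.
Proof.
move=> t0; have mp := measurable_levy_density_time t.
transitivity (\int[leb]_y (p t y)%:E)%E.
  apply: ae_eq_integral => //.
  - by apply/measurable_EFinP; exact: measurableT_comp.
  - exact/measurable_EFinP.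
  - by apply: filterS (levy_density_ge0 t0) => y h _; rewrite ger0_norm.
by rewrite -densityX// (_ : [set _ | _] = setT) ?probability_setT//; apply/seteqP.
Qed.

Lemma rintegral_levy_density t (f : 'rV[R]_d -> R) : 0 < t -> measurable_fun setT f ->
  (forall y, `|f y| <= 1) ->
  rintegrable leb (fun y => f y * p t y) /\
  \int[leb]_y (f y * p t y) = \int[PX]_w f (X t w).
Proof.
move=> t0 mf f1; have mp := measurable_levy_density_time t.
have mX := measurable_levy (ltW t0).
have pi_ : rintegrable leb (p t).
  apply/integrableP; split; first exact/measurable_EFinP.
  by rewrite integral_norm_levy_density// ltry.
split.
  apply: (@le_rintegrable _ _ _ leb _ (fun y => `|p t y|)).
  - exact: measurable_funM.
  - by move=> y; rewrite normrM ler_piMl.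
  - exact: rintegrable_norm.
pose Y : {mfun OmegaX >-> 'rV[R]_d} := mfun_Sub (mem_set mX).
(* The change of density wants a function nonnegative everywhere, while [p t] is so only almost
   everywhere. *)
pose pp y := Num.max (p t y) 0.
have mpp : measurable_fun setT pp by exact: measurable_funrpos.
have pp0 y : 0 <= pp y by rewrite le_max lexx orbT.
have nuE A : measurable A -> distribution PX Y A = (\int[leb]_(y in A) (pp y)%:E)%E.
  move=> mA; transitivity (PX [set w | A (X t w)]); first by [].
  rewrite densityX//; apply: ae_eq_integral => //.
  - by apply/measurable_EFinP; exact: measurable_funS mp.
  - by apply/measurable_EFinP; exact: measurable_funS mpp.
  - by apply: filterS (levy_density_ge0 t0) => y h _; rewrite /pp; congr EFin; apply/esym/max_l.
have fi : rintegrable (distribution PX Y) f by exact: bounded_rintegrable f1.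
rewrite (@rintegral_law _ _ _ _ R PX (distribution PX Y) _ mX _ f mf)//.
rewrite (rintegral_density mpp pp0 nuE fi).
apply: ae_eq_rintegral; [exact: measurable_funM|exact: measurable_funM|].
by apply: filterS (levy_density_ge0 t0) => y h; rewrite /pp max_l.
Qed.

Lemma measurable_dotpl xi : measurable_fun setT (fun y : 'rV[R]_d => dotp xi y).
Proof. exact: (measurableT_comp (@measurable_dotp R d) (measurable_pair1 xi)). Qed.

(** After translation by [x] this is the characteristic function of [X t], which is real, so the
    sine term vanishes. The phase [th] will carry the time variable. *)
Lemma levy_density_cos_phase t xi x th : 0 < t ->
  \int[leb]_y (cos (th + dotp xi y) * p t (x - y)) = cos (th + dotp xi x) * expR (- t * Psi xi).
Proof.
move=> t0; have md := measurable_dotpl xi.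
have mc : measurable_fun setT (fun y => cos (th + dotp xi x + dotp xi y)).
  by apply: measurable_cos_fun; exact: measurable_funD.
have [i1 E1] := rintegral_levy_density t0 mc (fun y => cos_max _).
transitivity (\int[leb]_y (cos (th + dotp xi x + dotp xi (y - x)) * p t (y - x))).
  apply: eq_Rintegral => y _; rewrite levy_density_subC; congr (cos _ * _).
  rewrite -addrA; congr (_ + _); rewrite -big_split; apply: eq_bigr => j _ /=.
  by rewrite !mxE; ring.
rewrite (rintegral_rV_sub x i1) E1.
have mX := measurable_levy (ltW t0).
have ic : rintegrable PX (fun w => cos (dotp xi (X t w))).
  apply: bounded_rintegrable (fun w => cos_max _).
  by apply: measurable_cos_fun; exact: measurableT_comp md mX.
have is_ : rintegrable PX (fun w => sin (dotp xi (X t w))).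
  apply: bounded_rintegrable (fun w => sin_max _).
  apply: measurableT_comp; first by apply: continuous_measurable_fun; exact: continuous_sin.
  exact: measurableT_comp md mX.
transitivity (\int[PX]_w (cos (th + dotp xi x) * cos (dotp xi (X t w)) -
    sin (th + dotp xi x) * sin (dotp xi (X t w)))).
  by apply: eq_Rintegral => w _; rewrite cosD.
rewrite rintegralB; try exact: rintegrableZl.
by rewrite !rintegralZl// levy_cos ?ltW// levy_sin ?ltW// mulr0 subr0.
Qed.

End levy_density_theory.

Section green_fourier.
Context (R : realType) (d : nat) (dX : measure_display) (OmegaX : measurableType dX).
Context (PX : probability OmegaX R) (X : R -> OmegaX -> 'rV[R]_d) (Psi : 'rV[R]_d -> R).
Hypotheses (levyX : symmetric_levy PX X) (PsiX : char_exponent PX X Psi)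
  (densityX : has_levy_density PX X Psi).
Local Notation leb := (lebesgue_rV R d).
Local Notation lam := (@lebesgue_measure R).
Local Notation tx := (@lebesgue_tx R d).
Local Notation p := (levy_density Psi).

Lemma ae_lebesgue_neq (t : R) (Q : R -> Prop) : (forall s, s != t -> Q s) ->
  {ae lam, forall s, Q s}.
Proof.
move=> H; exists [set t]; split => //; first exact: lebesgue_measure_set1.
by move=> s /= nQ; apply: contrapT => /eqP st; apply: nQ; exact: H.
Qed.

Lemma measurable_indic_itv (t : R) : measurable_fun [set: measurableTypeR R] (\1_(`[0, t]%classic) : R -> R).
Proof. by apply: measurable_indic; exact: measurable_itv. Qed.

Lemma measurable_green t x : measurable_fun setT (green Psi t x).
Proof.
apply: measurable_funM; last first.
  exact: measurableT_comp (measurable_indic_itv t) measurable_fst.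
have m : measurable_fun setT (fun q : R * 'rV[R]_d => (t - q.1, x - q.2)).
  apply/measurable_fun_pair => /=.
    by apply: measurable_funB => //; exact: measurable_fst.
  apply: measurable_fun_rV => i; under eq_fun do rewrite !mxE.
  apply: measurable_funB => //.
  exact: measurableT_comp (measurable_coord i) measurable_snd.
by have := measurableT_comp (measurable_levy_density levyX PsiX) m.
Qed.

Lemma rintegrable_indic_itv (t : R) : rintegrable lam \1_(`[0, t]%classic).
Proof.
apply: ge0_rintegrable; first exact: measurable_indic_itv.
  by move=> s; rewrite indicE.
rewrite (@integral_indic _ (measurableTypeR R) R lam setT measurableT _ (measurable_itv _)) setIT.
by rewrite [X in (X < _)%E]lebesgue_measure_itv/= lte_fin; case: ifP => _; rewrite ?ltry// -EFinD ltry.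
Qed.

(** Each slice [s < t] is a probability density up to null sets, so the Green function has total
    mass [t]. *)
Lemma rintegrable_green t x (f : R * 'rV[R]_d -> R) : measurable_fun setT f ->
  (forall q, `|f q| <= 1) -> rintegrable tx (fun q => f q * green Psi t x q).
Proof.
move=> mf f1.
have mg := measurable_green t x.
apply: (rintegrable_product_le _ (rintegrable_indic_itv t)); first exact: measurable_funM.
apply: (ae_lebesgue_neq (t := t)) => s st.
have mp := measurable_levy_density_time levyX PsiX (t - s).
have mps : measurable_fun setT (fun y : 'rV[R]_d => p (t - s) (y - x)).
  by have := measurableT_comp mp (measurable_rV_sub x).
have sE : (s \in `[0, t]%classic) = (0 <= s <= t) by apply/idP/idP; rewrite inE /= in_itv.
have [s0t|s0t] := boolP (0 <= s <= t); last first.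
  rewrite (_ : (fun y => _) = cst 0%E) ?integral0 ?lee_fin//; apply/funext => y.
  by rewrite /green /= indicE sE (negbTE s0t) !mulr0 normr0.
have ts : 0 < t - s by rewrite subr_gt0 lt_neqAle st; case/andP: s0t.
apply: (@le_trans _ _ (\int[leb]_y `|p (t - s) (y - x)%R|%:E)%E).
  apply: ge0_le_integral => //.
  - apply/measurable_EFinP; apply: measurableT_comp => //.
    by have := measurableT_comp (measurable_funM mf mg) (measurable_pair1 s).
  - by apply/measurable_EFinP; exact: measurableT_comp.
  - move=> y _; rewrite lee_fin normrM /green /= indicE levy_density_subC.
    rewrite -[leRHS]mul1r ler_pM// normrM ler_piMr//.
    by case: (_ \in _); rewrite ?normr1 ?normr0.
rewrite (@ge0_integral_rV_sub _ _ (fun y => `|p (t - s) y|%:E) x)//; last first.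
  by apply/measurable_EFinP; exact: measurableT_comp.
by rewrite (integral_norm_levy_density levyX PsiX densityX ts) indicE sE s0t.
Qed.

(** The phase [th] lets one formula give the real part, for [th = 0], and the imaginary part, for
    [th] a quarter turn; the remaining time integral is the one of [damped_oscillation]. *)
Lemma rintegral_green t x q th :
  \int[tx]_z (cos (phase q z + th) * green Psi t x z) =
  \int[lam]_(s in `[0, t]) (cos (q.1 * s + (dotp q.2 x + th)) * expR (Psi q.2 * s - Psi q.2 * t)).
Proof.
have mc : measurable_fun setT (fun z => cos (phase q z + th)).
  apply: measurable_cos_fun; apply: measurable_funD => //.
  by have := measurableT_comp (@measurable_phase R d) (measurable_pair1 q).
have gi := rintegrable_green t x mc (fun z => cos_max _).
rewrite (rintegral_fubini gi) [RHS]rintegral_set_indic.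
apply: (@ae_eq_rintegral _ (measurableTypeR R) R lam).
- apply: (@measurable_rintegral2 _ _ (measurableTypeR R) _ R leb
    (fun z => cos (phase q z + th) * green Psi t x z)).
  exact: rintegrable_measurable gi.
- apply: measurable_funM; last exact: measurable_indic_itv.
  apply: measurable_funM.
    apply: (measurableT_comp (continuous_measurable_fun (@continuous_cos R))).
    by apply: measurable_funD => //; apply: measurable_funM.
  apply: (measurableT_comp (continuous_measurable_fun (@continuous_expR R))).
  by apply: measurable_funB => //; apply: measurable_funM.
- apply: (ae_lebesgue_neq (t := t)) => s st; rewrite indicE.
  have [|] := boolP (s \in `[0, t]%classic) => s0t; last first.
    rewrite mulr0 (_ : (fun y => _) = cst 0) ?rintegral0//; apply/funext => y.
    by rewrite /green /= indicE (negbTE s0t) !mulr0.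
  have ts : 0 < t - s.
    by move: s0t; rewrite inE/= in_itv/= => /andP[_]; rewrite subr_gt0 lt_neqAle st.
  rewrite mulr1; transitivity
      (\int[leb]_y (cos ((q.1 * s + th) + dotp q.2 y) * p (t - s) (x - y))).
    apply: eq_Rintegral => y _; rewrite /green /phase /= indicE s0t mulr1.
    by congr (cos _ * _); ring.
  rewrite (levy_density_cos_phase levyX PsiX densityX)//.
  by congr (cos _ * expR _); ring.
Qed.

End green_fourier.

Section damped_oscillation.
Variable R : realType.
Local Notation lam := (@lebesgue_measure R).

(* The antiderivatives come from the real and imaginary parts of
   exp ((psi + i tau) s). *)
Lemma damped_oscillation (psi tau a t : R) : 0 <= t ->
  let C := \int[lam]_(s in `[0, t]) (cos (tau * s + a) * expR (psi * s - psi * t)) in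
  let S := \int[lam]_(s in `[0, t]) (sin (tau * s + a) * expR (psi * s - psi * t)) in
  psi * C - tau * S = cos (tau * t + a) - cos a * expR (- psi * t) /\
  psi * S + tau * C = sin (tau * t + a) - sin a * expR (- psi * t).
Proof.
move=> t0 C S.
have dE (s : R) : is_derive s (1 : R) (fun s => expR (psi * s + - (psi * t))) (expR (psi * s - psi * t) * psi).
  exact: (is_derive_comp (is_derive_lin _ _ _) (is_derive_expR _)).
have dc (s : R) : is_derive s (1 : R) (fun s => cos (tau * s + a)) (- sin (tau * s + a) * tau).
  exact: (is_derive_comp (is_derive_lin _ _ _) (is_derive_cos _)).
have ds (s : R) : is_derive s (1 : R) (fun s => sin (tau * s + a)) (cos (tau * s + a) * tau).
  exact: (is_derive_comp (is_derive_lin _ _ _) (is_derive_sin _)).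
pose fc s := cos (tau * s + a) * expR (psi * s - psi * t).
pose fs s := sin (tau * s + a) * expR (psi * s - psi * t).
have cE : continuous (fun s : R => expR (psi * s - psi * t)).
  by move=> s; exact: is_derive_continuous (dE s).
have cfc : continuous fc.
  by move=> s; apply: cvgM; [exact: is_derive_continuous (dc s)|exact: cE].
have cfs : continuous fs.
  by move=> s; apply: cvgM; [exact: is_derive_continuous (ds s)|exact: cE].
have int_ (f : R -> R) : continuous f -> lam.-integrable `[0, t] (EFin \o f).
  move=> cf; apply: continuous_compact_integrable; first exact: segment_compact.
  exact: continuous_subspaceT.
have ic := int_ fc cfc; have is_ := int_ fs cfs.
have icp := fun k => @integrableZl _ _ _ lam _ (measurable_itv _) k _ ic.
have isp := fun k => @integrableZl _ _ _ lam _ (measurable_itv _) k _ is_.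
have comb k1 k2 : \int[lam]_(s in `[0, t]) (k1 * fc s + k2 * fs s) = k1 * C + k2 * S.
  rewrite RintegralD//; [|exact: icp|exact: isp].
  by rewrite !RintegralZl.
have cont k1 k2 : continuous (fun s => k1 * fc s + k2 * fs s).
  by move=> s; apply: cvgD; apply: cvgM; [exact: cvg_cst|exact: cfc|exact: cvg_cst|exact: cfs].
have d1 (s : R) : is_derive s (1 : R)
    (fun s => cos (tau * s + a) * expR (psi * s + - (psi * t))) (psi * fc s + - tau * fs s).
  by apply: (is_derive_eq (is_derive_mul (dc s) (dE s))); rewrite /fc /fs; ring.
have d2 (s : R) : is_derive s (1 : R)
    (fun s => sin (tau * s + a) * expR (psi * s + - (psi * t))) (tau * fc s + psi * fs s).
  by apply: (is_derive_eq (is_derive_mul (ds s) (dE s))); rewrite /fc /fs; ring.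
split.
- have -> : psi * C - tau * S = psi * C + - tau * S by ring.
  rewrite -comb (ftc_itvcc t0 d1 (cont _ _)).
  by rewrite !mulr0 subrr expR0 mulr1 !add0r mulNr.
- rewrite [LHS]addrC -comb (ftc_itvcc t0 d2 (cont _ _)).
  by rewrite !mulr0 subrr expR0 mulr1 !add0r mulNr.
Qed.

(** The identities of [damped_oscillation] give no bound where [psi] and [tau] are both near 0;
    there the length of the interval takes over. *)
Lemma damped_oscillation_bound (g : R -> R) (psi t : R) : 0 <= t -> 0 <= psi ->
  continuous g -> (forall s, `|g s| <= 1) ->
  `|\int[lam]_(s in `[0, t]) (g s * expR (psi * s - psi * t))| <= t.
Proof.
move=> t0 psi0 cg g1.
have cE : continuous (fun s : R => expR (psi * s + - (psi * t))).
  move=> s; exact: (is_derive_continuous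
    (is_derive_comp (is_derive_lin _ _ _) (is_derive_expR _))).
have cf : continuous (fun s : R => g s * expR (psi * s - psi * t)).
  by move=> s; apply: cvgM; [exact: cg|exact: cE].
have fi : lam.-integrable `[0, t] (EFin \o (fun s : R => g s * expR (psi * s - psi * t))).
  apply: continuous_compact_integrable; first exact: segment_compact.
  exact: continuous_subspaceT.
have c1 : lam.-integrable `[0, t] (EFin \o (fun=> 1 : R)).
  apply: continuous_compact_integrable; first exact: segment_compact.
  by apply: continuous_subspaceT => s; exact: cvg_cst.
have := @le_normr_Rintegral _ _ R lam _ _ (measurable_itv _) fi.
move=> /le_trans; apply.
apply: (@le_trans _ _ (\int[lam]_(s in `[0, t]) 1)).
  apply: le_Rintegral => //; first exact: (integrable_abse fi).
  move=> s; rewrite /= in_itv/= => /andP[s0 st].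
  rewrite normrM mulr_ile1// ger0_norm ?expR_ge0// -expR0 ler_expR subr_le0.
  by rewrite ler_wpM2l.
rewrite (@Rintegral_cst _ (measurableTypeR R) R lam _ (measurable_itv _)).
by rewrite mul1r [X in fine X]lebesgue_measure_itv/= lte_fin; case: ifP => //=; rewrite subr0.
Qed.

End damped_oscillation.

(** * Integrability against the spectral measure *)

Section almost_everywhere_bound.
Context d (T : measurableType d) (R : realType) (mu : {measure set T -> \bar R}).

Lemma le_rintegrable_ae (f g : T -> R) : measurable_fun setT f -> rintegrable mu g ->
  {ae mu, forall x, `|f x| <= g x} -> rintegrable mu f.
Proof.
move=> mf gi fg; have mg := rintegrable_measurable gi.
apply/integrableP; split; first exact/measurable_EFinP.
apply: (@le_lt_trans _ _ (\int[mu]_x `|(EFin \o g) x|)%E); last first.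
  by have /integrableP[] := gi.
apply: ae_ge0_le_integral => //.
- by apply/measurable_EFinP; exact: measurableT_comp.
- by apply/measurable_EFinP; exact: measurableT_comp.
- by apply: filterS fg => x h _; rewrite lee_fin (le_trans h)// ler_norm.
Qed.

End almost_everywhere_bound.

Section half_line.
Variable R : realType.
Local Notation lam := (@lebesgue_measure R).

Lemma integral_exp_subst_le (f : R -> R) (k C : R) (n : nat) : 0 < k ->
  (forall x, 0 < x -> 0 <= f x) -> (forall x, 0 < x -> {for x, continuous f}) ->
  (forall y, f (expR y) * expR y <= C * expR (- k * `|y|)) ->
  (\int[lam]_(x in `[expR (- n%:R), expR n%:R]) (f x)%:E <=
   (C * \int[lam]_y expR (- k * `|y|))%:E)%E.
Proof.
move=> k0 f0 cf fC; have dE : (@expR R)^`()%classic = @expR R.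
  by apply/funext => x; rewrite derive1E derive_val.
have n0 : - n%:R <= n%:R :> R by rewrite (@le_trans _ _ 0)// oppr_le0.
have ce (x : R) : expR y @[y --> x^'+] --> expR x /\ expR y @[y --> x^'-] --> expR x.
  by split; [apply: cvg_at_right_filter|apply: cvg_at_left_filter]; exact: continuous_expR.
rewrite (@integration_by_substitution_increasing _ (@expR R) f (- n%:R) n%:R)//; last 6 first.
- by move=> x y _ _; rewrite ltr_expR.
- by move=> x _; rewrite dE; exact: continuous_expR.
- by rewrite dE; apply/cvg_ex; exists (expR (- n%:R)); exact: (ce _).1.
- by rewrite dE; apply/cvg_ex; exists (expR n%:R); exact: (ce _).2.
- by split; [|exact: (ce _).1|exact: (ce _).2].
- apply: continuous_in_subspaceT => x; rewrite inE/= in_itv/= => /andP[h _].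
  by apply: cf; exact: lt_le_trans (expR_gt0 _) h.
rewrite dE.
have ei := @rintegrable_exp_norm R k k0; have cei := rintegrableZl C ei.
have C0 : 0 <= C.
  have := fC 0; rewrite normr0 mulr0 expR0 !mulr1; apply: le_trans.
  exact: f0.
apply: (@le_trans _ _ (\int[lam]_(y in `[(- n%:R)%R, n%:R]) (C * expR (- k * `|y|))%:E)%E).
  apply: ge0_le_integral => //.
  - by move=> y _; rewrite lee_fin mulr_ge0 ?expR_ge0// f0// expR_gt0.
  - apply/measurable_EFinP; apply: (@measurable_funS _ _ _ _ setT) => //.
    apply: continuous_measurable_fun => y; apply: cvgM; last exact: continuous_expR.
    apply: (@continuous_comp _ _ _ (@expR R) f); first exact: continuous_expR.
    by apply: cf; exact: expR_gt0.
  - apply: measurable_funS (measurable_int _ cei) => //.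
  - by move=> y _; rewrite lee_fin; exact: fC.
rewrite -rintegralZl// EFin_Rintegral//.
apply: ge0_subset_integral => //.
- exact: (measurable_int _ cei).
- by move=> y _; rewrite lee_fin mulr_ge0 ?expR_ge0.
Qed.

(** With [x = exp y] the behaviours at 0 and at infinity are controlled by a single exponential
    bound in [|y|]. The substitution is made on [[exp (- n), exp n]], and monotone convergence
    exhausts the half-line. *)
Lemma rintegrable_exp_subst (f : R -> R) (k C : R) : 0 < k -> measurable_fun setT f ->
  (forall x, 0 < x -> 0 <= f x) -> (forall x, 0 < x -> {for x, continuous f}) ->
  (forall y, f (expR y) * expR y <= C * expR (- k * `|y|)) ->
  rintegrable lam (fun x => f x * \1_(`]0, +oo[%classic) x).
Proof.
move=> k0 mf f0 cf fC.
have mi : measurable_fun [set: measurableTypeR R] (\1_(`]0, +oo[%classic) : R -> R).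
  by apply: measurable_indic; exact: measurable_itv.
apply: ge0_rintegrable; first exact: measurable_funM.
  move=> x; rewrite indicE; have [xp|] := boolP (x \in `]0, +oo[%classic); last by rewrite mulr0.
  by rewrite mulr1 f0//; move: xp; rewrite inE/= in_itv/= andbT.
pose F (n : nat) : set (measurableTypeR R) := `[expR (- n%:R), expR n%:R]%classic.
have UF : `]0, +oo[%classic = \bigcup_n F n.
  apply/seteqP; split => x /=.
    rewrite in_itv/= andbT => x0; exists (Num.trunc `|ln x|).+1 => //.
    have h : `|ln x| <= (Num.trunc `|ln x|).+1%:R by apply: ltW; exact: truncnS_gt.
    move: h; rewrite ler_norml /F /= in_itv/= => /andP[h1 h2].
    apply/andP; split; first by rewrite -[leRHS]lnK ?posrE// ler_expR.
    by rewrite -[leLHS]lnK ?posrE// ler_expR.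
  move=> [n _]; rewrite /F /= !in_itv/= andbT => /andP[h _].
  exact: lt_le_trans (expR_gt0 _) h.
have mF n : measurable (F n) by exact: measurable_itv.
have lim : (\int[lam]_(x in F n) (f x)%:E)%E @[n --> \oo] -->
    (\int[lam]_(x in \bigcup_n F n) (f x)%:E)%E.
  apply: ge0_nondecreasing_set_cvg_integral => //.
  - apply/nondecreasing_seqP => n; apply/subsetPset => x; rewrite /F /= !in_itv/=.
    move=> /andP[h1 h2]; apply/andP; split.
      by apply: le_trans h1; rewrite ler_expR lerN2 ler_nat.
    by apply: (le_trans h2); rewrite ler_expR ler_nat.
  - move=> n; apply/measurable_EFinP; apply: measurable_funS mf => //.
  - move=> n x; rewrite /F /= in_itv/= => /andP[h _]; rewrite lee_fin f0//.
    exact: lt_le_trans (expR_gt0 _) h.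
apply: (@le_lt_trans _ _ (C * \int[lam]_y expR (- k * `|y|))%:E%E); last exact: ltry.
rewrite (_ : (\int[lam]_x _)%E = (\int[lam]_(x in \bigcup_n F n) (f x)%:E)%E); last first.
  rewrite -UF [RHS]integral_mkcond; apply: eq_integral => x _.
  by rewrite patchE indicE; case: ifPn; rewrite ?mulr1 ?mulr0.
rewrite -(cvg_lim (@ereal_hausdorff R) lim).
apply: lime_le; first by apply/cvg_ex; eexists; exact: lim.
by apply: nearW => n; exact: (integral_exp_subst_le n k0 f0 cf fC).
Qed.

Lemma powR_expR (y p : R) : expR y `^ p = expR (p * y).
Proof. by rewrite /powR gt_eqF ?expR_gt0// expRK. Qed.

Lemma powR_continuous_gt0 (p x : R) : 0 < x -> {for x, continuous (fun y : R => y `^ p)}.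
Proof.
move=> x0; apply: differentiable_continuous; apply/derivable1_diffP.
by apply: derivable_powR; rewrite in_itv/= x0.
Qed.

Lemma ler_powRN (u v e : R) : 0 <= e -> 0 < u -> u <= v -> v `^ (- e) <= u `^ (- e).
Proof.
move=> e_ge u_gt uv; have v_gt := lt_le_trans u_gt uv.
rewrite !powRN lef_pV2 ?posrE ?powR_gt0//.
by apply: ge0_ler_powR => //; rewrite nnegrE ltW.
Qed.

Lemma powR_cauchy_tail (r y : R) : 0 <= r ->
  (1 + expR y ^+ 2) `^ (- r) <= 1 /\ (1 + expR y ^+ 2) `^ (- r) <= expR (- (2 * r) * y).
Proof.
move=> r0; have e0 : 0 <= expR y ^+ 2 by rewrite exprn_ge0 ?expR_ge0.
have e1 : 0 < expR y ^+ 2 by rewrite exprn_gt0 ?expR_gt0.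
have s1 : 1 <= 1 + expR y ^+ 2 by rewrite lerDl.
split.
  by rewrite powRN invf_le1 ?powR_gt0 ?(lt_le_trans ltr01)// -[leLHS](powRr0 (1 + expR y ^+ 2)) ler_powR.
have -> : expR (- (2 * r) * y) = (expR y ^+ 2) `^ (- r).
  by rewrite expr2 -expRD powR_expR; congr expR; ring.
by apply: ler_powRN => //; rewrite lerDr.
Qed.

(* [0 `^ p = 0] for [p != 0], so the singularity at 0 is invisible at the point 0. *)
Lemma rintegrable_powR_cauchy (g r : R) : 0 <= g -> g < 1 -> 0 <= r -> 1 < g + 2 * r ->
  rintegrable lam (fun x => `|x| `^ (- g) * (1 + x ^+ 2) `^ (- r)).
Proof.
move=> g0 g1 r0 gr.
pose f (x : R) := x `^ (- g) * (1 + x ^+ 2) `^ (- r).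
(* In the variable [y], [1 - g] is the decay rate towards [x = 0] and [g + 2 * r - 1] the one
   towards infinity. *)
pose k := Num.min (1 - g) (g + 2 * r - 1).
have k0 : 0 < k by rewrite lt_min !subr_gt0 g1.
have m1 : measurable_fun [set: R] (fun x : R => (1 + x ^+ 2) `^ (- r)).
  apply: (measurableT_comp (measurable_powR (- r))).
  by apply: measurable_funD => //; apply: measurable_funX.
have mf : measurable_fun setT f.
  by apply: measurable_funM => //; exact: measurable_powR.
have fi : rintegrable lam (fun x => f x * \1_(`]0, +oo[%classic) x).
  apply: (@rintegrable_exp_subst f k 1) => //.
  - by move=> x _; rewrite mulr_ge0 ?powR_ge0.
  - move=> x x0; apply: cvgM; first exact: powR_continuous_gt0.
    have h1 : {for x, continuous (fun x : R => 1 + x ^+ 2)}.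
      by apply: cvgD; [exact: cvg_cst|exact: exprn_continuous].
    have p1 : 0 < 1 + x ^+ 2 by rewrite ltr_pwDl// sqr_ge0.
    exact: (@continuous_comp R R R (fun x : R => 1 + x ^+ 2) (fun y => y `^ (- r)) x h1
      (powR_continuous_gt0 p1)).
  - move=> y; rewrite mul1r /f powR_expR.
    have [h1 h2] := powR_cauchy_tail y r0; have [y0|y0] := leP 0 y.
    + apply: (@le_trans _ _ (expR (- g * y) * expR (- (2 * r) * y) * expR y)).
        by rewrite ler_wpM2r ?expR_ge0// ler_wpM2l ?expR_ge0.
      rewrite -!expRD ler_expR ger0_norm//.
      have : k * y <= (g + 2 * r - 1) * y by rewrite ler_wpM2r// ge_min lexx orbT.
      lra.
    + apply: (@le_trans _ _ (expR (- g * y) * 1 * expR y)).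
        by rewrite ler_wpM2r ?expR_ge0// ler_wpM2l ?expR_ge0.
      rewrite mulr1 -!expRD ler_expR ltr0_norm//.
      have : k * - y <= (1 - g) * - y by rewrite ler_wpM2r ?ge_min ?lexx// oppr_ge0 ltW.
      lra.
have fo := rintegrable_opp fi.
apply: (le_rintegrable_ae _ (rintegrableD fi fo)).
  apply: measurable_funM => //.
  exact: (measurableT_comp (measurable_powR (- g)) (@normr_measurable R setT)).
apply: (ae_lebesgue_neq (t := 0)) => x x0.
rewrite ger0_norm ?mulr_ge0 ?powR_ge0// /f !indicE sqrrN.
have pE (z : R) : (z \in `]0, +oo[%classic) = (0 < z).
  by apply/idP/idP; rewrite inE/= in_itv/= andbT.
rewrite !pE oppr_gt0; case: (ltgtP x 0) x0 => // h _.
  by rewrite ltr0_norm// mulr0 mulr1 add0r.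
by rewrite gtr0_norm// mulr0 mulr1 addr0.
Qed.

End half_line.

Section gamma_positive.
Variable R : realType.
Local Notation lam := (@lebesgue_measure R).

(** Convergence comes first, because a divergent [Rintegral] is 0 by convention; then the integrand
    is at least [exp (-1)] on []0, 1]]. The range of [x] covers the arguments [H - 1/2] and [1 - H]
    in [bH]. *)
Lemma Gamma_gt0 (x : R) : 0 < x -> x < 1 -> 0 < Gamma x.
Proof.
move=> x0 x1; pose f (t : R) := t `^ (x - 1) * expR (- t).
have mf : measurable_fun setT f.
  by apply: measurable_funM; [exact: measurable_powR|apply: measurableT_comp].
pose k := Num.min x (1 - x).
have k0 : 0 < k by rewrite lt_min x0 subr_gt0.
have fi : rintegrable lam (fun t => f t * \1_(`]0, +oo[%classic) t).
  apply: (@rintegrable_exp_subst _ f k 1) => //.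
  - by move=> t _; rewrite mulr_ge0 ?powR_ge0 ?expR_ge0.
  - move=> t t0; apply: cvgM; first exact: powR_continuous_gt0.
    apply: (@continuous_comp R R R (fun t : R => - t) (@expR R) t).
      by apply: cvgN; exact: cvg_id.
    exact: continuous_expR.
  - move=> y; rewrite mul1r /f powR_expR -!expRD ler_expR.
    have := expR_ge1Dx y; have [y0|y0] := leP 0 y.
    + rewrite ger0_norm//; have : k * y <= (1 - x) * y by rewrite ler_wpM2r// ge_min lexx orbT.
      lra.
    + move=> _; have := expR_ge0 y; rewrite ltr0_norm//.
      have : k * - y <= x * - y by rewrite ler_wpM2r ?ge_min ?lexx// oppr_ge0 ltW.
      lra.
have -> : Gamma x = \int[lam]_t (f t * \1_(`]0, +oo[%classic) t).
  by rewrite /Gamma rintegral_set_indic.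
have i1 : rintegrable lam (\1_(`]0, 1]%classic)).
  apply: ge0_rintegrable; first by apply: measurable_indic; exact: measurable_itv.
    by move=> s; rewrite indicE.
  rewrite (@integral_indic _ (measurableTypeR R) R lam setT measurableT _ (measurable_itv _)) setIT.
  by rewrite [X in (X < _)%E]lebesgue_measure_itv/= lte_fin ltr01 -EFinD ltry.
apply: (@lt_le_trans _ _ (\int[lam]_t (expR (- 1) * \1_(`]0, 1]%classic) t))).
  rewrite rintegralZl// mulr_gt0 ?expR_gt0// /Rintegral.
  rewrite (@integral_indic _ (measurableTypeR R) R lam setT measurableT _ (measurable_itv _)) setIT.
  by rewrite [X in fine X]lebesgue_measure_itv/= lte_fin ltr01 /= subr0.
apply: le_rintegral => //; first exact: rintegrableZl.
move=> t; rewrite !indicE.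
have pE : (t \in `]0, +oo[%classic) = (0 < t).
  by apply/idP/idP; rewrite inE/= in_itv/= andbT.
have qE : (t \in `]0, 1]%classic) = (0 < t <= 1).
  by apply/idP/idP; rewrite inE/= in_itv.
rewrite pE qE; have [t0|_] /= := ltP 0 t; last by rewrite !mulr0.
rewrite mulr1; have [t1|_] := leP t 1; last first.
  by rewrite mulr0 mulr_ge0 ?powR_ge0 ?expR_ge0.
rewrite mulr1 /f -[leLHS]mul1r ler_pM ?expR_ge0 ?ler_expR ?lerN2//.
rewrite -[leLHS](powRr0 t); apply: ger_powR; first by rewrite t0.
by rewrite subr_le0 ltW.
Qed.

Lemma cHd_gt0 (d : nat) (H : R) : 2^-1 <= H -> H < 1 -> 0 < cHd d H.
Proof.
move=> H2 H1; have pi0 : 0 < 2 * pi :> R by rewrite mulr_gt0 ?pi_gt0.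
rewrite /cHd mulr_gt0 ?invr_gt0 ?exprn_gt0// /bH.
case: eqP => [_|/eqP Hne]; first by rewrite invr_gt0.
have Hgt : 2^-1 < H by rewrite lt_neqAle eq_sym Hne.
rewrite mulr_gt0//; last by rewrite divr_gt0// Gamma_gt0//; lra.
rewrite mulr_gt0//; first by rewrite mulr_gt0//; lra.
by rewrite invr_gt0 mulr_gt0 ?powR_gt0 ?sqrtr_gt0 ?pi_gt0.
Qed.

End gamma_positive.

Section euclidean_norm.
Variables (R : realType) (d : nat).
Implicit Type x : 'rV[R]_d.

Lemma coord_le_enorm x j : `|x ord0 j| <= enorm x.
Proof.
rewrite /enorm -sqrtr_sqr ler_sqrt; last by apply: sumr_ge0 => i _; rewrite -expr2 sqr_ge0.
rewrite /dotp (bigD1 j)//= -expr2 lerDl.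
by apply: sumr_ge0 => i _; rewrite -expr2 sqr_ge0.
Qed.

Lemma enorm_ge0 x : 0 <= enorm x. Proof. exact: sqrtr_ge0. Qed.

(** Comparison with the largest coordinate works for every exponent [g >= 0]. The sum of coordinate
    powers is what makes the later integrals factor. *)
Lemma enorm_powR_le x (g : R) : (0 < d)%N -> 0 <= g ->
  enorm x `^ g <= d%:R `^ g * \sum_(j < d) `|x ord0 j| `^ g.
Proof.
move=> d0 g0; pose j0 := Ordinal d0.
pose j := [arg max_(i > j0) `|x ord0 i|]%O.
have jmax i : `|x ord0 i| <= `|x ord0 j|.
  by rewrite /j; case: arg_maxP => // k _; apply.
have le1 : enorm x <= d%:R * `|x ord0 j|.
  have dR : 1 <= d%:R :> R by rewrite ler1n.
  rewrite /enorm -[leRHS]ger0_norm ?mulr_ge0// -sqrtr_sqr ler_sqrt ?sqr_ge0// exprMn.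
  apply: (@le_trans _ _ (\sum_(i < d) `|x ord0 j| ^+ 2)).
    apply: ler_sum => i _; rewrite -expr2 -(real_normK (num_real (x ord0 i))).
    by rewrite lerXn2r ?nnegrE.
  rewrite sumr_const card_ord -[_ *+ d]mulr_natl ler_wpM2r ?sqr_ge0//.
  by rewrite expr2 ler_peMl// (le_trans ler01).
have h1 : enorm x `^ g <= (d%:R * `|x ord0 j|) `^ g.
  by apply: ge0_ler_powR => //; rewrite nnegrE ?enorm_ge0// mulr_ge0.
apply: (le_trans h1); rewrite powRM// ler_wpM2l ?powR_ge0//.
by rewrite (bigD1 j)//= lerDl; apply: sumr_ge0 => i _; exact: powR_ge0.
Qed.

End euclidean_norm.

Section null_hyperplanes.
Variable R : realType.

Lemma measurable_coord0 d (j : 'I_d) : measurable [set y : 'rV[R]_d | y ord0 j = 0].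
Proof.
by have := measurable_coord j measurableT (measurable_set1 (0 : R)); rewrite setTI.
Qed.

Lemma lebesgue_rV_coord0 d (i : 'I_d) :
  lebesgue_rV R d [set x : 'rV[R]_d | x ord0 i = 0] = 0%E.
Proof.
elim: d i => [[]//|n IH] i; case: (unliftP ord0 i) => [k ->|->].
- have E : @rV_cons R n @^-1` [set x : 'rV[R]_n.+1 | x ord0 (lift ord0 k) = 0] =
      setT `*` [set y : 'rV[R]_n | y ord0 k = 0].
    by apply/seteqP; split => [[a y] /= |[a y] /= [_ +]]; rewrite rV_consS.
  transitivity ((@lebesgue_measure R \x lebesgue_rV R n)%E (@rV_cons R n @^-1`
    [set x : 'rV[R]_n.+1 | x ord0 (lift ord0 k) = 0])); first by [].
  rewrite E product_measure1E//; last exact: measurable_coord0.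
  by rewrite (IH k) mule0.
- have E : @rV_cons R n @^-1` [set x : 'rV[R]_n.+1 | x ord0 ord0 = 0] = [set 0] `*` setT.
    by apply/seteqP; split => [[a y] /= |[a y] /= [+ _]]; rewrite rV_cons0.
  transitivity ((@lebesgue_measure R \x lebesgue_rV R n)%E (@rV_cons R n @^-1`
    [set x : 'rV[R]_n.+1 | x ord0 ord0 = 0])); first by [].
  by rewrite E product_measure1E// [X in (X * _)%E]lebesgue_measure_set1 mul0e.
Qed.

(** The power bounds on [Psi] and [h] hold off the origin, and the product bounds use negative
    powers of the coordinates and of [tau], which [powR] sets to 0 at 0. Dominations are therefore
    proved off the coordinate hyperplanes. *)
Lemma ae_coord_neq0 d (Q : R * 'rV[R]_d -> Prop) :
  (forall q : R * 'rV[R]_d, q.1 != 0 -> (forall j, q.2 ord0 j != 0) -> Q q) ->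
  {ae @lebesgue_tx R d, forall q, Q q}.
Proof.
move=> H; pose F := @ae_filter_ringOfSetsType _ (measurableTypeR R * 'rV[R]_d)%type R (@lebesgue_tx R d).
have n1 : {ae @lebesgue_tx R d, forall q : R * 'rV[R]_d, q.1 != 0}.
  exists ([set 0] `*` setT); split.
  - exact: measurableX.
  - transitivity (@lebesgue_measure R [set 0%R] * lebesgue_rV R d setT)%E.
      exact: product_measure1E.
    by rewrite lebesgue_measure_set1 mul0e.
  - by move=> q /= /negP; rewrite negbK => /eqP.
have n2 : {ae @lebesgue_tx R d, forall q : R * 'rV[R]_d, forall j, q.2 ord0 j != 0}.
  apply: (@filter_forall _ _ _ _ F) => j.
  exists (setT `*` [set y : 'rV[R]_d | y ord0 j = 0]); split.
  - by apply: measurableX => //; exact: measurable_coord0.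
  - transitivity (@lebesgue_measure R setT * lebesgue_rV R d [set y : 'rV[R]_d | y ord0 j = 0%R])%E.
      by apply: product_measure1E => //; exact: measurable_coord0.
    by rewrite lebesgue_rV_coord0 mule0.
  - by move=> q /= /negP; rewrite negbK => /eqP.
exact: (@filterS2 _ _ F _ _ _ (fun q h1 h2 => H q h1 h2) n1 n2).
Qed.

End null_hyperplanes.

Section green_spectral.
Context (R : realType) (d : nat) (dX : measure_display) (OmegaX : measurableType dX).
Context (PX : probability OmegaX R) (X : R -> OmegaX -> 'rV[R]_d) (Psi : 'rV[R]_d -> R).
Hypotheses (levyX : symmetric_levy PX X) (PsiX : char_exponent PX X Psi)
  (densityX : has_levy_density PX X Psi).
Local Notation lam := (@lebesgue_measure R).
Local Notation tx := (@lebesgue_tx R d).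

Lemma green_fourier_parts t x q : 0 <= t ->
  let psi := Psi q.2 in let tau := q.1 in let a := dotp q.2 x in
  let C := complex.Re (fourier (green Psi t x) q.1 q.2) in
  let S := - complex.Im (fourier (green Psi t x) q.1 q.2) in
  psi * C - tau * S = cos (tau * t + a) - cos a * expR (- psi * t) /\
  psi * S + tau * C = sin (tau * t + a) - sin a * expR (- psi * t).
Proof.
move=> t0 psi tau a C S.
have CE : C = \int[lam]_(s in `[0, t]) (cos (tau * s + a) * expR (psi * s - psi * t)).
  rewrite /C Re_fourier.
  have := rintegral_green levyX PsiX densityX t x q 0.
  under eq_Rintegral do rewrite addr0.
  move=> ->; apply: eq_Rintegral => s _; by rewrite addr0.
have SE : S = \int[lam]_(s in `[0, t]) (sin (tau * s + a) * expR (psi * s - psi * t)).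
  rewrite /S Im_fourier.
  have := rintegral_green levyX PsiX densityX t x q (- (pi / 2)).
  have sE (y : R) : cos (y - pi / 2) = sin y.
    by rewrite cosB cos_pihalf sin_pihalf mulr0 add0r mulr1.
  under eq_Rintegral do rewrite sE.
  move=> E; rewrite [RHS](_ : _ = \int[lam]_(s in `[0, t])
      (cos (tau * s + (a - pi / 2)) * expR (psi * s - psi * t))); last first.
    by apply: eq_Rintegral => s _; rewrite addrA sE.
  rewrite -E; under eq_Rintegral do rewrite mulNr -mulN1r.
  have gi : rintegrable tx (fun p => sin (phase q p) * green Psi t x p).
    apply: (rintegrable_green levyX PsiX densityX) => [|p]; last exact: sin_max.
    apply: measurableT_comp; first by apply: continuous_measurable_fun; exact: continuous_sin.
    by have := measurableT_comp (@measurable_phase R d) (measurable_pair1 q).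
  by rewrite rintegralZl// mulN1r opprK.
rewrite CE SE; exact: damped_oscillation.
Qed.

(** The term 1 of the last factor is paid by [2 t^2], each part of the transform being at most [t].
    The terms [Psi^2 + tau^2] become, by [green_fourier_parts], the sum of two squares of numbers at
    most 2, which gives 8. *)
Lemma green_fourier_bound t x q : 0 <= t -> 0 <= Psi q.2 ->
  (complex.Re (fourier (green Psi t x) q.1 q.2) ^+ 2 +
   complex.Im (fourier (green Psi t x) q.1 q.2) ^+ 2) * (1 + Psi q.2 ^+ 2 + q.1 ^+ 2) <= 2 * t ^+ 2 + 8.
Proof.
move=> t0 psi0; have := green_fourier_parts x q t0; cbv zeta.
set F := fourier _ _ _; set C := complex.Re F; set D := complex.Im F; set psi := Psi q.2.
set tau := q.1; set a := dotp q.2 x => -[E1 E2].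
have h1 : `|C| <= t.
  rewrite /C /F Re_fourier.
  have := rintegral_green levyX PsiX densityX t x q 0.
  under eq_Rintegral do rewrite addr0.
  move=> ->; apply: (@damped_oscillation_bound R (fun s => cos (q.1 * s + (dotp q.2 x + 0)))) => //.
    move=> s; exact: (is_derive_continuous (is_derive_comp (is_derive_lin _ _ _) (is_derive_cos _))).
  by move=> s; exact: cos_max.
have h2 : `|D| <= t.
  rewrite /D /F Im_fourier.
  have := rintegral_green levyX PsiX densityX t x q (pi / 2).
  have sE (y : R) : cos (y + pi / 2) = - sin y.
    by rewrite cosD cos_pihalf sin_pihalf mulr0 sub0r mulr1.
  under eq_Rintegral do rewrite sE.
  move=> ->; apply: (@damped_oscillation_bound R (fun s => cos (q.1 * s + (dotp q.2 x + pi / 2)))) => //.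
    move=> s; exact: (is_derive_continuous (is_derive_comp (is_derive_lin _ _ _) (is_derive_cos _))).
  by move=> s; exact: cos_max.
have sqr_le (y b : R) : `|y| <= b -> y ^+ 2 <= b ^+ 2.
  by move=> yb; rewrite -(real_normK (num_real y)) lerXn2r ?nnegrE// (le_trans _ yb).
have e1 : 0 <= expR (- psi * t) <= 1.
  by rewrite expR_ge0 -expR0 ler_expR mulNr oppr_le0 mulr_ge0.
have two (u v k : R) : `|u| <= 1 -> `|v| <= 1 -> 0 <= k <= 1 -> `|u - v * k| <= 2.
  move=> u1 v1 /andP[k0 k1]; apply: (le_trans (ler_normB _ _)).
  rewrite -[leRHS]/(1 + 1) lerD// normrM mulr_ile1//.
  by rewrite ger0_norm.
have h3 : (psi * C - tau * - D) ^+ 2 <= 2 ^+ 2.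
  by rewrite sqr_le// E1; apply: two => //; exact: cos_max.
have h4 : (psi * - D + tau * C) ^+ 2 <= 2 ^+ 2.
  by rewrite sqr_le// E2; apply: two => //; exact: sin_max.
have hC := sqr_le _ _ h1; have hD := sqr_le _ _ h2.
have E : (C ^+ 2 + D ^+ 2) * (1 + psi ^+ 2 + tau ^+ 2) = C ^+ 2 + D ^+ 2 +
  (psi * C - tau * - D) ^+ 2 + (psi * - D + tau * C) ^+ 2 by ring.
rewrite E; lra.
Qed.

Variables (H : R) (h : 'rV[R]_d -> R) (cPsi Ch alpha beta : R).
Hypotheses (d_ge1 : (1 <= d)%N) (H_ge : 2^-1 <= H) (H_lt1 : H < 1).
Hypotheses (h_meas : measurable_fun setT h) (h_ge0 : forall xi, 0 <= h xi).
Hypotheses (cPsi_gt0 : 0 < cPsi) (Ch_gt0 : 0 < Ch) (alpha_gt0 : 0 < alpha)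
  (beta_gt0 : 0 < beta) (beta_ltd : beta < d%:R).
Hypothesis Psi_lower : forall xi, xi != 0 -> cPsi * enorm xi `^ alpha <= Psi xi.
Hypothesis h_upper : forall xi, xi != 0 -> h xi <= Ch * enorm xi `^ (- beta).
Hypothesis theta_gt0 : 0 < H - (d%:R - beta) / (2 * alpha).

(* [s] lies strictly between [1 - H], for integrability in tau, and
   [1 - (d - beta) / (2 alpha)], for integrability in xi. *)
Let s := 1 - H + (H - (d%:R - beta) / (2 * alpha)) / 2.
(** [r] is the exponent left to each coordinate when [(1 + Psi^2)^(- (1 - s))] is bounded by a
    product, and [kap] is the constant of [exponent_lower]. *)
Let r := alpha * (1 - s) / d%:R.
Let kap := Num.min 1 (cPsi ^+ 2) / 2 `^ alpha.

Let d0 : 0 < d%:R :> R. Proof. by rewrite ltr0n. Qed.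
Let q0 : 0 < (d%:R - beta) / (2 * alpha).
Proof. by rewrite divr_gt0 ?subr_gt0// mulr_gt0. Qed.
Let s0 : 0 < s. Proof. by rewrite /s; move: theta_gt0 H_lt1; lra. Qed.
Let s1 : s < 1. Proof. by rewrite /s; move: theta_gt0 q0 H_ge; lra. Qed.
Let kap0 : 0 < kap.
Proof. by rewrite divr_gt0 ?powR_gt0// lt_min ltr01 exprn_gt0. Qed.

(** Cutting a power into [d] equal ones and bounding each by a different coordinate yields a product
    function of [xi]. *)
Let powR_const_prod (y e : R) : 0 <= y -> y `^ e = \prod_(j < d) y `^ (e / d%:R).
Proof.
move=> y0; rewrite prodr_const card_ord -powR_mulrn ?powR_ge0// -powRrM.
by rewrite divfK// gt_eqF.
Qed.

Let norm_powR_lower (z : R) : (1 + z ^+ 2) `^ alpha <= 2 `^ alpha * (1 + `|z| `^ (2 * alpha)).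
Proof.
have z2 : `|z| `^ (2 * alpha) = (z ^+ 2) `^ alpha.
  by rewrite powRrM -(real_normK (num_real z)) -powR_mulrn.
rewrite z2; have zz := sqr_ge0 z.
have [z1|/ltW z1] := leP (z ^+ 2) 1.
  apply: (@le_trans _ _ (2 `^ alpha)).
    by apply: ge0_ler_powR; rewrite ?nnegrE ?(ltW alpha_gt0)//; lra.
  by rewrite ler_peMr ?powR_ge0// lerDl powR_ge0.
apply: (@le_trans _ _ ((2 * z ^+ 2) `^ alpha)).
  by apply: ge0_ler_powR; rewrite ?nnegrE ?(ltW alpha_gt0)//; lra.
by rewrite powRM// ler_wpM2l ?powR_ge0// lerDr.
Qed.

Let exponent_lower (xi : 'rV[R]_d) j : xi != 0 -> kap * (1 + xi ord0 j ^+ 2) `^ alpha <= 1 + Psi xi ^+ 2.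
Proof.
move=> xi0; have lowj := norm_powR_lower (xi ord0 j).
have e0 := enorm_ge0 xi.
have P0 : 0 <= cPsi * enorm xi `^ alpha by rewrite mulr_ge0 ?powR_ge0// ltW.
have h1 : (cPsi * enorm xi `^ alpha) ^+ 2 <= Psi xi ^+ 2.
  rewrite lerXn2r ?nnegrE//; last exact: Psi_lower.
  by apply: le_trans (Psi_lower xi0).
have h2 : cPsi ^+ 2 * `|xi ord0 j| `^ (2 * alpha) <= Psi xi ^+ 2.
  apply: le_trans h1; rewrite exprMn ler_wpM2l ?sqr_ge0//.
  rewrite -powR_mulrn ?powR_ge0// -powRrM [alpha * _]mulrC; apply: ge0_ler_powR; rewrite ?nnegrE//.
    by rewrite mulr_ge0// ltW.
  exact: coord_le_enorm.
rewrite /kap; set m := Num.min _ _; have m0 : 0 <= m by rewrite le_min ler01 sqr_ge0.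
have m1 : m <= 1 by rewrite ge_min lexx.
have m2 : m <= cPsi ^+ 2 by rewrite ge_min lexx orbT.
have p2 : 0 < 2 `^ alpha :> R by rewrite powR_gt0.
rewrite mulrAC ler_pdivrMr//; apply: (le_trans (ler_wpM2l m0 lowj)).
rewrite mulrCA [leRHS]mulrC ler_wpM2l ?(ltW p2)// mulrDr mulr1 lerD//.
by apply: le_trans h2; rewrite ler_wpM2r ?powR_ge0.
Qed.

Let f (z : R) := `|z| `^ (- (beta / d%:R)) * (1 + z ^+ 2) `^ (- r).

Let rintegrable_f : rintegrable (lebesgue_rV R d) (fun xi => \prod_(j < d) f (xi ord0 j)).
Proof.
have [] // := @rintegrable_rV_prod R d (fun=> f) _ => j.
apply: rintegrable_powR_cauchy.
- by rewrite divr_ge0// ltW.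
- by rewrite ltr_pdivrMr// mul1r.
- rewrite divr_ge0//; apply: mulr_ge0; [exact: ltW|rewrite subr_ge0; exact: ltW].
(* The exponent condition [beta / d + 2 r > 1] amounts to [(d - beta) / (2 alpha) < 1 - s], the
   upper constraint on [s]. *)
- rewrite /r; have : (d%:R - beta) / (2 * alpha) < 1 - s by rewrite /s; move: theta_gt0; lra.
  rewrite ltr_pdivrMr ?mulr_gt0// => hs.
  rewrite mulrA -mulrDl ltr_pdivlMr// mul1r; lra.
Qed.

Let spatial_bound (xi : 'rV[R]_d) : (forall j, xi ord0 j != 0) ->
  h xi * (1 + Psi xi ^+ 2) `^ (- (1 - s)) <=
  Ch * kap `^ (- (1 - s)) * \prod_(j < d) f (xi ord0 j).
Proof.
move=> xij; have xi0 : xi != 0.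
  by apply/eqP => xiE; have := xij (Ordinal d_ge1); rewrite xiE mxE eqxx.
have e0 := enorm_ge0 xi.
have e1 : 0 < enorm xi.
  by apply: lt_le_trans (coord_le_enorm xi (Ordinal d_ge1)); rewrite normr_gt0.
have D1 : 0 < 1 + Psi xi ^+ 2 by rewrite ltr_pwDl// sqr_ge0.
have bd0 : 0 <= beta / d%:R by rewrite divr_ge0// ltW.
have sd0 : 0 <= (1 - s) / d%:R by rewrite divr_ge0// subr_ge0 ltW.
have p1 : enorm xi `^ (- beta) <= \prod_(j < d) `|xi ord0 j| `^ (- (beta / d%:R)).
  rewrite powR_const_prod//; apply: ler_prod => j _; rewrite powR_ge0 mulNr.
  by apply: ler_powRN => //; [rewrite normr_gt0|exact: coord_le_enorm].
have p2 : (1 + Psi xi ^+ 2) `^ (- (1 - s)) <=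
    kap `^ (- (1 - s)) * \prod_(j < d) (1 + xi ord0 j ^+ 2) `^ (- r).
  rewrite powR_const_prod ?(ltW D1)// [kap `^ _]powR_const_prod ?(ltW kap0)// -big_split /=.
  apply: ler_prod => j _; rewrite powR_ge0 mulNr.
  have z0 : 0 < 1 + xi ord0 j ^+ 2 by rewrite ltr_pwDl// sqr_ge0.
  have -> : (1 + xi ord0 j ^+ 2) `^ (- r) = ((1 + xi ord0 j ^+ 2) `^ alpha) `^ (- ((1 - s) / d%:R)).
    by rewrite -powRrM /r; congr (_ `^ _); ring.
  rewrite -powRM ?powR_ge0 ?(ltW kap0)//.
  apply: ler_powRN => //; last exact: exponent_lower.
  by rewrite mulr_gt0 ?powR_gt0.
apply: (@le_trans _ _ ((Ch * \prod_(j < d) `|xi ord0 j| `^ (- (beta / d%:R))) *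
    (kap `^ (- (1 - s)) * \prod_(j < d) (1 + xi ord0 j ^+ 2) `^ (- r)))).
  apply: ler_pM; rewrite ?powR_ge0//.
  by apply: (le_trans (h_upper xi0)); rewrite ler_wpM2l// ltW.
by rewrite big_split /= le_eqVlt; apply/orP; left; apply/eqP; ring.
Qed.

(** The condition [theta_gt0] is exactly what leaves room for an exponent [s] serving both [tau] and
    [xi], so that the squared transform is dominated by an integrable product. *)
Lemma green_spectral_L2 t x : 0 <= t -> spectral_L2 H h (green Psi t x).
Proof.
move=> t0; pose M := 2 * t ^+ 2 + 8.
have M0 : 0 <= M by rewrite addr_ge0// mulr_ge0// sqr_ge0.
pose K := M * (Ch * kap `^ (- (1 - s))).
have K0 : 0 <= K by rewrite !mulr_ge0 ?powR_ge0// ltW.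
pose G (q : R * 'rV[R]_d) := K * (`|q.1| `^ (- (2 * H - 1)) * (1 + q.1 ^+ 2) `^ (- s) *
   \prod_(j < d) f (q.2 ord0 j)).
have Gi : rintegrable tx G.
  apply: rintegrableZl.
  apply: (@rintegrableX _ _ (measurableTypeR R) _ R lam (lebesgue_rV R d)
    (fun y => `|y| `^ (- (2 * H - 1)) * (1 + y ^+ 2) `^ (- s)) _ _ rintegrable_f).
  apply: rintegrable_powR_cauchy; rewrite ?(ltW s0)//.
  - by move: H_ge; lra.
  - by move: H_lt1; lra.
  - by rewrite /s; move: theta_gt0; lra.
have mg := measurable_green levyX PsiX t x.
have bound (q : R * 'rV[R]_d) : q.1 != 0 -> (forall j, q.2 ord0 j != 0) ->
    specRe H h (green Psi t x) q ^+ 2 + specIm H h (green Psi t x) q ^+ 2 <= G q.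
  move=> tau0 xij; rewrite /specRe /specIm !exprMn sqr_sqrtr ?spectral_weight_ge0// -mulrDr.
  have xi0 : q.2 != 0.
    by apply/eqP => xiE; have := xij (Ordinal d_ge1); rewrite xiE mxE eqxx.
  have psi0 : 0 <= Psi q.2.
    by apply: le_trans (Psi_lower xi0); rewrite mulr_ge0 ?powR_ge0// ltW.
  have := green_fourier_bound x t0 psi0.
  set F2 := (_ ^+ 2 + _ ^+ 2) => FM.
  have A0 : 0 < 1 + Psi q.2 ^+ 2 + q.1 ^+ 2.
    by rewrite -addrA ltr_pwDl// addr_ge0 ?sqr_ge0.
  have F2M : F2 <= M * ((1 + q.1 ^+ 2) `^ (- s) * (1 + Psi q.2 ^+ 2) `^ (- (1 - s))).
    move: FM; rewrite -ler_pdivlMr// => /le_trans; apply; rewrite ler_wpM2l//.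
    (* Splitting the inverse into powers [- s] and [- (1 - s)] lets one factor keep only [tau] and
       the other only [Psi]. *)
    have -> : (1 + Psi q.2 ^+ 2 + q.1 ^+ 2)^-1 =
        (1 + Psi q.2 ^+ 2 + q.1 ^+ 2) `^ (- s) * (1 + Psi q.2 ^+ 2 + q.1 ^+ 2) `^ (- (1 - s)).
      rewrite -powRD; last by rewrite (gt_eqF A0) implybT.
      by rewrite -(powR_inv1 (ltW A0)); congr (_ `^ _); ring.
    have q2 := sqr_ge0 q.1; have P2 := sqr_ge0 (Psi q.2).
    apply: ler_pM; rewrite ?powR_ge0//; apply: ler_powRN; rewrite ?(ltW s0) ?subr_ge0 ?(ltW s1)//; lra.
  apply: (le_trans (ler_wpM2l (spectral_weight_ge0 _ h_ge0 _) F2M)).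
  rewrite /G /K /spectral_weight (_ : 1 - 2 * H = - (2 * H - 1)); last by ring.
  have := ler_wpM2l (_ : 0 <= M * (`|q.1| `^ (- (2 * H - 1)) * (1 + q.1 ^+ 2) `^ (- s))) (spatial_bound xij).
  have nn : 0 <= M * (`|q.1| `^ (- (2 * H - 1)) * (1 + q.1 ^+ 2) `^ (- s)).
    by rewrite !mulr_ge0 ?powR_ge0.
  move=> /(_ nn); congr (_ <= _); ring.
have m1 := measurable_specRe H h_meas mg; have m2 := measurable_specIm H h_meas mg.
split; split => //.
- apply: (@le_rintegrable_ae _ (measurableTypeR R * 'rV[R]_d)%type R tx
    (fun q => specRe H h (green Psi t x) q ^+ 2) G _ Gi); first exact: measurable_funX.
  apply: ae_coord_neq0 => q tau0 xij.
  rewrite ger0_norm ?sqr_ge0//; apply: le_trans (bound q tau0 xij).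
  by rewrite lerDl sqr_ge0.
- apply: (@le_rintegrable_ae _ (measurableTypeR R * 'rV[R]_d)%type R tx
    (fun q => specIm H h (green Psi t x) q ^+ 2) G _ Gi); first exact: measurable_funX.
  apply: ae_coord_neq0 => q tau0 xij.
  rewrite ger0_norm ?sqr_ge0//; apply: le_trans (bound q tau0 xij).
  by rewrite lerDr sqr_ge0.
Qed.

End green_spectral.

(** * The pairing estimate *)

Section kernel_rV.
Variables (R : realType) (K kq : R -> R).
Local Notation lam := (@lebesgue_measure R).
Hypotheses (mK : measurable_fun setT K) (Ki : rintegrable lam K)
  (Keven : forall x, K (- x) = K x)
  (Kq : forall s, \int[lam]_x (K x * cos (x * s)) = kq s).

Lemma rintegrable_kernel_rV d (e : R) : 0 < e ->
  rintegrable (lebesgue_rV R d) (fun xi => \prod_(j < d) K (e * xi ord0 j)).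
Proof.
move=> e0; have [] // := @rintegrable_rV_prod R d (fun _ x => K (e * x)) _ => _.
exact: rintegrable_kernel_scaled.
Qed.

Lemma measurable_kernel_rV d (e : R) :
  measurable_fun setT (fun xi : 'rV[R]_d => \prod_(j < d) K (e * xi ord0 j)).
Proof.
apply: measurable_prod => j _; apply: (measurableT_comp mK).
by apply: measurable_funM => //; exact: measurable_coord.
Qed.

Lemma kernel_cos_rV d (e : R) (z : 'rV[R]_d) (th : R) : 0 < e ->
  \int[lebesgue_rV R d]_xi ((\prod_(j < d) K (e * xi ord0 j)) * cos (dotp xi z + th)) =
  cos th * \prod_(j < d) (e^-1 * kq (z ord0 j / e)).
Proof.
move=> e0; elim: d z th => [|d IH] z th.
  rewrite big_ord0 mulr1; under eq_Rintegral do rewrite big_ord0 mul1r /dotp big_ord0 add0r.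
  rewrite Rintegral_cst; last exact: measurableT.
  by rewrite [X in fine X]/= [X in fine X]diracT mulr1.
have ki := @rintegrable_kernel_rV d.+1 e e0.
have mc : measurable_fun setT (fun xi : 'rV[R]_d.+1 => cos (dotp xi z + th)).
  apply: measurable_cos_fun; apply: measurable_funD => //.
  by have := measurableT_comp (@measurable_dotp R d.+1) (measurable_pair2 z).
have fi : rintegrable (lebesgue_rV R d.+1)
    (fun xi => (\prod_(j < d.+1) K (e * xi ord0 j)) * cos (dotp xi z + th)).
  apply: (@le_rintegrable _ _ _ (lebesgue_rV R d.+1) _ (fun xi => `|\prod_(j < d.+1) K (e * xi ord0 j)|)).
  - by apply: measurable_funM => //; exact: measurable_kernel_rV.
  - by move=> xi; rewrite normrM ler_piMr// cos_max.
  - exact: rintegrable_norm.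
rewrite (rintegral_rV_succ fi).
have fi2 := (rintegrable_rV_succ (rintegrable_measurable fi)).1 fi.
rewrite (rintegral_fubini fi2).
pose z' : 'rV[R]_d := (rV_uncons z).2.
transitivity (\int[lam]_a (K (e * a) * cos (a * z ord0 ord0 + th)) *
    \prod_(j < d) (e^-1 * kq (z' ord0 j / e))).
  rewrite mulrC -rintegralZl; last first.
    apply: (@le_rintegrable _ _ _ lam _ (fun a => `|K (e * a)|)).
    - apply: measurable_funM; first by apply: (measurableT_comp mK); exact: measurable_funM.
      by apply: measurable_cos_fun; apply: measurable_funD => //; exact: measurable_funM.
    - by move=> a; rewrite normrM ler_piMr// cos_max.
    - by apply: rintegrable_norm; exact: rintegrable_kernel_scaled.
  apply: eq_Rintegral => a _ /=.
  transitivity (K (e * a) * \int[lebesgue_rV R d]_y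
      ((\prod_(j < d) K (e * y ord0 j)) * cos (dotp y z' + (a * z ord0 ord0 + th)))).
    rewrite -rintegralZl; last first.
      apply: (@le_rintegrable _ _ _ (lebesgue_rV R d) _ (fun xi => `|\prod_(j < d) K (e * xi ord0 j)|)).
      - apply: measurable_funM; first exact: measurable_kernel_rV.
        apply: measurable_cos_fun; apply: measurable_funD => //.
        by have := measurableT_comp (@measurable_dotp R d) (measurable_pair2 z').
      - by move=> xi; rewrite normrM ler_piMr// cos_max.
      - by apply: rintegrable_norm; exact: rintegrable_kernel_rV.
    apply: eq_Rintegral => y _; rewrite big_ord_recl rV_cons0 mulrA; congr (_ * _ * cos _).
      by apply: eq_bigr => j _; rewrite rV_consS.
    rewrite /dotp big_ord_recl rV_cons0 -addrA addrCA; congr (_ + _).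
    by apply: eq_bigr => j _; rewrite rV_consS mxE.
  by rewrite IH; ring.
rewrite (kernel_cos_phase Ki Keven Kq)// -mulrA big_ord_recl; congr (_ * (_ * _)).
by apply: eq_bigr => j _; rewrite mxE.
Qed.

Definition kernel_moment (k : R) : R := \int[lam]_x (K x ^+ 2 * `|x| `^ k).

Definition kernel_moment_rV d (i : 'I_d) (k : R) : R :=
  \prod_(j < d) kernel_moment (if j == i then k else 0).

(** Only the coordinate [i] carries the weight. The scale comes out as a pure power of [e], and
    [kernel_moment_rV] does not involve it. *)
Lemma kernel_sqr_rV d (e k k0 : R) (i : 'I_d) : 0 < e -> 0 <= k <= k0 ->
  (forall k, 0 <= k <= k0 -> rintegrable lam (fun x => K x ^+ 2 * `|x| `^ k)) ->
  rintegrable (lebesgue_rV R d)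
    (fun xi => (\prod_(j < d) K (e * xi ord0 j)) ^+ 2 * `|xi ord0 i| `^ k) /\
  \int[lebesgue_rV R d]_xi ((\prod_(j < d) K (e * xi ord0 j)) ^+ 2 * `|xi ord0 i| `^ k) =
  e `^ (- (d%:R + k)) * kernel_moment_rV i k.
Proof.
move=> e0 kk K2; have /andP[k_ge0 kk0] := kk.
pose kj (j : 'I_d) := if j == i then k else 0.
have kjk j : 0 <= kj j <= k0.
  by rewrite /kj; case: ifP => _ //; rewrite lexx (le_trans k_ge0).
have H j := kernel_sqr_scaled e0 (K2 _ (kjk j)).
have [fi fE] := @rintegrable_rV_prod R d (fun j x => K (e * x) ^+ 2 * `|x| `^ kj j) (fun j => (H j).1).
have E xi : \prod_(j < d) (K (e * xi ord0 j) ^+ 2 * `|xi ord0 j| `^ kj j) =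
    (\prod_(j < d) K (e * xi ord0 j)) ^+ 2 * `|xi ord0 i| `^ k.
  rewrite big_split /= -prodrXl; congr (_ * _).
  rewrite (bigD1 i)//= big1 ?mulr1; first by rewrite /kj eqxx.
  by move=> j /negbTE ji; rewrite /kj ji powRr0.
split; first by apply: eq_rintegrable fi.
transitivity (\int[lebesgue_rV R d]_xi \prod_(j < d) (K (e * xi ord0 j) ^+ 2 * `|xi ord0 j| `^ kj j)).
  by apply: eq_Rintegral => xi _; rewrite E.
rewrite fE; under eq_bigr => j _ do rewrite (H j).2.
rewrite big_split /=; congr (_ * _).
rewrite (_ : \prod_(j < d) e `^ (- (kj j + 1)) = expR (\sum_(j < d) (- (kj j + 1) * ln e))); last first.
  rewrite expR_sum; apply: eq_bigr => j _; by rewrite /powR gt_eqF.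
rewrite /powR gt_eqF//; congr expR; rewrite -mulr_suml; congr (_ * _).
rewrite sumrN big_split /= sumr_const card_ord addrC; congr (- (_ + _)).
by rewrite (bigD1 i)//= /kj eqxx big1 ?addr0// => j /negbTE ->.
Qed.

End kernel_rV.

Section spectral_pairing.
Context (R : realType) (d : nat) (dX : measure_display) (OmegaX : measurableType dX).
Context (PX : probability OmegaX R) (X : R -> OmegaX -> 'rV[R]_d) (Psi : 'rV[R]_d -> R).
Hypotheses (levyX : symmetric_levy PX X) (PsiX : char_exponent PX X Psi)
  (densityX : has_levy_density PX X Psi).
Local Notation lam := (@lebesgue_measure R).
Local Notation leb := (lebesgue_rV R d).
Local Notation tx := (@lebesgue_tx R d).

(** Read off [E cos <= 1], so that it also holds at the origin, where the power bounds are
    silent. *)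
Lemma exponent_ge0 xi : 0 <= Psi xi.
Proof.
have := levy_cos PsiX xi (@ler01 R); rewrite mulN1r => E.
rewrite -oppr_le0 -ler_expR expR0 -E -[leRHS](rintegral_prob_cst PX 1).
have mX : measurable_fun setT (X 1) by case: levyX => mX _ _ _ _ _; exact: mX.
apply: le_rintegral => [||w].
- apply: bounded_rintegrable (fun w => cos_max _).
  by apply: measurable_cos_fun; exact: measurableT_comp (measurable_dotpl xi) mX.
- exact: finite_measure_integrable_cst.
- exact: cos_le1.
Qed.

Variables (K kq : R -> R).
Hypotheses (mK : measurable_fun setT K) (Ki : rintegrable lam K)
  (Keven : forall x, K (- x) = K x)
  (Kq : forall s, \int[lam]_x (K x * cos (x * s)) = kq s)
  (kq_out : forall s, 1 <= `|s| -> kq s = 0).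

Definition space_kernel (e : R) (xi : 'rV[R]_d) := \prod_(j < d) K (e * xi ord0 j).
Definition time_space_kernel (dl e : R) (q : R * 'rV[R]_d) := K (dl * q.1) * space_kernel e q.2.

Lemma measurable_time_kernel (dl : R) : measurable_fun [set: R] (fun a => K (dl * a)).
Proof. by apply: (measurableT_comp mK); exact: measurable_funM. Qed.

Lemma measurable_time_space_kernel dl e : measurable_fun setT (time_space_kernel dl e).
Proof.
apply: measurable_funM.
  by have := measurableT_comp (measurable_time_kernel dl) (@measurable_fst _ _ (measurableTypeR R) 'rV[R]_d).
exact: measurableT_comp (measurable_kernel_rV mK _) measurable_snd.
Qed.

Lemma rintegrable_time_space_kernel dl e (f : R * 'rV[R]_d -> R) : 0 < dl -> 0 < e ->
  measurable_fun setT f -> (forall q, `|f q| <= 1) ->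
  rintegrable tx (fun q => time_space_kernel dl e q * f q).
Proof.
move=> dl0 e0 mf f1.
have ki : rintegrable tx (time_space_kernel dl e).
  apply: (@rintegrableX _ _ (measurableTypeR R) _ R lam leb (fun a => K (dl * a)) (space_kernel e)).
    exact: rintegrable_kernel_scaled.
  exact: rintegrable_kernel_rV.
apply: (@le_rintegrable _ (measurableTypeR R * 'rV[R]_d)%type R tx _ (fun q => `|time_space_kernel dl e q|)).
- by apply: measurable_funM => //; exact: measurable_time_space_kernel.
- by move=> q; rewrite normrM ler_piMr.
- exact: rintegrable_norm.
Qed.

Lemma measurable_linear_phase s (z : 'rV[R]_d) :
  measurable_fun setT (fun q : R * 'rV[R]_d => q.1 * s + dotp q.2 z).
Proof.
by have := measurableT_comp (@measurable_phase R d) (measurable_pair2 (s, z)).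
Qed.

Lemma rintegral_time_space_kernel dl e (g : 'rV[R]_d -> R) s z : 0 < dl -> 0 < e ->
  measurable_fun setT g -> (forall xi, `|g xi| <= 1) ->
  rintegrable tx (fun q => time_space_kernel dl e q * (g q.2 * cos (q.1 * s + dotp q.2 z))) /\
  \int[tx]_q (time_space_kernel dl e q * (g q.2 * cos (q.1 * s + dotp q.2 z))) =
  dl^-1 * kq (s / dl) * \int[leb]_xi (space_kernel e xi * (g xi * cos (dotp xi z))).
Proof.
move=> dl0 e0 mg g1.
have fi : rintegrable tx (fun q => time_space_kernel dl e q * (g q.2 * cos (q.1 * s + dotp q.2 z))).
  apply: rintegrable_time_space_kernel => //.
    apply: measurable_funM; first exact: measurableT_comp mg measurable_snd.
    by apply: measurable_cos_fun; exact: measurable_linear_phase.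
  by move=> q; rewrite normrM mulr_ile1 ?cos_max.
split=> //.
rewrite (@rintegral_fubini_swap _ _ (measurableTypeR R) _ R lam leb _ fi) -rintegralZl; last first.
  apply: (@le_rintegrable _ _ _ leb _ (fun xi => `|space_kernel e xi|)).
  - apply: measurable_funM; first exact: measurable_kernel_rV.
    by apply: measurable_funM => //; apply: measurable_cosdotp.
  - by move=> xi; rewrite normrM ler_piMr// normrM mulr_ile1 ?cos_max.
  - by apply: rintegrable_norm; exact: rintegrable_kernel_rV.
apply: eq_Rintegral => xi _ /=; rewrite /time_space_kernel /=.
transitivity (space_kernel e xi * g xi * \int[lam]_a (K (dl * a) * cos (a * s + dotp xi z))).
  rewrite -rintegralZl; last first.
    apply: (@le_rintegrable _ _ _ lam _ (fun a => `|K (dl * a)|)).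
    - apply: measurable_funM; first exact: measurable_time_kernel.
      by apply: measurable_cos_fun; apply: measurable_funD => //; exact: measurable_funM.
    - by move=> a; rewrite normrM ler_piMr// cos_max.
    - by apply: rintegrable_norm; exact: rintegrable_kernel_scaled.
  by apply: eq_Rintegral => a _; ring.
by rewrite (kernel_cos_phase Ki Keven Kq)//; ring.
Qed.

Lemma pairing_term dl e t x t' x' : 0 < dl -> dl <= t -> 0 < e -> 0 <= t' ->
  rintegrable tx (fun q => time_space_kernel dl e q *
    (cos (q.1 * (t - t') + dotp q.2 (x - x')) -
     expR (- Psi q.2 * t') * cos (q.1 * t + dotp q.2 (x - x')))) /\
  \int[tx]_q (time_space_kernel dl e q *
    (cos (q.1 * (t - t') + dotp q.2 (x - x')) -
     expR (- Psi q.2 * t') * cos (q.1 * t + dotp q.2 (x - x')))) =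
  dl^-1 * kq ((t - t') / dl) * \prod_(j < d) (e^-1 * kq ((x - x') ord0 j / e)).
Proof.
move=> dl0 dlt e0 t'0.
have m1 : measurable_fun [set: 'rV[R]_d] (fun=> 1 : R) by exact: measurable_cst.
have b1 (xi : 'rV[R]_d) : `|1 : R| <= 1 by rewrite normr1.
have [i1 E1] := rintegral_time_space_kernel (t - t') (x - x') dl0 e0 m1 b1.
have m2 : measurable_fun setT (fun xi => expR (- Psi xi * t')).
  apply: (measurableT_comp (continuous_measurable_fun (@continuous_expR R))).
  apply: measurable_funM => //; apply: measurableT_comp => //.
  exact: measurable_exponent levyX PsiX.
have b2 xi : `|expR (- Psi xi * t')| <= 1.
  rewrite ger0_norm ?expR_ge0// -expR0 ler_expR mulNr oppr_le0 mulr_ge0//.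
  exact: exponent_ge0.
have [i2 E2] := rintegral_time_space_kernel t (x - x') dl0 e0 m2 b2.
have EE q : time_space_kernel dl e q * (1 * cos (q.1 * (t - t') + dotp q.2 (x - x'))) -
    time_space_kernel dl e q * (expR (- Psi q.2 * t') * cos (q.1 * t + dotp q.2 (x - x'))) =
    time_space_kernel dl e q *
    (cos (q.1 * (t - t') + dotp q.2 (x - x')) -
     expR (- Psi q.2 * t') * cos (q.1 * t + dotp q.2 (x - x'))).
  by rewrite mul1r -mulrBr.
split; first by apply: (@eq_rintegrable _ _ _ tx _ _ EE); exact: rintegrableB.
rewrite -(funext EE) (rintegralB i1 i2) E1 E2.
(* The boundary term has frequency [t] in [tau], and [t / dl >= 1] lies outside the open support
   interval of the transform. *)
rewrite (kq_out (s := t / dl)); last first.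
  by rewrite normrM normfV (gtr0_norm dl0) (gtr0_norm (lt_le_trans dl0 dlt)) ler_pdivlMr// mul1r.
rewrite mulr0 mul0r subr0; congr (_ * _).
transitivity (cos 0 * \prod_(j < d) (e^-1 * kq ((x - x') ord0 j / e))); last by rewrite cos0 mul1r.
rewrite -(kernel_cos_rV mK Ki Keven Kq)//.
by apply: eq_Rintegral => xi _; rewrite mul1r addr0.
Qed.

Variables (n : nat) (p : 'I_n -> R * 'rV[R]_d) (b : 'I_n -> R) (i0 : 'I_n).
Hypotheses (p_ge0 : forall i, 0 <= (p i).1) (b1 : b i0 = 1).
Local Notation G i := (green Psi (p i).1 (p i).2).

(** With [kernel_sine], the real and imaginary parts of [(Psi - i tau)] times the exponential of [i]
    times the phase at [p i0]. *)
Definition kernel_cosine (q : R * 'rV[R]_d) : R :=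
  Psi q.2 * cos (phase q (p i0)) + q.1 * sin (phase q (p i0)).
Definition kernel_sine (q : R * 'rV[R]_d) : R :=
  Psi q.2 * sin (phase q (p i0)) - q.1 * cos (phase q (p i0)).

Lemma phase_sub (q : R * 'rV[R]_d) t (x : 'rV[R]_d) t' (x' : 'rV[R]_d) : phase q (t, x) - phase q (t', x') =
  q.1 * (t - t') + dotp q.2 (x - x').
Proof.
rewrite /phase /= mulrBr.
have -> : dotp q.2 (x - x') = dotp q.2 x - dotp q.2 x'.
  by rewrite /dotp -sumrB; apply: eq_bigr => j _; rewrite !mxE mulrBr.
by ring.
Qed.

(** This is the real part of a complex product; the factor [Psi - i tau] meets the denominator of
    each transform, which leaves differences of pure phases. *)
Lemma pairing_pointwise q :
  (\sum_(i < n) b i * complex.Re (fourier (G i) q.1 q.2)) * kernel_cosine q -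
  (\sum_(i < n) b i * complex.Im (fourier (G i) q.1 q.2)) * kernel_sine q =
  \sum_(i < n) b i * (cos (q.1 * ((p i0).1 - (p i).1) + dotp q.2 ((p i0).2 - (p i).2)) -
     expR (- Psi q.2 * (p i).1) * cos (q.1 * (p i0).1 + dotp q.2 ((p i0).2 - (p i).2))).
Proof.
rewrite !mulr_suml -sumrB; apply: eq_bigr => i _.
have := green_fourier_parts levyX PsiX densityX (p i).2 q (p_ge0 i); cbv zeta.
set C := complex.Re _; set D := complex.Im _ => -[E1 E2].
have e1 : q.1 * ((p i0).1 - (p i).1) + dotp q.2 ((p i0).2 - (p i).2) =
    phase q (p i0) - (q.1 * (p i).1 + dotp q.2 (p i).2).
  by rewrite -phase_sub; congr (phase q _ - _); case: (p i0).
have e2 : q.1 * (p i0).1 + dotp q.2 ((p i0).2 - (p i).2) = phase q (p i0) - dotp q.2 (p i).2.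
  have := phase_sub q (p i0).1 (p i0).2 0 (p i).2; rewrite subr0 => <-.
  by rewrite /phase /= mulr0 add0r.
rewrite e1 e2 (cosB (phase q (p i0)) (_ + _)) (cosB (phase q (p i0)) (dotp _ _)).
rewrite /kernel_cosine /kernel_sine.
move: (phase q (p i0)) E1 E2 => ph.
move: (cos (_ + _)) (sin (_ + _)) (cos (dotp _ _)) (sin (dotp _ _)) => c1 s1 c2 s2.
move: (expR _) => ee E1 E2.
have -> : c1 = Psi q.2 * C - q.1 * - D + c2 * ee by rewrite E1; ring.
have -> : s1 = Psi q.2 * - D + q.1 * C + s2 * ee by rewrite E2; ring.
ring.
Qed.

Lemma pairing_integral dl e : 0 < dl -> dl <= (p i0).1 -> 0 < e ->
  (forall i, i != i0 -> dl <= `|(p i0).1 - (p i).1| \/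
    exists j, e <= `|(p i0).2 ord0 j - (p i).2 ord0 j|) ->
  let f q := time_space_kernel dl e q *
    ((\sum_(i < n) b i * complex.Re (fourier (G i) q.1 q.2)) * kernel_cosine q -
     (\sum_(i < n) b i * complex.Im (fourier (G i) q.1 q.2)) * kernel_sine q) in
  rintegrable tx f /\ \int[tx]_q f q = dl^-1 * e ^- d * kq 0 ^+ d.+1.
Proof.
move=> dl0 dlt e0 sep f.
pose T i q := time_space_kernel dl e q *
    (cos (q.1 * ((p i0).1 - (p i).1) + dotp q.2 ((p i0).2 - (p i).2)) -
     expR (- Psi q.2 * (p i).1) * cos (q.1 * (p i0).1 + dotp q.2 ((p i0).2 - (p i).2))).
have fE q : \sum_(i < n) b i * T i q = f q.
  by rewrite /f pairing_pointwise mulr_sumr; apply: eq_bigr => i _; rewrite /T mulrCA.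
have Ti i := pairing_term (p i0).2 (p i).2 dl0 dlt e0 (p_ge0 i).
have bTi i : rintegrable tx (fun q => b i * T i q) by exact: rintegrableZl (Ti i).1.
split; first by apply: (@eq_rintegrable _ _ _ tx _ _ fE); exact: rintegrable_sum.
transitivity (\int[tx]_q \sum_(i < n) b i * T i q).
  by apply: eq_Rintegral => q _; rewrite fE.
rewrite rintegral_sum// (bigD1 i0)//= big1 ?addr0; last first.
  move=> i ii0; rewrite rintegralZl; last exact: (Ti i).1.
  rewrite (Ti i).2; case: (sep i ii0) => [h|[j h]].
    rewrite kq_out ?mulr0 ?mul0r ?mulr0//.
    by rewrite normrM normfV (gtr0_norm dl0) ler_pdivlMr// mul1r.
  rewrite (bigD1 j)//= (kq_out (s := _ / e)) ?mulr0 ?mul0r ?mulr0//.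
  by rewrite !mxE normrM normfV (gtr0_norm e0) ler_pdivlMr// mul1r.
rewrite rintegralZl; last exact: (Ti i0).1.
rewrite b1 mul1r (Ti i0).2 !subrr mul0r.
under eq_bigr do rewrite mxE mul0r.
rewrite prodr_const card_ord exprMn exprS exprVn; ring.
Qed.

End spectral_pairing.

Section spectral_lower_bound.
Context (R : realType) (d : nat) (dX : measure_display) (OmegaX : measurableType dX).
Context (PX : probability OmegaX R) (X : R -> OmegaX -> 'rV[R]_d) (Psi : 'rV[R]_d -> R).
Hypotheses (levyX : symmetric_levy PX X) (PsiX : char_exponent PX X Psi)
  (densityX : has_levy_density PX X Psi).
Local Notation lam := (@lebesgue_measure R).
Local Notation leb := (lebesgue_rV R d).
Local Notation tx := (@lebesgue_tx R d).

Variables (H : R) (h : 'rV[R]_d -> R) (CPsi ch alpha beta k0 : R).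
Hypotheses (d_ge1 : (1 <= d)%N) (H_ge : 2^-1 <= H).
Hypotheses (h_meas : measurable_fun setT h) (h_ge0 : forall xi, 0 <= h xi).
Hypotheses (CPsi_gt0 : 0 < CPsi) (ch_gt0 : 0 < ch) (alpha_gt0 : 0 < alpha)
  (beta_gt0 : 0 < beta).
Hypothesis Psi_upper : forall xi, xi != 0 -> Psi xi <= CPsi * enorm xi `^ alpha.
Hypothesis h_lower : forall xi, xi != 0 -> ch * enorm xi `^ (- beta) <= h xi.

Variables (K kq : R -> R).
Hypotheses (mK : measurable_fun setT K) (Ki : rintegrable lam K)
  (K2 : forall k, 0 <= k <= k0 -> rintegrable lam (fun x => K x ^+ 2 * `|x| `^ k))
  (Keven : forall x, K (- x) = K x)
  (Kq : forall s, \int[lam]_x (K x * cos (x * s)) = kq s)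
  (kq_out : forall s, 1 <= `|s| -> kq s = 0) (kq0 : 0 < kq 0).
Let g1 := 2 * alpha + beta.
Hypotheses (g1_le : g1 <= k0) (H_le : 2 * H + 1 <= k0).

Let c1 := CPsi ^+ 2 * d%:R `^ g1 / ch.
Let c2 := d%:R `^ beta / ch.

(** By [h_lower] the inverse weight is at most [|tau|^(2H-1) |xi|^beta / ch]. The [Psi^2] part then
    has exponents [2H - 1] and [2 alpha + beta], the [tau^2] part [2H + 1] and [beta]; norms are
    replaced by coordinates so that every summand factors. *)
Let dominator (dl e : R) (q : R * 'rV[R]_d) := \sum_(j < d)
  (c1 * ((K (dl * q.1) ^+ 2 * `|q.1| `^ (2 * H - 1)) *
         (space_kernel K e q.2 ^+ 2 * `|q.2 ord0 j| `^ g1)) +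
   c2 * ((K (dl * q.1) ^+ 2 * `|q.1| `^ (2 * H + 1)) *
         (space_kernel K e q.2 ^+ 2 * `|q.2 ord0 j| `^ beta))).

Let dominator_bound dl e (q : R * 'rV[R]_d) : q.1 != 0 -> (forall j, q.2 ord0 j != 0) ->
  time_space_kernel K dl e q ^+ 2 * (Psi q.2 ^+ 2 + q.1 ^+ 2) / spectral_weight H h q <=
  dominator dl e q.
Proof.
move=> tau0 xij; have xi0 : q.2 != 0.
  by apply/eqP => xiE; have := xij (Ordinal d_ge1); rewrite xiE mxE eqxx.
have e0 : 0 < enorm q.2.
  by apply: lt_le_trans (coord_le_enorm q.2 (Ordinal d_ge1)); rewrite normr_gt0.
have t0 : 0 < `|q.1| by rewrite normr_gt0.
have h0 : 0 < h q.2.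
  by apply: lt_le_trans (h_lower xi0); rewrite mulr_gt0 ?powR_gt0.
set k := K (dl * q.1); set S := space_kernel K e q.2.
have winv : (spectral_weight H h q)^-1 <= `|q.1| `^ (2 * H - 1) * (enorm q.2 `^ beta / ch).
  rewrite /spectral_weight invfM -powRN opprB ler_wpM2l ?powR_ge0//.
  rewrite -[enorm q.2 `^ beta]invrK -powRN -invfM lef_pV2 ?posrE ?mulr_gt0 ?powR_gt0//.
  by rewrite mulrC; exact: h_lower.
have Psi2 : Psi q.2 ^+ 2 <= CPsi ^+ 2 * enorm q.2 `^ (2 * alpha).
  rewrite (_ : enorm q.2 `^ (2 * alpha) = (enorm q.2 `^ alpha) ^+ 2); last first.
    by rewrite -powR_mulrn ?powR_ge0// -powRrM mulrC.
  rewrite -exprMn lerXn2r ?nnegrE//; last exact: Psi_upper.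
    exact: exponent_ge0 levyX PsiX _.
  by rewrite mulr_ge0 ?powR_ge0// ltW.
have ps : 0 <= time_space_kernel K dl e q ^+ 2 * (Psi q.2 ^+ 2 + q.1 ^+ 2).
  by rewrite mulr_ge0 ?sqr_ge0// addr_ge0 ?sqr_ge0.
apply: (le_trans (ler_wpM2l ps winv)).
have s1 := enorm_powR_le q.2 d_ge1 (_ : 0 <= g1).
have g1_ge0 : 0 <= g1 by rewrite addr_ge0 ?mulr_ge0 ?(ltW alpha_gt0) ?(ltW beta_gt0).
have {}s1 := s1 g1_ge0.
have s2 := enorm_powR_le q.2 d_ge1 (ltW beta_gt0).
pose A := k ^+ 2 * S ^+ 2.
have A0 : 0 <= A by rewrite mulr_ge0 ?sqr_ge0.
have tau2 : q.1 ^+ 2 * `|q.1| `^ (2 * H - 1) = `|q.1| `^ (2 * H + 1).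
  rewrite -(real_normK (num_real q.1)) -powR_mulrn// -powRD; last by rewrite (gt_eqF t0) implybT.
  by congr (_ `^ _); ring.
have eg1 : enorm q.2 `^ (2 * alpha) * enorm q.2 `^ beta = enorm q.2 `^ g1.
  by rewrite -powRD// (gt_eqF e0) implybT.
apply: (@le_trans _ _ (A * `|q.1| `^ (2 * H - 1) * (CPsi ^+ 2 * enorm q.2 `^ g1 / ch) +
   A * `|q.1| `^ (2 * H + 1) * (enorm q.2 `^ beta / ch))).
  rewrite -tau2 -eg1 /time_space_kernel -/k -/S exprMn -/A.
  have nn : 0 <= A * `|q.1| `^ (2 * H - 1) * (enorm q.2 `^ beta / ch).
    apply: mulr_ge0; first by apply: mulr_ge0 => //; exact: powR_ge0.
    by apply: divr_ge0; [exact: powR_ge0|exact: ltW].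
  have := ler_wpM2l nn Psi2; lra.
have w1 : 0 <= A * `|q.1| `^ (2 * H - 1) * (CPsi ^+ 2 / ch).
  apply: mulr_ge0; first by apply: mulr_ge0 => //; exact: powR_ge0.
  by apply: divr_ge0; [exact: sqr_ge0|exact: ltW].
have w2 : 0 <= A * `|q.1| `^ (2 * H + 1) / ch.
  apply: divr_ge0; last exact: ltW.
  by apply: mulr_ge0 => //; exact: powR_ge0.
have -> : dominator dl e q =
    c1 * (k ^+ 2 * `|q.1| `^ (2 * H - 1) * (S ^+ 2 * \sum_(j < d) `|q.2 ord0 j| `^ g1)) +
    c2 * (k ^+ 2 * `|q.1| `^ (2 * H + 1) * (S ^+ 2 * \sum_(j < d) `|q.2 ord0 j| `^ beta)).
  by rewrite /dominator big_split /= -!mulr_sumr.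
have := ler_wpM2l w1 s1; have := ler_wpM2l w2 s2; rewrite /c1 /c2 /A.
move: (\sum_(j < d) _) (\sum_(j < d) _) (enorm q.2 `^ g1) (enorm q.2 `^ beta) => S1 S2 E1 E2.
move: (`|q.1| `^ (2 * H - 1)) (`|q.1| `^ (2 * H + 1)) (d%:R `^ beta) (d%:R `^ g1) => t1 t2 d1 d2.
by lra.
Qed.

Let g1_ge0 : 0 <= g1.
Proof. by rewrite addr_ge0 ?mulr_ge0 ?(ltW alpha_gt0) ?(ltW beta_gt0). Qed.

Let constant := \sum_(j < d)
  (c1 * (kernel_moment K (2 * H - 1) * kernel_moment_rV K j g1) +
   c2 * (kernel_moment K (2 * H + 1) * kernel_moment_rV K j beta)).

(** The relation [dl = e^alpha] makes both families scale alike: the extra [e^(- 2 alpha)] from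
    [Psi^2] equals the extra [dl^(-2)] from [tau^2]. *)
Let dominator_integral dl e : 0 < dl -> 0 < e -> dl = e `^ alpha ->
  rintegrable tx (dominator dl e) /\
  \int[tx]_q dominator dl e q = dl `^ (- (2 * H + 2)) * e `^ (- (d%:R + beta)) * constant.
Proof.
move=> dl0 e0 dle.
have k1 : 0 <= 2 * H - 1 <= k0 by apply/andP; split; move: H_ge H_le; lra.
have k2 : 0 <= 2 * H + 1 <= k0 by apply/andP; split; move: H_ge H_le; lra.
have k3 : 0 <= g1 <= k0 by rewrite g1_ge0.
have k4 : 0 <= beta <= k0.
  by rewrite (ltW beta_gt0) (le_trans _ g1_le)// lerDr mulr_ge0// ltW.
have [ti1 tE1] := kernel_sqr_scaled dl0 (K2 k1).
have [ti2 tE2] := kernel_sqr_scaled dl0 (K2 k2).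
have S1 j := @kernel_sqr_rV _ _ d e g1 k0 j e0 k3 K2.
have S2 j := @kernel_sqr_rV _ _ d e beta k0 j e0 k4 K2.
have P1 j := @rintegrableX _ _ (measurableTypeR R) _ R lam leb _ _ ti1 (S1 j).1.
have P2 j := @rintegrableX _ _ (measurableTypeR R) _ R lam leb _ _ ti2 (S2 j).1.
have E1 j := @rintegralX _ _ (measurableTypeR R) _ R lam leb _ _ ti1 (S1 j).1.
have E2 j := @rintegralX _ _ (measurableTypeR R) _ R lam leb _ _ ti2 (S2 j).1.
have Di j := rintegrableD (rintegrableZl c1 (P1 j)) (rintegrableZl c2 (P2 j)).
split; first by apply: rintegrable_sum => j; exact: Di.
rewrite /dominator rintegral_sum; last exact: Di.
rewrite mulr_sumr; apply: eq_bigr => j _.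
rewrite rintegralD; [|exact: rintegrableZl (P1 j)|exact: rintegrableZl (P2 j)].
rewrite (rintegralZl _ (P1 j)) (rintegralZl _ (P2 j)) (E1 j) (E2 j) tE1 tE2 (S1 j).2 (S2 j).2.
rewrite -/(kernel_moment K (2 * H - 1)) -/(kernel_moment K (2 * H + 1)).
have -> : e `^ (- (d%:R + g1)) = e `^ (- (d%:R + beta)) * dl `^ (- 2).
  rewrite dle -powRrM -powRD; last by rewrite (gt_eqF e0) implybT.
  by congr (_ `^ _); rewrite /g1; ring.
have -> : dl `^ (- (2 * H - 1 + 1)) = dl `^ (- (2 * H + 2)) * dl `^ 2.
  rewrite -powRD; last by rewrite (gt_eqF dl0) implybT.
  by congr (_ `^ _); ring.
have d2 : dl `^ 2 * dl `^ (- 2) = 1.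
  by rewrite powRN mulfV// gt_eqF ?powR_gt0.
have -> : - (2 * H + 1 + 1) = - (2 * H + 2) by ring.
rewrite mulrDr; congr (_ + _); last by ring.
move: (dl `^ (- (2 * H + 2))) (e `^ _) (kernel_moment K _) (kernel_moment_rV K j g1) => a1 a2 a3 a4.
transitivity (c1 * (a1 * a2 * a3 * a4 * (dl `^ 2 * dl `^ (- 2)))); first by ring.
by rewrite d2; ring.
Qed.

Let constant_ge0 : 0 <= constant.
Proof.
have m0 k : 0 <= kernel_moment K k.
  by apply: rintegral_ge0 => x; rewrite mulr_ge0 ?sqr_ge0 ?powR_ge0.
have mm0 j k : 0 <= kernel_moment_rV K j k by apply: prodr_ge0 => i _; exact: m0.
have c10 : 0 <= c1.
  by apply: divr_ge0; [apply: mulr_ge0; [exact: sqr_ge0|exact: powR_ge0]|exact: ltW].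
have c20 : 0 <= c2 by apply: divr_ge0; [exact: powR_ge0|exact: ltW].
by apply: sumr_ge0 => j _; rewrite addr_ge0// mulr_ge0// mulr_ge0.
Qed.

(** Cauchy-Schwarz is replaced by Young's inequality with a free parameter, which can be integrated
    from a pointwise inequality. Taking [l = M / I] in place of the minimiser avoids a special case
    for [N = 0]. *)
Let le_of_young (I N M : R) : 0 < I -> 0 < M -> 0 <= N ->
  (forall l, 0 < l -> I <= l / 2 * N + (2 * l)^-1 * M) -> I ^+ 2 / M <= N.
Proof.
move=> I0 M0 N0 hyp; rewrite ler_pdivrMr//.
have l0 : 0 < M / I by rewrite divr_gt0.
have := hyp _ l0; rewrite -(ler_pM2r (_ : 0 < 2 * I)) ?mulr_gt0//.
rewrite [X in _ <= X -> _](_ : _ = M * N + I ^+ 2); first by rewrite expr2; lra.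
by field; rewrite !gt_eqF.
Qed.

(** Adding 1 makes the denominator positive from [constant_ge0] alone, at the cost of a smaller
    bound. *)
Definition spectral_constant : R := kq 0 ^+ d.+1 ^+ 2 / (constant + 1).

Lemma spectral_constant_gt0 : 0 < spectral_constant.
Proof. by rewrite divr_gt0 ?exprn_gt0// ltr_wpDl. Qed.

Variables (n : nat) (p : 'I_n -> R * 'rV[R]_d) (b : 'I_n -> R) (i0 : 'I_n).
Hypotheses (p_ge0 : forall i, 0 <= (p i).1) (b1 : b i0 = 1).
Hypothesis green_L2 : forall i, spectral_L2 H h (green Psi (p i).1 (p i).2).

Local Notation A := (fun q => \sum_(i < n) b i * specRe H h (green Psi (p i).1 (p i).2) q).
Local Notation B := (fun q => \sum_(i < n) b i * specIm H h (green Psi (p i).1 (p i).2) q).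

Lemma spectral_lower_bound (e : R) : 0 < e -> e `^ alpha <= (p i0).1 ->
  (forall i, i != i0 -> e `^ alpha <= `|(p i0).1 - (p i).1| \/
    exists j, e <= `|(p i0).2 ord0 j - (p i).2 ord0 j|) ->
  spectral_constant * e `^ (2 * alpha * H - (d%:R - beta)) <= dotL2 tx A A + dotL2 tx B B.
Proof.
move=> e0 et sep; set dl := e `^ alpha.
have dl0 : 0 < dl by rewrite powR_gt0.
have LA : L2 tx A by apply: L2_sum => i; apply: L2Z; exact: (green_L2 i).1.
have LB : L2 tx B by apply: L2_sum => i; apply: L2Z; exact: (green_L2 i).2.
have [fi fE] := pairing_integral levyX PsiX densityX mK Ki Keven Kq kq_out p_ge0 b1 dl0 et e0 sep.
have [Di DE] := dominator_integral dl0 e0 erefl.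
set N := dotL2 tx _ _ + _; pose W := dl `^ (- (2 * H + 2)) * e `^ (- (d%:R + beta)).
have W0 : 0 < W by rewrite mulr_gt0 ?powR_gt0.
pose I := dl^-1 * e ^- d * kq 0 ^+ d.+1.
have I0 : 0 < I by rewrite mulr_gt0 ?exprn_gt0// mulr_gt0 ?invr_gt0 ?exprn_gt0.
have main l : 0 < l -> I <= l / 2 * N + (2 * l)^-1 * (W * (constant + 1)).
  move=> l0; rewrite /I -fE.
  have AA := L2_mul LA LA; have BB := L2_mul LB LB.
  have ri : rintegrable tx (fun q => l / 2 * (A q * A q + B q * B q) + (2 * l)^-1 * dominator dl e q).
    by apply: rintegrableD; apply: rintegrableZl => //; exact: rintegrableD.
  apply: (@le_trans _ _ (\int[tx]_q (l / 2 * (A q * A q + B q * B q) + (2 * l)^-1 * dominator dl e q))).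
    apply: ae_le_rintegral => //; apply: ae_coord_neq0 => q tau0 xij.
    have := dominator_bound dl e tau0 xij.
    have xi0 : q.2 != 0.
      by apply/eqP => xiE; have := xij (Ordinal d_ge1); rewrite xiE mxE eqxx.
    have w0 : 0 < spectral_weight H h q.
      rewrite mulr_gt0 ?powR_gt0 ?normr_gt0//; apply: lt_le_trans (h_lower xi0).
      rewrite mulr_gt0 ?powR_gt0//.
      by apply: lt_le_trans (coord_le_enorm q.2 (Ordinal d_ge1)); rewrite normr_gt0.
    have AE : A q = Num.sqrt (spectral_weight H h q) *
        \sum_(i < n) b i * complex.Re (fourier (green Psi (p i).1 (p i).2) q.1 q.2).
      by rewrite mulr_sumr; apply: eq_bigr => i _; rewrite /specRe mulrCA.
    have BE : B q = Num.sqrt (spectral_weight H h q) *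
        \sum_(i < n) b i * complex.Im (fourier (green Psi (p i).1 (p i).2) q.1 q.2).
      by rewrite mulr_sumr; apply: eq_bigr => i _; rewrite /specIm mulrCA.
    rewrite AE BE -{1}(sqr_sqrtr (ltW w0)).
    have : 0 < Num.sqrt (spectral_weight H h q) by rewrite sqrtr_gt0.
    have uv : kernel_cosine Psi p i0 q ^+ 2 + kernel_sine Psi p i0 q ^+ 2 =
        Psi q.2 ^+ 2 + q.1 ^+ 2.
      rewrite /kernel_cosine /kernel_sine; have := cos2Dsin2 (phase q (p i0)).
      move: (cos _) (sin _) => c s cs.
      transitivity ((Psi q.2 ^+ 2 + q.1 ^+ 2) * (c ^+ 2 + s ^+ 2)); first by ring.
      by rewrite cs mulr1.
    rewrite -uv; move: (Num.sqrt _) (kernel_cosine Psi p i0 q) (kernel_sine Psi p i0 q) => r u v.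
    move: (time_space_kernel K dl e q) (dominator dl e q) => k D.
    move: (\sum_(i < n) _) (\sum_(i < n) _) => bb a r0 hD.
    (* Completing the squares, with [r] the square root of the weight: the gap in Young's inequality
       is a sum of two squares. *)
    have alg : (l / 2 * (r * a * (r * a) + r * bb * (r * bb)) +
        (2 * l)^-1 * (k ^+ 2 * (u ^+ 2 + v ^+ 2) / r ^+ 2)) - k * (a * u - bb * v) =
        (2 * l)^-1 * ((l * r * a - k * u / r) ^+ 2 + (l * r * bb + k * v / r) ^+ 2).
      by field; rewrite !gt_eqF.
    have nn : 0 <= (2 * l)^-1 * ((l * r * a - k * u / r) ^+ 2 + (l * r * bb + k * v / r) ^+ 2).
      by rewrite mulr_ge0 ?addr_ge0 ?sqr_ge0// invr_ge0 mulr_ge0 ?ltW.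
    have : (2 * l)^-1 * (k ^+ 2 * (u ^+ 2 + v ^+ 2) / r ^+ 2) <= (2 * l)^-1 * D.
      by rewrite ler_wpM2l// invr_ge0 mulr_ge0 ?ltW.
    rewrite -alg subr_ge0 in nn; move=> hD2; apply: (le_trans nn).
    by rewrite lerD2l.
  rewrite rintegralD; [|by apply: rintegrableZl; exact: rintegrableD|exact: rintegrableZl].
  rewrite rintegralZl; last exact: rintegrableD.
  rewrite rintegralZl// rintegralD// -/(dotL2 tx A A) -/(dotL2 tx B B) -/N DE -/W.
  rewrite lerD2l ler_wpM2l ?invr_ge0 ?mulr_ge0 ?(ltW l0)//.
  by rewrite ler_wpM2l ?(ltW W0)// lerDl.
have M0 : 0 < W * (constant + 1) by rewrite mulr_gt0// ltr_wpDl.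
have N0 : 0 <= N by rewrite addr_ge0 ?dotL2_ge0.
apply: le_trans (le_of_young I0 M0 N0 main).
rewrite le_eqVlt; apply/orP; left; apply/eqP.
have C0 : 0 < constant + 1 by rewrite ltr_wpDl.
(* The squared pairing over the dominating integral is [dl^(2H) e^(- (d - beta))], the powers
   [dl^(-2)] and [dl^2] cancelling. *)
have -> : e `^ (2 * alpha * H - (d%:R - beta)) = (dl^-1 * e ^- d) ^+ 2 / W.
  have en0 (r s : R) : (r + s == 0) ==> (e != 0) by rewrite (gt_eqF e0) implybT.
  have -> : dl^-1 = e `^ (- alpha) by rewrite powRN.
  have -> : e ^- d = e `^ (- d%:R) by rewrite powR_invn// ltW.
  have -> : W = e `^ (alpha * - (2 * H + 2) - (d%:R + beta)) by rewrite powRD// powRrM.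
  rewrite -powRD// -powR_mulrn ?powR_ge0// -powRrM -powRN -powRD//.
  by congr (_ `^ _); ring.
rewrite /spectral_constant /I.
by field; rewrite !gt_eqF ?exprn_gt0.
Qed.

End spectral_lower_bound.

(** * The variance bound *)

Section metric_separation.
Variables (R : realType) (d : nat) (alpha theta1 theta2 : R).
Hypotheses (alpha_gt0 : 0 < alpha) (theta1_gt0 : 0 < theta1) (theta2E : theta2 = alpha * theta1).

Let theta2_gt0 : 0 < theta2. Proof. by rewrite theta2E mulr_gt0. Qed.

Lemma Delta_ge0 (p q : R * 'rV[R]_d) : 0 <= Delta theta1 theta2 p q.
Proof. by rewrite addr_ge0 ?powR_ge0 ?sumr_ge0// => j _; exact: powR_ge0. Qed.

Lemma Delta_rectangle_le (a b : R) (lo hi : 'rV[R]_d) p q :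
  rectangle a b lo hi p -> rectangle a b lo hi q ->
  Delta theta1 theta2 p q <=
  (b - a) `^ theta1 + \sum_(j < d) (hi ord0 j - lo ord0 j) `^ theta2.
Proof.
have H (u v l r : R) : l <= u <= r -> l <= v <= r -> `|u - v| <= r - l.
  by move=> /andP[? ?] /andP[? ?]; rewrite ler_norml; apply/andP; split; lra.
have P (u v th : R) : 0 < th -> 0 <= u -> u <= v -> u `^ th <= v `^ th.
  by move=> th0 u0 uv; apply: ge0_ler_powR; rewrite ?nnegrE ?(ltW th0)// (le_trans u0).
move=> [p1 p2] [q1 q2]; apply: lerD; first by apply: P => //; exact: H.
by apply: ler_sum => j _; apply: P => //; exact: H.
Qed.

(** [Delta] has [d.+1] terms, so one of them is at least [rho / d.+1]. Since
    [theta2 = alpha * theta1], a gap [e] in space corresponds to a gap [e^alpha] in time. *)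
Lemma Delta_separation (p q : R * 'rV[R]_d) (rho e : R) : 0 < rho -> 0 <= e ->
  rho <= Delta theta1 theta2 p q -> e <= (rho / d.+1%:R) `^ theta2^-1 ->
  e `^ alpha <= `|p.1 - q.1| \/ exists j, e <= `|p.2 ord0 j - q.2 ord0 j|.
Proof.
move=> rho0 e0 rhoD es; set s := rho / d.+1%:R in es.
have s0 : 0 < s by rewrite divr_gt0.
have root (u th : R) : 0 < th -> 0 <= u -> s <= u `^ th -> s `^ th^-1 <= u.
  move=> th0 u0 su; rewrite -[leRHS](powRr1 u0) -(mulfV (lt0r_neq0 th0)) powRrM.
  by apply: ge0_ler_powR; rewrite ?nnegrE ?invr_ge0 ?powR_ge0 ?(ltW th0) ?(ltW s0).
have [h|h] := leP s (`|p.1 - q.1| `^ theta1).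
  left; apply: le_trans (root _ _ theta1_gt0 (normr_ge0 _) h).
  have -> : s `^ theta1^-1 = (s `^ theta2^-1) `^ alpha.
    rewrite -powRrM theta2E invfM mulrC mulrA mulfV ?mul1r//; exact: lt0r_neq0.
  by apply: ge0_ler_powR; rewrite ?nnegrE ?powR_ge0 ?(ltW alpha_gt0).
right; have [/existsP[j hj]|/existsPn hn] := boolP [exists j, s <= `|p.2 ord0 j - q.2 ord0 j| `^ theta2].
  by exists j; apply: (le_trans es); exact: root.
exfalso; have : Delta theta1 theta2 p q < s + \sum_(j < d) s.
  apply: ltr_leD => //; apply: ler_sum => j _; apply: ltW.
  by rewrite ltNge; exact: hn.
rewrite sumr_const card_ord -mulrS -mulr_natr /s divfK; last by rewrite pnatr_eq0.
by rewrite ltNge rhoD.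
Qed.

End metric_separation.

Section variance_lower_bound.
Variables (R : realType) (d : nat) (H : R)
  (d_ge1 : (1 <= d)%N) (H_ge : 2^-1 <= H) (H_lt1 : H < 1)
  (dX : measure_display) (OmegaX : measurableType dX) (PX : probability OmegaX R)
  (X : R -> OmegaX -> 'rV[R]_d) (Psi : 'rV[R]_d -> R)
  (levyX : symmetric_levy PX X)
  (PsiX : char_exponent PX X Psi)
  (densityX : has_levy_density PX X Psi)
  (h : 'rV[R]_d -> R) (h_meas : measurable_fun setT h)
  (h_ge0 : forall xi, 0 <= h xi)
  (dO : measure_display) (Omega : measurableType dO) (P : probability Omega R)
  (W : (R * 'rV[R]_d -> R) -> {RV P >-> R})
  (noiseW : gaussian_noise H h W)
  (u : R -> 'rV[R]_d -> {RV P >-> R})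
  (solu : mild_solution H h Psi W u)
  (cPsi CPsi ch Ch alpha beta : R)
  (cPsi_gt0 : 0 < cPsi) (CPsi_gt0 : 0 < CPsi) (ch_gt0 : 0 < ch) (Ch_gt0 : 0 < Ch)
  (alpha_gt0 : 0 < alpha)
  (beta_gt0 : 0 < beta) (beta_ltd : beta < d%:R)
  (Psi_bounds : forall xi, xi != 0 ->
     cPsi * enorm xi `^ alpha <= Psi xi <= CPsi * enorm xi `^ alpha)
  (h_bounds : forall xi, xi != 0 ->
     ch * enorm xi `^ (- beta) <= h xi <= Ch * enorm xi `^ (- beta))
  (theta1 theta2 : R)
  (theta1E : theta1 = H - (d%:R - beta) / (2 * alpha))
  (theta2E : theta2 = alpha * theta1)
  (theta1_gt0 : 0 < theta1).

Lemma mild_solution_spectral t x : 0 <= t -> spectral_L2 H h (green Psi t x).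
Proof.
apply: (green_spectral_L2 levyX PsiX densityX d_ge1 H_ge H_lt1 h_meas h_ge0 cPsi_gt0 Ch_gt0
  alpha_gt0 beta_gt0 beta_ltd).
- by move=> xi /Psi_bounds/andP[].
- by move=> xi /h_bounds/andP[].
- by rewrite -theta1E.
Qed.

Lemma mild_solution_L2 t x : 0 <= t -> L2 P (u t x).
Proof.
move=> t0; have [] // := wiener_approx h_meas h_ge0 (cHd_gt0 d H_ge H_lt1) noiseW
  (mild_solution_spectral x t0) (solu x t0).
Qed.

Local Notation comb p b := (fun w => \sum_i b i * u (p i).1 (p i).2 w).

Lemma mild_solution_gaussian n (p : 'I_n -> R * 'rV[R]_d) (b : 'I_n -> R) :
  (forall i, 0 <= (p i).1) ->
  \int[P]_w cos (comb p b w) = expR (- (dotL2 P (comb p b) (comb p b) / 2)) /\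
  \int[P]_w sin (comb p b w) = 0.
Proof.
move=> p0; exact: (wiener_gaussian h_meas h_ge0 (cHd_gt0 d H_ge H_lt1) noiseW
  (fun i => mild_solution_spectral (p i).2 (p0 i)) (fun i => solu (p i).2 (p0 i)) b).
Qed.

(** Stated for any separation [rho] so as to serve both conclusions of the theorem. The rectangle
    enters through [a], its distance from time 0, and [rmax], its size. *)
Lemma variance_lower_bound (a rmax : R) : 0 < a -> 0 < rmax ->
  exists2 c2 : R, 0 < c2 &
    forall n (p : 'I_n -> R * 'rV[R]_d) (b : 'I_n -> R) (i0 : 'I_n) (rho : R),
      (forall i, a <= (p i).1) -> b i0 = 1 -> 0 < rho -> rho <= rmax ->
      (forall i, i != i0 -> rho <= Delta theta1 theta2 (p i0) (p i)) ->
      c2 * rho ^+ 2 <= dotL2 P (comb p b) (comb p b).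
Proof.
(* The sum exceeds both moment orders occurring in the dominating function. *)
move=> a0 rmax0; pose k0 := 2 * alpha + beta + (2 * H + 1).
have theta2_gt0 : 0 < theta2 by rewrite theta2E mulr_gt0.
have [K [kq [mK Ki K2 Keven [Kq kq_out kq0]]]] := exists_kernel k0.
have Psi_up xi : xi != 0 -> Psi xi <= CPsi * enorm xi `^ alpha by move=> /Psi_bounds/andP[].
have h_lo xi : xi != 0 -> ch * enorm xi `^ (- beta) <= h xi by move=> /h_bounds/andP[].
have g1_le : 2 * alpha + beta <= k0 by rewrite /k0; move: H_ge; lra.
have H_le : 2 * H + 1 <= k0 by rewrite /k0; move: alpha_gt0 beta_gt0; lra.
pose c3 := spectral_constant d H CPsi ch alpha beta K kq.
have c30 : 0 < c3 by exact: spectral_constant_gt0.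
have cH := cHd_gt0 d H_ge H_lt1.
have dn0 : 0 < d.+1%:R :> R by rewrite ltr0n.
(* The factor [kap] shrinks the spatial scale so that [e^alpha <= a] for every [rho <= rmax], as the
   removal of the boundary term demands. *)
pose kap := Num.min 1 (a `^ alpha^-1 / (rmax / d.+1%:R) `^ theta2^-1).
have rm0 : 0 < (rmax / d.+1%:R) `^ theta2^-1 by apply: powR_gt0; exact: divr_gt0.
have kap0 : 0 < kap by rewrite lt_min ltr01 divr_gt0// powR_gt0.
(* The spectral bound is of order [e^(2 theta2)], and [e = kap (rho / d.+1)^(1 / theta2)] turns this
   into [kap^(2 theta2) rho^2 / d.+1^2]. *)
exists (cHd d H / 4 * (c3 * (kap `^ (2 * theta2) / d.+1%:R ^+ 2))).
  apply: mulr_gt0; first by rewrite divr_gt0.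
  by apply: mulr_gt0 => //; apply: divr_gt0; [exact: powR_gt0|exact: exprn_gt0].
move=> n p b i0 rho pa b1 rho0 rho_le sep.
have p0 i : 0 <= (p i).1 by rewrite (le_trans (ltW a0)).
pose s := (rho / d.+1%:R) `^ theta2^-1; pose e := kap * s.
have s0 : 0 < s by apply: powR_gt0; exact: divr_gt0.
have e0 : 0 < e by rewrite mulr_gt0.
have es : e <= s by rewrite ler_piMl ?(ltW s0)// ge_min lexx.
have ea : e `^ alpha <= (p i0).1.
  apply: le_trans (pa i0).
  have e_le : e <= a `^ alpha^-1.
    apply: (@le_trans _ _ (kap * (rmax / d.+1%:R) `^ theta2^-1)).
      rewrite ler_wpM2l ?(ltW kap0)//; apply: ge0_ler_powR.
      - by rewrite invr_ge0 ltW.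
      - by rewrite nnegrE divr_ge0 ?ltW.
      - by rewrite nnegrE divr_ge0 ?ltW.
      - by rewrite ler_pM2r// invr_gt0.
    by rewrite -ler_pdivlMr// ge_min lexx orbT.
  rewrite -[leRHS](powRr1 (ltW a0)) -(mulVf (lt0r_neq0 alpha_gt0)) powRrM.
  by apply: ge0_ler_powR; rewrite ?nnegrE ?powR_ge0 ?(ltW alpha_gt0) ?(ltW e0).
have sp i : i != i0 -> e `^ alpha <= `|(p i0).1 - (p i).1| \/
    exists j, e <= `|(p i0).2 ord0 j - (p i).2 ord0 j|.
  by move=> ii0; exact: (Delta_separation alpha_gt0 theta1_gt0 theta2E rho0 (ltW e0) (sep i ii0) es).
have LS i := mild_solution_spectral (p i).2 (p0 i).
have low := spectral_lower_bound levyX PsiX densityX d_ge1 H_ge CPsi_gt0 ch_gt0 alpha_gt0 beta_gt0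
  Psi_up h_lo mK Ki K2 Keven Kq kq_out kq0 g1_le H_le p0 b1 LS e0 ea sp.
apply: le_trans (wiener_lower_bound h_meas h_ge0 cH noiseW LS (fun i => solu (p i).2 (p0 i)) b).
have c4 : 0 <= cHd d H / 4 by apply: mulr_ge0; [exact: ltW|rewrite invr_ge0].
rewrite -mulrA; apply: ler_wpM2l => //; apply: le_trans low.
rewrite -/c3 -mulrA ler_wpM2l ?(ltW c30)// le_eqVlt; apply/orP; left; apply/eqP.
have -> : 2 * alpha * H - (d%:R - beta) = 2 * theta2.
  by rewrite theta2E theta1E; field; rewrite gt_eqF.
rewrite /e powRM ?(ltW kap0) ?(ltW s0)// -mulrA; congr (_ * _).
rewrite /s -powRrM (_ : theta2^-1 * (2 * theta2) = 2); last by field; rewrite gt_eqF.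
by rewrite powR_mulrn ?divr_ge0 ?(ltW rho0)// exprMn exprVn mulrC.
Qed.

End variance_lower_bound.

Unset Implicit Arguments.
Set Strict Implicit.
Set Printing Implicit Defensive.

Theorem lemma7p3 (R : realType) (d : nat) (H : R)
  (d_ge1 : (1 <= d)%N) (H_ge : 2^-1 <= H) (H_lt1 : H < 1)
  (* the symmetric Levy process, with exponent Psi and density p_t *)
  (dX : measure_display) (OmegaX : measurableType dX) (PX : probability OmegaX R)
  (X : R -> OmegaX -> 'rV[R]_d) (Psi : 'rV[R]_d -> R)
  (levyX : symmetric_levy PX X)
  (PsiX : char_exponent PX X Psi)
  (densityX : has_levy_density PX X Psi)
  (* the noise, with spectral density h *)
  (h : 'rV[R]_d -> R) (h_meas : measurable_fun setT h)
  (h_ge0 : forall xi, 0 <= h xi) (h_even : forall xi, h (- xi) = h xi)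
  (dO : measure_display) (Omega : measurableType dO) (P : probability Omega R)
  (W : (R * 'rV[R]_d -> R) -> {RV P >-> R})
  (noiseW : gaussian_noise H h W)
  (* the solution u(t,x) = W(G_{t,x}) *)
  (u : R -> 'rV[R]_d -> {RV P >-> R})
  (solu : mild_solution H h Psi W u)
  (* power bounds on Psi and h *)
  (cPsi CPsi ch Ch alpha beta : R)
  (cPsi_gt0 : 0 < cPsi) (CPsi_gt0 : 0 < CPsi) (ch_gt0 : 0 < ch) (Ch_gt0 : 0 < Ch)
  (alpha_gt0 : 0 < alpha) (alpha_le2 : alpha <= 2)
  (beta_gt0 : 0 < beta) (beta_ltd : beta < d%:R)
  (Psi_bounds : forall xi, xi != 0 ->
     cPsi * enorm xi `^ alpha <= Psi xi <= CPsi * enorm xi `^ alpha)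
  (h_bounds : forall xi, xi != 0 ->
     ch * enorm xi `^ (- beta) <= h xi <= Ch * enorm xi `^ (- beta))
  (theta1 theta2 : R)
  (theta1E : theta1 = H - (d%:R - beta) / (2 * alpha))
  (theta2E : theta2 = alpha * theta1)
  (theta1_gt0 : 0 < theta1) (theta2_lt1 : theta2 < 1)
  (* T = [a, b] x [lo, hi], a compact rectangle in (0, +oo) x R^d *)
  (a b : R) (lo hi : 'rV[R]_d) (a_gt0 : 0 < a) (a_leb : a <= b)
  (lo_lehi : forall j, lo ord0 j <= hi ord0 j) :
  exists2 c2 : R, 0 < c2 &
    (forall (n : nat) (p : R * 'rV[R]_d) (q : 'I_n.+1 -> R * 'rV[R]_d),
       rectangle a b lo hi p -> (forall j, rectangle a b lo hi (q j)) ->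
       {ae P, forall w,
         c2 * \big[Num.min/Delta theta1 theta2 p (q ord0) ^+ 2]_(j < n.+1)
                Delta theta1 theta2 p (q j) ^+ 2
         <= cond_var P (u p.1 p.2) (fun j => u (q j).1 (q j).2) w}) /\
    (forall p q : R * 'rV[R]_d,
       rectangle a b lo hi p -> rectangle a b lo hi q ->
       Num.sqrt c2 * Delta theta1 theta2 p q
       <= L2norm P (fun w => u p.1 p.2 w - u q.1 q.2 w)).
Proof.
(* The sum bounds the diameter of the rectangle for [Delta]; the 1 keeps [rmax] positive when the
   rectangle is a point. *)
pose rmax := 1 + ((b - a) `^ theta1 + \sum_(j < d) (hi ord0 j - lo ord0 j) `^ theta2).
have rmax0 : 0 < rmax.
  by rewrite ltr_pwDl// addr_ge0 ?powR_ge0// sumr_ge0// => j _; exact: powR_ge0.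
have theta1_ge0 : 0 <= theta1 by exact: ltW.
have Delta_rmax p q : rectangle a b lo hi p -> rectangle a b lo hi q ->
    Delta theta1 theta2 p q <= rmax.
  move=> Tp Tq; apply: (le_trans (Delta_rectangle_le alpha_gt0 theta1_gt0 theta2E Tp Tq)).
  by rewrite lerDr.
have [c2 c2_gt0 lower] := variance_lower_bound d_ge1 H_ge H_lt1 levyX PsiX densityX h_meas h_ge0
  noiseW solu cPsi_gt0 CPsi_gt0 ch_gt0 Ch_gt0 alpha_gt0 beta_gt0 beta_ltd Psi_bounds h_bounds
  theta1E theta2E theta1_gt0 a_gt0 rmax0.
have T_ge p : rectangle a b lo hi p -> a <= p.1 by move=> [/andP[]].
have T_ge0 p : rectangle a b lo hi p -> 0 <= p.1.
  by move=> /T_ge; exact: le_trans (ltW a_gt0).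
have uL2 t x : 0 <= t -> L2 P (u t x).
  exact: (mild_solution_L2 d_ge1 H_ge H_lt1 levyX PsiX densityX h_meas h_ge0 noiseW solu
    cPsi_gt0 Ch_gt0 alpha_gt0 beta_gt0 beta_ltd Psi_bounds h_bounds theta1E theta1_gt0 x).
exists c2 => //; split=> [n p q Tp Tq|p q Tp Tq].
- pose pt (i : 'I_n.+2) := if unlift ord0 i is Some j then q j else p.
  have pt0 : pt ord0 = p by rewrite /pt unlift_none.
  have ptS j : pt (lift ord0 j) = q j by rewrite /pt liftK.
  have Tpt i : rectangle a b lo hi (pt i) by rewrite /pt; case: unlift.
  pose wt b0 (bs : 'I_n.+1 -> R) (i : 'I_n.+2) := if unlift ord0 i is Some j then bs j else b0.
  have combE b0 bs w : \sum_i wt b0 bs i * u (pt i).1 (pt i).2 w =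
      b0 * u p.1 p.2 w + \sum_j bs j * u (q j).1 (q j).2 w.
    rewrite big_ord_recl /= pt0 /wt unlift_none; congr (_ + _).
    by apply: eq_bigr => j _; rewrite ptS liftK.
  pose Y := u p.1 p.2; pose V j := u (q j).1 (q j).2.
  have LY : L2 P Y by apply: uL2; exact: T_ge0.
  have LV j : L2 P (V j) by apply: uL2; exact: T_ge0.
  have G : jointly_gaussian P Y (fun j => V j : Omega -> R).
    move=> b0 bs L; have := mild_solution_gaussian d_ge1 H_ge H_lt1 levyX PsiX densityX h_meas
      h_ge0 noiseW solu cPsi_gt0 Ch_gt0 alpha_gt0 beta_gt0 beta_ltd Psi_bounds h_bounds theta1E
      theta1_gt0 (wt b0 bs) (fun i => T_ge0 _ (Tpt i)).
    by rewrite (funext (combE b0 bs)); under eq_Rintegral do rewrite combE;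
       under [X in _ /\ X = _]eq_Rintegral do rewrite combE.
  have [cf orth] := L2_projection LV LY.
  apply: filterS (cond_var_gaussian (fun j => (LV j).1) LY LV G orth) => w ->.
  (* The minimum is taken over squares, whereas the variance bound wants a distance; its square root
     is below every [Delta]. *)
  set m := \big[Num.min/_]_(j < n.+1) _; pose rho := Num.sqrt m.
  have m_le j : m <= Delta theta1 theta2 p (q j) ^+ 2 by exact: bigmin_le.
  have m0 : 0 <= m by apply: le_bigmin => [|j _]; exact: sqr_ge0.
  have rho2 : rho ^+ 2 = m by exact: sqr_sqrtr.
  have rho_le j : rho <= Delta theta1 theta2 p (q j).
    by rewrite -[leRHS]ger0_norm ?Delta_ge0// -sqrtr_sqr ler_wsqrtr.
  (* If [p] is at distance 0 from some conditioning point, the claim is only that a variance is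
     nonnegative. *)
  have [rho0|rho0] := leP rho 0.
    have -> : m = 0.
      by rewrite -rho2 (_ : rho = 0) ?expr0n//; apply/eqP; rewrite eq_le rho0 sqrtr_ge0.
    by rewrite mulr0; exact: dotL2_ge0.
  have b1 : wt 1 (fun j => - cf j) ord0 = 1 by rewrite /wt unlift_none.
  have sep i : i != ord0 -> rho <= Delta theta1 theta2 (pt ord0) (pt i).
    case: (unliftP ord0 i) => [j ->|->]; last by rewrite eqxx.
    by rewrite pt0 ptS => _; exact: rho_le.
  have := lower _ pt _ _ rho (fun i => T_ge _ (Tpt i)) b1 rho0
    (le_trans (rho_le ord0) (Delta_rmax _ _ Tp (Tq ord0))) sep.
  rewrite rho2 (_ : (fun w => _) = fun w => Y w - \sum_(j < n.+1) cf j * V j w)//.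
  apply/funext => w'; rewrite combE mul1r; congr (_ + _).
  by rewrite -sumrN; apply: eq_bigr => j _; rewrite mulNr.
(* The increment is itself a combination with coefficients 1 and -1, so the variance bound applies
   directly, without passing through the conditional variance. *)
- set D := Delta theta1 theta2 p q; have D_ge0 : 0 <= D by exact: Delta_ge0.
  pose pt (i : 'I_2) := if i == ord0 then p else q.
  pose wt (i : 'I_2) : R := if i == ord0 then 1 else -1.
  have Tpt i : rectangle a b lo hi (pt i) by rewrite /pt; case: ifP.
  have : c2 * D ^+ 2 <= \int[P]_w (u p.1 p.2 w - u q.1 q.2 w) ^+ 2.
    move: D_ge0; rewrite le_eqVlt => /predU1P[<-|D_gt0].
      by rewrite expr0n mulr0; apply: rintegral_ge0 => w; exact: sqr_ge0.
    have sep i : i != ord0 -> D <= Delta theta1 theta2 (pt ord0) (pt i).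
      by rewrite /pt eqxx => /negbTE ->.
    have b1 : wt ord0 = 1 by rewrite /wt eqxx.
    apply: le_trans (lower _ pt _ _ D (fun i => T_ge _ (Tpt i)) b1 D_gt0 (Delta_rmax _ _ Tp Tq) sep) _.
    rewrite le_eqVlt; apply/orP; left; apply/eqP; apply: eq_Rintegral => w _.
    by rewrite !big_ord_recl !big_ord0 /wt /pt /= addr0 mul1r mulN1r expr2.
  move=> /ler_wsqrtr; rewrite -/(L2norm P _).
  by rewrite sqrtrM ?(ltW c2_gt0)// sqrtr_sqr ger0_norm.
Qed.
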